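(* Let $1<p_1,p_2<\infty$, let $\mathbf A>1$ and $\mathbf T_{\mathrm{loc}}$ be constants. Suppose that $T$ is a perfect dyadic Calderón–Zygmund operator on $\mathbb R^n$, and that for $j=1,2$ there is a system $\{b^j_Q : Q\in\mathcal D\}$ of $p_j$-accretive functions with constant $\mathbf A$, such that for every dyadic cube $Q\in\mathcal D$ $$\int_Q |T b^1_Q|^{p_2'}\,dx\le \mathbf T_{\mathrm{loc}}^{p_2'}\,|Q|,\qquad \int_Q |T^* b^2_Q|^{p_1'}\,dx\le \mathbf T_{\mathrm{loc}}^{p_1'}\,|Q| .$$ Then $T$ extends to a bounded operator on $L^2(\mathbb R^n)$ and, moreover, its norm $\mathbf T$ satisfies $$\mathbf T\le C\,(1+\mathbf T_{\mathrm{loc}}),$$ where the constant $C$ depends only on $n$, $\mathbf A$, $p_1$, $p_2$.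
   Context: $\mathcal D$ denotes the collection of dyadic cubes in $\mathbb R^n$, and $|Q|$ is the Lebesgue measure of $Q$. For $1<p<\infty$, $p'$ is the dual exponent, $1/p+1/p'=1$. The exponents $p_1$ and $p_2$ are not related by duality (e.g. $1<p_1,p_2<2$ is allowed). Perfect (dyadic) Calderón–Zygmund operator: a linear operator $T$ for which there is a kernel $K(x,y)$ such that $$\langle Tf,g\rangle=\int_{\mathbb R^n}\int_{\mathbb R^n}K(x,y)f(y)g(x)\,dy\,dx$$ for all smooth, compactly supported $f,g$ the closures of whose supports do not intersect; the kernel satisfies the size condition $|K(x,y)|\le |x-y|^{-n}$; and for any two disjoint dyadic cubes $P,Q$, $K$ is constant on $P\times Q$. The implication of the last property that is meant is: if $f$ is supported on $P$ and $g$ is supported on $Q$, with $P,Q$ disjoint dyadic cubes, and at least one of $f,g$ has integral zero, then $\langle Tf,g\rangle=0$. The pairing is bilinear and $T^*$ is the adjoint, $\langle Tf,g\rangle=\langle f,T^*g\rangle$. It is part of the hypotheses that $Tb^1_Q$ and $T^*b^2_Q$ are well-defined functions on $Q$. $\mathbf T$ is the norm of $T$ on $L^2(\mathbb R^n)$: the best constant in $|\langle Tf,g\rangle|\le \mathbf T\|f\|_2\|g\|_2$. System of $p$-accretive functions with constant $\mathbf A>1$ (for fixed $1<p<\infty$): a collection $\{b_Q: Q\in\mathcal D\}$ such that for each dyadic cube $Q$: (1) $b_Q$ is supported on $Q$ and $\int_Q b_Q(x)\,dx=|Q|$; (2) $\|b_Q\|_p\le \mathbf A|Q|^{1/p}$.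 *)

(* Defs.v *)
From HB Require Import structures.
From mathcomp Require Import all_boot all_order all_algebra.
From mathcomp Require Import all_classical all_reals all_analysis.

Set Implicit Arguments.
Unset Strict Implicit.
Unset Printing Implicit Defensive.
Import Order.TTheory GRing.Theory Num.Theory.
Import numFieldNormedType.Exports.

Local Open Scope classical_set_scope.
Local Open Scope ring_scope.

Section rV_measurable.
Context {R : realType} (n : nat).

Definition rV_coord (i : 'I_n) (x : 'rV[R]_n) : measurableTypeR R := x ord0 i.

Let rV_set0 : g_sigma_preimage rV_coord set0.
Proof. exact: sigma_algebra0. Qed.

Let rV_setC A : g_sigma_preimage rV_coord A -> g_sigma_preimage rV_coord (~` A).
Proof. exact: sigma_algebraC. Qed.

Let rV_bigcup (F : (set 'rV[R]_n)^nat) :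
  (forall i, g_sigma_preimage rV_coord (F i)) ->
  g_sigma_preimage rV_coord (\bigcup_i (F i)).
Proof. exact: sigma_algebra_bigcup. Qed.

HB.instance Definition _ := @isMeasurable.Build default_measure_display
  'rV[R]_n (g_sigma_preimage rV_coord) rV_set0 rV_setC rV_bigcup.

Lemma measurable_rV_coord i : measurable_fun [set: 'rV[R]_n] (rV_coord i).
Proof.
move=> _ A mA; rewrite setTI; apply: sub_sigma_algebra => /=.
rewrite -bigcup_seq/=; exists i => /=; first by rewrite mem_index_enum.
by exists A => //; rewrite setTI.
Qed.

Lemma measurable_fun_rV d (T : measurableType d) (f : T -> 'rV[R]_n) :
  (forall i, measurable_fun [set: T] (rV_coord i \o f)) ->
  measurable_fun [set: T] f.
Proof.
move=> mf _ A mA; rewrite setTI.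
suff : g_sigma_preimage (fun i => rV_coord i \o f) `<=` measurable.
  apply; rewrite g_sigma_preimage_comp.
  by exists A => //; rewrite setTI.
apply: smallest_sub; first exact: sigma_algebra_measurable.
move=> B; rewrite -bigcup_seq/= => -[i _ [C mC <-]].
exact: mf.
Qed.

End rV_measurable.

Section rV_cons.
Context {R : realType} (n : nat).

Definition rV_cons (x : measurableTypeR R * 'rV[R]_n) : 'rV[R]_n.+1 :=
  \row_i if unlift ord0 i is Some j then x.2 ord0 j else x.1.

Definition rV_uncons (v : 'rV[R]_n.+1) : measurableTypeR R * 'rV[R]_n :=
  (v ord0 ord0, \row_i v ord0 (lift ord0 i)).

Lemma rV_cons0 x : rV_cons x ord0 ord0 = x.1.
Proof. by rewrite mxE unlift_none. Qed.

Lemma rV_consS x i : rV_cons x ord0 (lift ord0 i) = x.2 ord0 i.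
Proof. by rewrite mxE liftK. Qed.

Lemma rV_consK : cancel rV_cons rV_uncons.
Proof.
move=> [a v]; rewrite /rV_uncons rV_cons0/=; congr pair.
by apply/rowP => i; rewrite mxE -[RHS](rV_consS (a, v)).
Qed.

Lemma rV_unconsK : cancel rV_uncons rV_cons.
Proof.
move=> v; apply/rowP => i; have [j ->|->] := unliftP ord0 i.
  by rewrite (rV_consS (rV_uncons v)) mxE.
by rewrite (rV_cons0 (rV_uncons v)).
Qed.

Lemma measurable_rV_cons : measurable_fun [set: _] rV_cons.
Proof.
apply: measurable_fun_rV => i; have [j ->|->] := unliftP ord0 i.
  rewrite (_ : _ \o _ = rV_coord j \o snd).
    by apply: measurableT_comp => //; exact: measurable_rV_coord.
  by apply/funext => x /=; rewrite /rV_coord rV_consS.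
rewrite (_ : _ \o _ = fst) //.
by apply/funext => x /=; rewrite /rV_coord rV_cons0.
Qed.

Lemma measurable_rV_uncons : measurable_fun [set: _] rV_uncons.
Proof.
apply/measurable_fun_pairP; split.
  exact: (measurable_rV_coord ord0).
apply: measurable_fun_rV => i.
rewrite (_ : _ \o _ = rV_coord (lift ord0 i)); first exact: measurable_rV_coord.
by apply/funext => x /=; rewrite /rV_coord/= mxE.
Qed.

Variable mu : {sigma_finite_measure set 'rV[R]_n -> \bar R}.

Definition lebesgue_cons : set 'rV[R]_n.+1 -> \bar R :=
  pushforward (lebesgue_measure \x mu)%E rV_cons.

Let mE A : measurable A -> measurable (rV_cons @^-1` A).
Proof.
by move=> mA; rewrite -[X in measurable X]setTI; exact: measurable_rV_cons.
Qed.

Let lebesgue_cons0 : lebesgue_cons set0 = 0%E.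
Proof. by rewrite /lebesgue_cons /pushforward preimage_set0 measure0. Qed.

Let lebesgue_cons_ge0 A : (0 <= lebesgue_cons A)%E.
Proof. exact: (@measure_ge0 _ _ _ (lebesgue_measure \x mu)%E). Qed.

Let lebesgue_cons_sigma_additive : semi_sigma_additive lebesgue_cons.
Proof.
move=> F mF tF mUF; rewrite /lebesgue_cons /pushforward preimage_bigcup.
apply: measure_semi_sigma_additive.
- by move=> k; exact: mE.
- apply/trivIsetP => /= i j _ _ ij; rewrite -preimage_setI.
  by move/trivIsetP : tF => /(_ _ _ _ _ ij) ->//; rewrite preimage_set0.
- by rewrite -preimage_bigcup; exact: mE.
Qed.

HB.instance Definition _ := isMeasure.Build _ _ _ lebesgue_cons
  lebesgue_cons0 lebesgue_cons_ge0 lebesgue_cons_sigma_additive.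

Let lebesgue_cons_sigma_finite : sigma_finite setT lebesgue_cons.
Proof.
have /sigma_finiteP[F [TF ndF Foo]] := sigma_finiteT (@lebesgue_measure R).
have /sigma_finiteP[G [TG ndG Goo]] := sigma_finiteT mu.
exists (fun k => rV_uncons @^-1` (F k `*` G k)).
  apply/esym; rewrite -subTset => v _.
  have [k _ Fk] : (\bigcup_k F k) (rV_uncons v).1 by rewrite -TF.
  have [l _ Gl] : (\bigcup_k G k) (rV_uncons v).2 by rewrite -TG.
  exists (maxn k l) => //; split.
    by move: Fk; exact/subsetPset/ndF/leq_maxl.
  by move: Gl; exact/subsetPset/ndG/leq_maxr.
move=> k; have [mF Fk] := Foo k; have [mG Gk] := Goo k; split.
  rewrite -[X in measurable X]setTI; apply: measurable_rV_uncons => //.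
  exact: measurableX.
rewrite /lebesgue_cons /pushforward -comp_preimage.
rewrite (_ : _ \o _ = id); last by apply/funext => x; exact: rV_consK.
by rewrite preimage_id product_measure1E// lte_mul_pinfty// ge0_fin_numE.
Qed.

HB.instance Definition _ := Measure_isSigmaFinite.Build _ _ _ lebesgue_cons
  lebesgue_cons_sigma_finite.

End rV_cons.

(* Lebesgue measure on R^n (restricted to the Borel sets), as the n-fold
   product of the one-dimensional one. *)
Fixpoint lebesgue_rV {R : realType} n :
    {sigma_finite_measure set 'rV[R]_n -> \bar R} :=
  match n with
  | 0 => \d_(0 : 'rV[R]_0)
  | n'.+1 => lebesgue_cons (lebesgue_rV n')
  end.
Arguments lebesgue_rV {R} n.

Lemma measurable_rV_box (R : realType) n (a b : 'I_n -> R) :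
  measurable [set x : 'rV[R]_n | forall i, a i <= x ord0 i < b i].
Proof.
rewrite (_ : [set _ | _] =
  \big[setI/setT]_(i < n) (rV_coord i @^-1` `[a i, b i[)).
  apply: bigsetI_measurable => i _; rewrite -[X in measurable X]setTI.
  exact: measurable_rV_coord.
rewrite -bigcap_seq; apply/seteqP; split => x /= h i.
  by rewrite /= /rV_coord in_itv/=.
by have := h i; rewrite /= /rV_coord in_itv/= mem_index_enum => ->.
Qed.

Lemma lebesgue_rV_box (R : realType) n (a b : 'I_n -> R) :
  (forall i, a i <= b i) ->
  lebesgue_rV n [set x : 'rV[R]_n | forall i, a i <= x ord0 i < b i] =
  (\prod_i (b i - a i))%:E.
Proof.
elim: n a b => [|n IH] a b ab.
  rewrite big_ord0 /= diracE mem_set//= => -[] //.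
rewrite big_ord_recl/= /lebesgue_cons /pushforward EFinM.
rewrite -(IH (fun i => a (lift ord0 i)) (fun i => b (lift ord0 i)))//.
have <- : lebesgue_measure `[a ord0, b ord0[ = (b ord0 - a ord0)%:E.
  rewrite lebesgue_measure_itv/= lte_fin; case: ltP => // ba.
  by have -> : b ord0 = a ord0 by [apply/eqP; rewrite eq_le ba ab]; rewrite subrr.
rewrite -product_measure1E//; last exact: measurable_rV_box.
congr (_ _); apply/seteqP; split => [[x v]|[x v]]/=.
- move=> h; split; first by have := h ord0; rewrite rV_cons0 in_itv.
  by move=> i; have := h (lift ord0 i); rewrite rV_consS.
- rewrite in_itv/= => -[h1 h2] i; have [j ->|->] := unliftP ord0 i.
    by rewrite rV_consS.
  by rewrite rV_cons0.
Qed.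

Section dyadic.
Context {R : realType} (n : nat).
Implicit Types f g : 'rV[R]_n -> R.

Definition dyadic_cube (k : int) (m : 'rV[int]_n) : set 'rV[R]_n :=
  [set x | forall i, (m ord0 i)%:~R * 2 ^ k <= x ord0 i
                     < (m ord0 i + 1)%:~R * 2 ^ k].

Definition dyadic : set (set 'rV[R]_n) :=
  [set Q | exists k m, Q = dyadic_cube k m].

(* The norm of the normed module 'rV[R]_n is the sup norm. *)
Definition euclidean_norm (x : 'rV[R]_n) : R := Num.sqrt (\sum_i x ord0 i ^+ 2).

Definition supported f (Q : set 'rV[R]_n) := forall x, ~ Q x -> f x = 0.

Definition closed_support f : set 'rV[R]_n := closure [set x | f x != 0].

Definition partial (i : 'I_n) f : 'rV[R]_n -> R :=
  fun x => 'D_(delta_mx ord0 i) f x.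

Definition smooth f := forall s : seq 'I_n,
  let h := foldr partial f s in
  continuous h /\ forall i x, derivable h x (delta_mx ord0 i).

Definition test_function f := smooth f /\ compact (closed_support f).

Definition loc_integrable f := measurable_fun setT f /\
  forall K, compact K -> (\int[lebesgue_rV n]_(x in K) `|f x|%:E < +oo)%E.

Definition pairing f g : R := \int[lebesgue_rV n]_x (f x * g x).

(* What is required of the class of functions on which an operator is given:
   the smooth compactly supported functions alone would not do, since the
   operator is applied to accretive functions and to their restrictions to
   dyadic cubes. *)
Record operator_domain (D : set ('rV[R]_n -> R)) : Prop := {
  domain_smooth : test_function `<=` D ;
  domain_linear : forall a f g, D f -> D g -> D (fun x => a * f x + g x) ;
  domain_cube : forall Q f, dyadic Q -> D f -> D (fun x => \1_Q x * f x) ;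
  domain_loc_integrable : D `<=` loc_integrable }.

(* T, given on D1, and Tadj, given on D2, take functions to functions and are
   adjoint to each other for the bilinear pairing; no boundedness is assumed. *)
Record adjoint_operators (D1 D2 : set ('rV[R]_n -> R))
    (T Tadj : ('rV[R]_n -> R) -> ('rV[R]_n -> R)) : Prop := {
  op_linear : forall a f g, D1 f -> D1 g ->
    T (fun x => a * f x + g x) = (fun x => a * T f x + T g x)
      %[ae lebesgue_rV n] ;
  op_measurable : forall f, D1 f -> measurable_fun setT (T f) ;
  adj_measurable : forall g, D2 g -> measurable_fun setT (Tadj g) ;
  op_integrable : forall f g, D1 f -> D2 g ->
    (lebesgue_rV n).-integrable setT (fun x => (T f x * g x)%:E) ;
  adj_integrable : forall f g, D1 f -> D2 g ->
    (lebesgue_rV n).-integrable setT (fun x => (f x * Tadj g x)%:E) ;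
  op_adj : forall f g, D1 f -> D2 g -> pairing (T f) g = pairing f (Tadj g) }.

Record perfect_kernel (D1 D2 : set ('rV[R]_n -> R))
    (T : ('rV[R]_n -> R) -> ('rV[R]_n -> R))
    (K : 'rV[R]_n -> 'rV[R]_n -> R) : Prop := {
  kernel_repr : forall f g, test_function f -> test_function g ->
    closed_support f `&` closed_support g = set0 ->
    pairing (T f) g =
      \int[lebesgue_rV n]_x \int[lebesgue_rV n]_y (K x y * f y * g x) ;
  kernel_size : forall x y, x != y -> `|K x y| <= euclidean_norm (x - y) ^- n ;
  kernel_const : forall P Q, dyadic P -> dyadic Q -> P `&` Q = set0 ->
    forall x x' y y', P x -> P x' -> Q y -> Q y' -> K x y = K x' y' ;
  kernel_perfect : forall P Q f g,
    dyadic P -> dyadic Q -> P `&` Q = set0 ->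
    D1 f -> D2 g -> supported f P -> supported g Q ->
    \int[lebesgue_rV n]_x f x = 0 \/ \int[lebesgue_rV n]_x g x = 0 ->
    pairing (T f) g = 0 }.

Definition perfect_dyadic_CZ (D1 D2 : set ('rV[R]_n -> R))
    (T Tadj : ('rV[R]_n -> R) -> ('rV[R]_n -> R)) : Prop :=
  [/\ operator_domain D1, operator_domain D2, adjoint_operators D1 D2 T Tadj
    & exists K, perfect_kernel D1 D2 T K].

Definition accretive_system (p A : R)
    (b : set 'rV[R]_n -> 'rV[R]_n -> R) : Prop :=
  forall Q, dyadic Q ->
  [/\ measurable_fun setT (b Q), supported (b Q) Q,
      (\int[lebesgue_rV n]_(x in Q) (b Q x)%:E = lebesgue_rV n Q)%E
    & ('N[lebesgue_rV n]_(p%:E)[EFin \o b Q]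
       <= A%:E * lebesgue_rV n Q `^ p^-1)%E].

Local Notation L2 := (Lfun (lebesgue_rV n) 2%:E).
Local Notation L2norm f := ('N[lebesgue_rV n]_(2%:E)[EFin \o f])%E.

Record L2_bounded_operator (S : ('rV[R]_n -> R) -> ('rV[R]_n -> R)) : Prop := {
  L2_op_stable : forall f, f \in L2 -> S f \in L2 ;
  L2_op_linear : forall a f g, f \in L2 -> g \in L2 ->
    S (fun x => a * f x + g x) = (fun x => a * S f x + S g x)
      %[ae lebesgue_rV n] ;
  L2_op_bounded : exists M : R,
    forall f, f \in L2 -> (L2norm (S f) <= M%:E * L2norm f)%E }.

Definition L2_operator_norm (S : ('rV[R]_n -> R) -> ('rV[R]_n -> R)) : \bar R :=
  ereal_inf [set M%:E | M in [set M : R | 0 <= M /\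
    forall f g, f \in L2 -> g \in L2 ->
      (`|pairing (S f) g|%:E <= M%:E * L2norm f * L2norm g)%E]].

End dyadic.

(* Main.v *)
(* On functions that are constant on the dyadic cubes of some generation,
   perfectness reduces <T f, g> to an off-diagonal form, a sum over pairs of
   sibling cubes with coefficients of size at most 1/|J|, and a diagonal one,
   given by the numbers w(J) = <T 1_J, 1_J>.

   Off-diagonal part, for |f|, |g| <= 1 on a cube: f and g are compared with the
   multiples of b^1_P and b^2_P that have the same averages, P being replaced by
   a smaller cube as soon as the average of b_P drops below 1/2 or the average
   of |b_P|^p + |T b_P|^q becomes large.  The stopping cubes are a Carleson
   family, and between them the error is a sum of products of martingale
   differences, which is absorbed by a potential made of squares of averages.
   Sparse domination improves this to an L2 bound.

   Diagonal part: |w(J)| <= C|J| holds up to an error that vanishes with the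
   generation on the cubes where b^1_Q has not stopped.  On the stopping cubes,
   which cover at most a fraction 1 - 1/(4C) of Q, the estimate is iterated; the
   remainder is finite because T* 1_Q is integrable on Q.

   The form is thus bounded on step functions, and the extension of T maps f to
   the L2 density of the set function J -> <f, T* 1_J>. *)

From HB Require Import structures.
From mathcomp Require Import all_boot all_order all_algebra.
From mathcomp Require Import ring lra.

Set Implicit Arguments.
Unset Strict Implicit.
Unset Printing Implicit Defensive.
Import Order.TTheory GRing.Theory Num.Theory.

Local Open Scope ring_scope.

(** * Dyadic forms on finite trees *)

(** For exponents below 2 the functions b need not be square integrable, so they admit no square
    function estimate. Only their averages over cubes that have not stopped are used: these are
    bounded, and so are the averages of the truncated singular integrals of b. The off-diagonal form
    of b^1 and b^2 is handled by summation by parts: with the truncated value of T b^1 on J, times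
    the integral of b^2 over J, added to it, it becomes additive over the children. A bound is then
    needed only where the recursion ends, and there the off-diagonal part is empty. Squares of
    averages of such additive quantities form the potential.

    The diagonal is kept out of this argument because w(J) has no a priori size: T is not assumed
    bounded in any sense. It is treated afterwards, and the L2 bound of the off-diagonal form is an
    ingredient. The level at which the adjoint image of 1_Q is cut and the number of iterations
    depend on T and Q, but they occur only in terms that can be made at most |Q|; this keeps the
    final constant uniform. *)

Section OneStep.
Context {R : realFieldType} {iota : finType}.
Implicit Types (m x y : iota -> R).

(** The quotient is Lipschitz here: u/p - U/P = (u - U)/p + U (P - p)/(p P), where 1/p and 1/P are
    at most 2. The constants are 2 * 2^2 and 2 * 4^2. *)
Lemma quotient_diff_sqr (u U p P : R) : `|U| <= 1 -> 2^-1 <= p -> 2^-1 <= P ->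
  (u / p - U / P) ^+ 2 <= 8 * (u - U) ^+ 2 + 32 * (p - P) ^+ 2.
Proof.
move=> U1 hp hP.
have p0 : 0 < p by lra.
have P0 : 0 < P by lra.
have -> : u / p - U / P = (u - U) / p + U * (P - p) * (p^-1 * P^-1).
  by field; rewrite !gt_eqF.
have ip : p^-1 <= 2 by rewrite invf_ple ?posrE//; lra.
have iP : P^-1 <= 2 by rewrite invf_ple ?posrE//; lra.
have ip0 : 0 < p^-1 by rewrite invr_gt0.
have iP0 : 0 < P^-1 by rewrite invr_gt0.
set x := (u - U) / p; set y := U * _ * _.
have hx : x ^+ 2 <= 4 * (u - U) ^+ 2.
  rewrite /x exprMn mulrC ler_wpM2r ?sqr_ge0//.
  have -> : (4 : R) = 2 ^+ 2 by rewrite -natrX.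
  by rewrite ler_pXn2r ?nnegrE ?(ltW ip0).
have hy : y ^+ 2 <= 16 * (p - P) ^+ 2.
  rewrite /y -(sqrrN (p - P)) opprB !exprMn.
  have h1 : U ^+ 2 <= 1 by rewrite -real_normK ?num_real// expr_le1.
  have h2 : (p^-1 ^+ 2 * P^-1 ^+ 2) <= 16.
    have -> : (16 : R) = (2 * 2) ^+ 2 by rewrite -natrM -natrX.
    by rewrite -exprMn ler_pXn2r ?nnegrE ?mulr_ge0 ?ler_pM ?(ltW ip0) ?(ltW iP0).
  rewrite -[P - p]opprB sqrrN mulrAC ler_wpM2r ?sqr_ge0//.
  rewrite -[leRHS]mul1r; apply: ler_pM h1 h2; first exact: sqr_ge0.
  by rewrite mulr_ge0 ?sqr_ge0.
have := sqr_ge0 (x - y); rewrite sqrrD sqrrB; lra.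
Qed.

(** When [X] is the average of [x] with weights [m], this is the squared L2 norm of one martingale
    difference. *)
Definition wvar m x (X : R) := \sum_i m i * (x i - X) ^+ 2.

Lemma wvar_ge0 m x X : (forall i, 0 < m i) -> 0 <= wvar m x X.
Proof. by move=> m0; apply: sumr_ge0 => i _; rewrite mulr_ge0 ?sqr_ge0 ?ltW. Qed.

Lemma wvarE m x X M : M = \sum_i m i -> M * X = \sum_i m i * x i ->
  wvar m x X = \sum_i m i * x i ^+ 2 - M * X ^+ 2.
Proof.
move=> hM hX; rewrite /wvar.
rewrite (eq_bigr (fun i => m i * x i ^+ 2 - 2 * X * (m i * x i) + m i * X ^+ 2));
  last by move=> i _; ring.
rewrite big_split sumrB/= -mulr_sumr -mulr_suml -hX -hM; ring.
Qed.

Lemma wcov_le m x y (X Y : R) : (forall i, 0 < m i) ->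
  `|\sum_i m i * ((x i - X) * (y i - Y))| <= (wvar m x X + wvar m y Y) / 2.
Proof.
move=> m0; rewrite (le_trans (ler_norm_sum _ _ _))//.
rewrite /wvar -big_split/= mulr_suml ler_sum// => i _.
rewrite -mulrDr -mulrA normrM (gtr0_norm (m0 i)) ler_wpM2l ?(ltW (m0 i))//.
rewrite ler_norml; apply/andP; split.
  have := sqr_ge0 ((x i - X) + (y i - Y)); rewrite sqrrD; lra.
have := sqr_ge0 ((x i - X) - (y i - Y)); rewrite sqrrB; lra.
Qed.

Variables (B M : R) (m u v p q w z X : iota -> R) (k : iota -> iota -> R).
Variables (U V P Q W Z t1 t2 : R).
Hypothesis B1 : 1 <= B.
Hypothesis m0 : forall i, 0 < m i.
Hypothesis hM : M = \sum_i m i.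
Hypothesis M0 : 0 < M.
Hypothesis hk : forall i j, i != j -> `|k i j| * M <= B.
Hypothesis hp : forall i, 2^-1 <= p i <= B.
Hypothesis hq : forall i, 2^-1 <= q i <= B.
Hypothesis hX : forall i, `|X i| <= 2 * B ^+ 2 * m i.
Hypothesis hU : `|U| <= 1.
Hypothesis hV : `|V| <= 1.
Hypothesis hP : 2^-1 <= P.
Hypothesis hQ : 2^-1 <= Q.
Hypothesis hW : `|W| <= B ^+ 2.
Hypothesis hZ : `|Z| <= B ^+ 2.
Hypothesis sU : M * U = \sum_i m i * u i.
Hypothesis sV : M * V = \sum_i m i * v i.
Hypothesis sP : M * P = \sum_i m i * p i.
Hypothesis sQ : M * Q = \sum_i m i * q i.
Hypothesis hw : forall j,
  \sum_(i | i != j) k i j * (m i * p i) * (m j * q j) + X j =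
  m j * w j - t1 * (m j * q j).
Hypothesis hz : forall i,
  \sum_(j | j != i) k i j * (m i * p i) * (m j * q j) + X i =
  m i * z i - t2 * (m i * p i).

Let a i := u i / p i.
Let c i := v i / q i.
Let aJ := U / P.
Let cJ := V / Q.
Let da i := a i - aJ.
Let dc i := c i - cJ.

Let p0 i : 0 < p i. Proof. by have /andP[+ _] := hp i; apply: lt_le_trans; lra. Qed.
Let q0 i : 0 < q i. Proof. by have /andP[+ _] := hq i; apply: lt_le_trans; lra. Qed.

Let P0 : 0 < P. Proof. by apply: lt_le_trans hP; rewrite invr_gt0. Qed.
Let Q0 : 0 < Q. Proof. by apply: lt_le_trans hQ; rewrite invr_gt0. Qed.

Let SA := \sum_i m i * da i ^+ 2.
Let SC := \sum_i m i * dc i ^+ 2.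

Let SA_le : SA <= 8 * wvar m u U + 32 * wvar m p P.
Proof.
rewrite /SA /wvar !mulr_sumr -big_split/= ler_sum// => i _.
rewrite (mulrCA 8) (mulrCA 32) -mulrDr ler_wpM2l ?(ltW (m0 i))//.
by apply: quotient_diff_sqr => //; have /andP[] := hp i.
Qed.

Let SC_le : SC <= 8 * wvar m v V + 32 * wvar m q Q.
Proof.
rewrite /SC /wvar !mulr_sumr -big_split/= ler_sum// => i _.
rewrite (mulrCA 8) (mulrCA 32) -mulrDr ler_wpM2l ?(ltW (m0 i))//.
by apply: quotient_diff_sqr => //; have /andP[] := hq i.
Qed.

Let SA0 : 0 <= SA.
Proof. by apply: sumr_ge0 => i _; rewrite mulr_ge0 ?sqr_ge0 ?ltW. Qed.
Let SC0 : 0 <= SC.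
Proof. by apply: sumr_ge0 => i _; rewrite mulr_ge0 ?sqr_ge0 ?ltW. Qed.

Let dap : \sum_i da i * (m i * p i) = 0.
Proof.
rewrite (eq_bigr (fun i => m i * u i - aJ * (m i * p i)));
  last by move=> i _; rewrite /da /a; field; rewrite gt_eqF.
rewrite sumrB -mulr_sumr -sU -sP /aJ; field.
by rewrite gt_eqF.
Qed.

Let dcq : \sum_i dc i * (m i * q i) = 0.
Proof.
rewrite (eq_bigr (fun i => m i * v i - cJ * (m i * q i)));
  last by move=> i _; rewrite /dc /c; field; rewrite gt_eqF.
rewrite sumrB -mulr_sumr -sV -sQ /cJ; field.
by rewrite gt_eqF.
Qed.

Let lam (f g : iota -> R) := \sum_i \sum_(j | j != i) k i j * (m i * f i) * (m j * g j).

Let T1 := \sum_i \sum_(j | j != i) k i j * (m i * p i) * (m j * q j) * (da i * dc j).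
Let T2 := \sum_i da i * dc i * X i.
Let T3 := \sum_j dc j * (m j * w j).
Let T4 := \sum_i da i * (m i * z i).

Let lamE (f : iota -> iota -> R) : \sum_i \sum_(j | j != i) f i j =
  \sum_j \sum_(i | i != j) f i j.
Proof.
rewrite (exchange_big_dep xpredT)//=; apply: eq_bigr => j _.
by apply: eq_bigl => i; rewrite eq_sym.
Qed.

(** In the application [u], [v] are the averages of the two functions over the children, [p], [q]
    those of the accretive functions, and [X] the off-diagonal forms of the latter inside the
    children. Writing [u i = (aJ + da i) * p i] and [v j = (cJ + dc j) * q j] expands the form into
    four parts. Those linear in [da] or [dc] are summed by [hz] and [hw]; the terms in [t2] and [t1]
    cancel by [dap] and [dcq]. *)
Let identity :
  lam u v - aJ * cJ * (lam p q + \sum_i X i) + \sum_i a i * c i * X i =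
  T1 + T2 + aJ * T3 + cJ * T4.
Proof.
have -> : T3 = \sum_j \sum_(i | i != j) dc j * (k i j * (m i * p i) * (m j * q j)) +
    \sum_j dc j * X j.
  rewrite -big_split/=; under [RHS]eq_bigr => j _ do rewrite -mulr_sumr -mulrDr.
  under [RHS]eq_bigr => j _ do rewrite hw mulrBr [dc j * (t1 * _)]mulrCA.
  by rewrite sumrB -mulr_sumr dcq mulr0 subr0.
have -> : T4 = \sum_i da i * (\sum_(j | j != i) k i j * (m i * p i) * (m j * q j)) +
    \sum_i da i * X i.
  rewrite -big_split/=; under [RHS]eq_bigr => j _ do rewrite -mulrDr.
  under [RHS]eq_bigr => j _ do rewrite hz mulrBr [da j * (t2 * _)]mulrCA.
  by rewrite sumrB -mulr_sumr dap mulr0 subr0.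
rewrite -lamE /T1 /T2 /lam.
have -> : \sum_i \sum_(j | j != i) k i j * (m i * u i) * (m j * v j) =
   \sum_i \sum_(j | j != i)
     (k i j * (m i * p i) * (m j * q j) * (da i * dc j) +
      aJ * (dc j * (k i j * (m i * p i) * (m j * q j))) +
      cJ * (da i * (k i j * (m i * p i) * (m j * q j))) +
      aJ * cJ * (k i j * (m i * p i) * (m j * q j))).
  apply: eq_bigr => i _; apply: eq_bigr => j _.
  have -> : u i = a i * p i by rewrite /a mulfVK// gt_eqF.
  have -> : v j = c j * q j by rewrite /c mulfVK// gt_eqF.
  rewrite /da /dc; ring.
have -> : \sum_i a i * c i * X i =
   \sum_i (da i * dc i * X i + aJ * (dc i * X i) + cJ * (da i * X i) + aJ * cJ * X i).
  by apply: eq_bigr => i _; rewrite /da /dc; ring.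
under eq_bigr => i _ do rewrite !big_split/= -!mulr_sumr.
rewrite !big_split/= -!mulr_sumr; ring.
Qed.

Let T1_le : `|T1| <= B ^+ 3 / 2 * (SA + SC).
Proof.
have hij i j : j != i -> `|k i j * (m i * p i) * (m j * q j) * (da i * dc j)|
   <= B ^+ 3 / 2 * M^-1 * (m i * m j * (da i ^+ 2 + dc j ^+ 2)).
  move=> ji; rewrite !normrM (gtr0_norm (m0 i)) (gtr0_norm (m0 j)).
  rewrite (gtr0_norm (p0 i)) (gtr0_norm (q0 j)).
  have h1 : `|k i j| <= B * M^-1 by rewrite ler_pdivlMr// hk// eq_sym.
  have h2 : `|da i| * `|dc j| <= (da i ^+ 2 + dc j ^+ 2) / 2.
    have := sqr_ge0 (`|da i| - `|dc j|); rewrite sqrrB !real_normK ?num_real//; lra.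
  have h3 : p i * q j <= B ^+ 2.
    have /andP[_ pB] := hp i; have /andP[_ qB] := hq j.
    by rewrite expr2 ler_pM ?(ltW (p0 _)) ?(ltW (q0 _)).
  rewrite (_ : `|k i j| * (m i * p i) * (m j * q j) * (`|da i| * `|dc j|) =
     (m i * m j) * (`|k i j| * ((p i * q j) * (`|da i| * `|dc j|)))); last by ring.
  rewrite (_ : B ^+ 3 / 2 * M^-1 * (m i * m j * (da i ^+ 2 + dc j ^+ 2)) =
     (m i * m j) * (B * M^-1 * (B ^+ 2 * ((da i ^+ 2 + dc j ^+ 2) / 2)))); last by ring.
  have pq0 : 0 <= p i * q j by rewrite mulr_ge0// ltW.
  rewrite ler_wpM2l ?mulr_ge0 ?(ltW (m0 _))//.
  apply: ler_pM => //; first by apply: mulr_ge0 => //; apply: mulr_ge0.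
  by apply: ler_pM => //; apply: mulr_ge0.
have B3 : 0 <= B ^+ 3 / 2.
  by rewrite divr_ge0// exprn_ge0// (le_trans _ B1).
have BM0 : 0 <= B ^+ 3 / 2 * M^-1 by rewrite mulr_ge0 ?invr_ge0 ?(ltW M0).
rewrite (le_trans (ler_norm_sum _ _ _))//.
apply: (@le_trans _ _ (\sum_i \sum_j B ^+ 3 / 2 * M^-1 * (m i * m j * (da i ^+ 2 + dc j ^+ 2)))).
  apply: ler_sum => i _; rewrite (le_trans (ler_norm_sum _ _ _))//.
  rewrite [leRHS](bigID (fun j => j != i))/= -[leLHS]addr0 lerD//.
    by apply: ler_sum => j ji; exact: hij.
  apply: sumr_ge0 => j _; rewrite mulr_ge0//.
  by apply: mulr_ge0; [apply: mulr_ge0; exact: ltW|rewrite addr_ge0 ?sqr_ge0].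
under eq_bigr => i _ do rewrite -mulr_sumr.
rewrite -mulr_sumr -mulrA ler_wpM2l//.
rewrite mulrC ler_pdivrMr//.
under eq_bigr => i _.
  rewrite (eq_bigr (fun j => m i * da i ^+ 2 * m j + m i * (m j * dc j ^+ 2)));
    last by move=> j _; ring.
  rewrite big_split/= -!mulr_sumr -hM.
  over.
by rewrite big_split/= -!mulr_suml -hM -/SA -/SC [M * SC]mulrC mulrDl.
Qed.

Let T2_le : `|T2| <= B ^+ 2 * (SA + SC).
Proof.
rewrite (le_trans (ler_norm_sum _ _ _))// mulrDr /SA /SC !mulr_sumr -big_split/=.
apply: ler_sum => i _; rewrite !normrM.
have h2 : `|da i| * `|dc i| <= (da i ^+ 2 + dc i ^+ 2) / 2.
  have := sqr_ge0 (`|da i| - `|dc i|); rewrite sqrrB !real_normK ?num_real//; lra.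
have h3 : `|da i| * `|dc i| * `|X i| <= (da i ^+ 2 + dc i ^+ 2) / 2 * (2 * B ^+ 2 * m i).
  by rewrite ler_pM ?mulr_ge0.
lra.
Qed.

(** Centering [w] at [W] leaves a covariance and [W] times the plain mean of [dc]. That mean is of
    second order too: [dc] has mean zero against [q], so [Q * \sum m dc = - \sum m dc (q - Q)], and
    [Q] is at least 1/2. *)
Let T3_le : `|T3| <= (SC + wvar m w W) / 2 + B ^+ 2 * (SC + wvar m q Q).
Proof.
have dcE : SC = wvar m c cJ by [].
have -> : T3 = \sum_i m i * ((c i - cJ) * (w i - W)) + W * \sum_i m i * dc i.
  rewrite /T3 mulr_sumr -big_split/=; apply: eq_bigr => i _; rewrite /dc; ring.
rewrite (le_trans (ler_normD _ _))// lerD//; first by rewrite dcE wcov_le.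
rewrite normrM ler_pM//.
have : Q * \sum_i m i * dc i = - \sum_i m i * ((c i - cJ) * (q i - Q)).
  apply/eqP; rewrite -subr_eq0 opprK mulr_sumr -big_split/=; apply/eqP.
  by rewrite -[RHS]dcq; apply: eq_bigr => i _; rewrite /dc; ring.
move=> /(congr1 Num.norm); rewrite normrN normrM (gtr0_norm Q0).
move=> h; have := wcov_le c q cJ Q m0; rewrite -h -dcE.
set S := `|_|; move=> h'.
have : 2^-1 * S <= Q * S by rewrite ler_wpM2r// normr_ge0.
lra.
Qed.

Let T4_le : `|T4| <= (SA + wvar m z Z) / 2 + B ^+ 2 * (SA + wvar m p P).
Proof.
have dcE : SA = wvar m a aJ by [].
have -> : T4 = \sum_i m i * ((a i - aJ) * (z i - Z)) + Z * \sum_i m i * da i.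
  rewrite /T4 mulr_sumr -big_split/=; apply: eq_bigr => i _; rewrite /da; ring.
rewrite (le_trans (ler_normD _ _))// lerD//; first by rewrite dcE wcov_le.
rewrite normrM ler_pM//.
have : P * \sum_i m i * da i = - \sum_i m i * ((a i - aJ) * (p i - P)).
  apply/eqP; rewrite -subr_eq0 opprK mulr_sumr -big_split/=; apply/eqP.
  by rewrite -[RHS]dap; apply: eq_bigr => i _; rewrite /da; ring.
move=> /(congr1 Num.norm); rewrite normrN normrM (gtr0_norm P0).
move=> h; have := wcov_le a p aJ P m0; rewrite -h -dcE.
set S := `|_|; move=> h'.
have : 2^-1 * S <= P * S by rewrite ler_wpM2r// normr_ge0.
lra.
Qed.

Let ratio_le (x y : R) : `|x| <= 1 -> 2^-1 <= y -> `|x / y| <= 2.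
Proof.
move=> x1 y2; have y0 : 0 < y by lra.
rewrite normrM normfV (gtr0_norm y0) ler_pdivrMr//; lra.
Qed.

(** Each part of [identity] is a sum of products of two martingale differences, so it is at most a
    sum of variances; those of the quotients are traded for the variances of numerators and
    denominators. The factor 200 is generous. *)
Lemma one_step :
  `|lam u v - aJ * cJ * (lam p q + \sum_i X i) + \sum_i a i * c i * X i| <=
  200 * B ^+ 3 * (wvar m u U + wvar m v V + wvar m p P + wvar m q Q +
                  wvar m w W + wvar m z Z).
Proof.
rewrite identity.
have aJ2 := ratio_le hU hP; have cJ2 := ratio_le hV hQ.
have h3 : `|aJ * T3| <= SC + wvar m w W + 2 * B ^+ 2 * (SC + wvar m q Q).
  rewrite normrM; have := ler_pM (normr_ge0 _) (normr_ge0 _) aJ2 T3_le; lra.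
have h4 : `|cJ * T4| <= SA + wvar m z Z + 2 * B ^+ 2 * (SA + wvar m p P).
  rewrite normrM; have := ler_pM (normr_ge0 _) (normr_ge0 _) cJ2 T4_le; lra.
have n1 := ler_normD (T1 + T2 + aJ * T3) (cJ * T4).
have n2 := ler_normD (T1 + T2) (aJ * T3).
apply: (le_trans n1); apply: (le_trans (lerD n2 h4)).
apply: (le_trans (lerD (lerD (le_trans (ler_normD _ _) (lerD T1_le T2_le)) h3) (lexx _))).
have := wvar_ge0 u U m0; have := wvar_ge0 v V m0.
have := wvar_ge0 p P m0; have := wvar_ge0 q Q m0.
have := wvar_ge0 w W m0; have := wvar_ge0 z Z m0.
have : 1 <= B ^+ 2 by rewrite exprn_ege1.
have : B ^+ 2 <= B ^+ 3 by rewrite ler_weXn2l.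
move: SA_le SC_le SA0 SC0.
move: (wvar m u U) (wvar m v V) (wvar m p P) (wvar m q Q) (wvar m w W) (wvar m z Z).
move: SA SC (B ^+ 3) (B ^+ 2) => A C b e s1 s2 s3 s4 s5 s6.
move=> Ale Cle A0 C0 b23 b2 z0 w0 q'0 p'0 v0 u0.
have H (x : R) : 0 <= x -> x <= b * x by move=> x0; rewrite ler_peMl//; lra.
have H' (x : R) : 0 <= x -> e * x <= b * x by move=> x0; rewrite ler_wpM2r.
have bA : b * A <= b * (8 * s1 + 32 * s3) by rewrite ler_wpM2l//; lra.
have bC : b * C <= b * (8 * s2 + 32 * s4) by rewrite ler_wpM2l//; lra.
have := H _ A0; have := H _ C0; have := H' _ A0; have := H' _ C0.
have := H _ w0; have := H _ z0; have := H' _ p'0; have := H' _ q'0.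
have bp (x : R) : 0 <= x -> 0 <= b * x by move=> x0; rewrite mulr_ge0//; lra.
have := bp _ u0; have := bp _ v0; have := bp _ p'0; have := bp _ q'0.
have := bp _ w0; have := bp _ z0.
rewrite !mulrDr in bA bC *; lra.
Qed.

End OneStep.

(** A function that is constant on the descendants of generation [d] of a cube, encoded as nested
    functions of the child index: every argument about it is then an induction on [d]. *)
Fixpoint dtree (R iota : Type) (d : nat) : Type :=
  if d is e.+1 then iota -> dtree R iota e else R.

(** * Forms and stopping families on trees *)

Section Trees.
Context {R : realFieldType} {I : Type} {iota : finType}.
Variables (ch : I -> iota -> I) (mu : I -> R) (k : I -> iota -> iota -> R).
Notation tree := (dtree R iota).

Fixpoint tfold (phi : I -> R -> R) d (J : I) : tree d -> R :=
  match d with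
  | 0 => fun t => phi J t
  | e.+1 => fun t => \sum_i tfold phi (ch J i) (t i)
  end.

Definition mass d J t := @tfold (fun J x => x * mu J) d J t.
Definition amass d J t := @tfold (fun J x => `|x| * mu J) d J t.
Definition norm2 d J t := @tfold (fun J x => x ^+ 2 * mu J) d J t.

Fixpoint tall (P : pred R) d : tree d -> Prop :=
  match d with
  | 0 => fun t => P t
  | e.+1 => fun t => forall i, tall P (t i)
  end.

Definition tbnd (x : R) d := @tall (fun y => `|y| <= x) d.

(* The bilinear form of a perfect operator on functions that are constant on
   the cubes of generation [d] below [J]: the off-diagonal part is given by the
   values [k] of the kernel on pairs of siblings, the diagonal by [w]. *)
Fixpoint form (w : I -> R) d (J : I) : tree d -> tree d -> R :=
  match d with
  | 0 => fun s t => s * t * w J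
  | e.+1 => fun s t => \sum_i form w (ch J i) (s i) (t i) +
      \sum_i \sum_(j | j != i) k J i j * mass (ch J i) (s i) * mass (ch J j) (t j)
  end.

Hypothesis mu_gt0 : forall J, 0 < mu J.
Hypothesis mu_ch : forall J, mu J = \sum_i mu (ch J i).

Lemma mass_le x d J (t : tree d) : tbnd x t -> `|mass J t| <= x * mu J.
Proof.
elim: d J t => [|d IH] J t /= tx.
  by rewrite /mass/= normrM (gtr0_norm (mu_gt0 J)) ler_wpM2r// ltW.
rewrite /mass/= (le_trans (ler_norm_sum _ _ _))// [mu J]mu_ch mulr_sumr.
by apply: ler_sum => i _; exact: IH.
Qed.

Section OneSystem.
Variables (kk : I -> iota -> iota -> R) (B D M E0 C : R).
Variables (below : I -> I -> Prop) (beta E tr : I -> I -> R).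

Definition stop P J := (beta P J < mu J / 2) || (M * mu J < E P J).

(* For an accretive family (b_P), beta P J is the integral of b_P over J, E P J
   the integral over J of |b_P|^p + |T b_P|^q, and tr P J the constant value on J
   of T (b_P 1_(P \ J)). *)
Record tb_system : Prop := {
  tb_add : forall P J, below J P -> beta P J = \sum_i beta P (ch J i) ;
  tb_energy_add : forall P J, below J P -> E P J = \sum_i E P (ch J i) ;
  tb_energy_ge0 : forall P J, below J P -> 0 <= E P J ;
  tb_root : forall P, beta P P = mu P ;
  tb_energy_root : forall P, E P P <= E0 * mu P ;
  tb_young : forall P J, below J P ->
    `|beta P J| <= E P J / (8 * E0) + C * mu J ;
  tb_trunc_add : forall P J i, below J P ->
    tr P (ch J i) = tr P J + \sum_(j | j != i) kk J j i * beta P (ch J j) ;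
  tb_trunc_le : forall P J, below J P -> E P J <= D * M * mu J ->
    `|tr P J| <= B }.

(** The cube [J] itself is not tested, the recursion starts with its children: it is called at cubes
    that have not stopped, in particular at the root ([good_root]). *)
Fixpoint first_stops (phi psi : I -> R) d J P : R :=
  if d is e.+1 then \sum_i (if stop P (ch J i) then psi (ch J i)
                            else first_stops phi psi e (ch J i) P)
  else phi J.

(** A stopping cube becomes the root for everything below it, so all layers of the stopping tree are
    counted. *)
Fixpoint all_stops d J P : R :=
  if d is e.+1 then
    \sum_i (if stop P (ch J i) then mu (ch J i) + all_stops e (ch J i) (ch J i)
            else all_stops e (ch J i) P)
  else 0.

Hypothesis below_refl : forall P, below P P.
Hypothesis below_ch : forall J P i, below J P -> below (ch J i) P.
Hypothesis E0_gt0 : 0 < E0.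
Hypothesis C_ge1 : 1 <= C.
Hypothesis M_ge : 8 * C * E0 <= M.
Hypothesis D_ge1 : 1 <= D.
Hypothesis mu_D : forall J i, mu J <= D * mu (ch J i).
Hypothesis B_ge : D * M / (8 * E0) + C <= B.
Hypothesis sys : tb_system.

Local Notation stopped := (first_stops (fun=> 0) mu).

Lemma first_stops_le d J P : stopped d J P <= mu J.
Proof.
elim: d J P => [|d IH] J P /=; first exact: ltW.
by rewrite [leRHS]mu_ch; apply: ler_sum => i _; case: ifP.
Qed.

Lemma M_gt0 : 0 < M.
Proof. by apply: lt_le_trans M_ge; rewrite !mulr_gt0//; apply: lt_le_trans C_ge1. Qed.

(** The integral of b_P over P is mu P. Stopped cubes with a small average carry at most half of it.
    On those with large energy, [M_ge] gives [C * mu <= E / (8 * E0)], so by [tb_young] they carry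
    at most [E / (4 * E0)], a quarter of mu P in total. The last quarter is left to the surviving
    cubes, which carry at most [C] times their measure beyond their share of the energy. *)
Lemma first_stops_packing d P : stopped d P P <= (1 - (4 * C)^-1) * mu P.
Proof.
have C0 : 0 < C by apply: lt_le_trans C_ge1.
suff H J : below J P ->
    beta P J <= mu J / 2 + E P J / (4 * E0) + C * (mu J - stopped d J P).
  have := H P (below_refl P); rewrite (tb_root sys).
  have := tb_energy_root sys P.
  rewrite -ler_pdivrMr// => h1 h2.
  have h3 : E P P / (4 * E0) <= mu P / 4.
    rewrite ler_pdivlMr// mulrC mulrA (_ : 4 * E P P / (4 * E0) = E P P / E0).
      by rewrite ler_pdivrMr// mulrC -ler_pdivrMr.
    by field; rewrite gt_eqF.
  have h4 : mu P / 4 <= C * (mu P - stopped d P P) by lra.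
  have : mu P / 4 / C <= mu P - stopped d P P by rewrite ler_pdivrMr// [leRHS]mulrC.
  have -> : mu P / 4 / C = (4 * C)^-1 * mu P by field; rewrite gt_eqF.
  by rewrite mulrBl mul1r; lra.
have half J' : E P J' / (4 * E0) = E P J' / (8 * E0) + E P J' / (8 * E0).
  by field; rewrite gt_eqF.
elim: d J => [|d IH] J /= bJ.
  have := tb_young sys bJ; rewrite ler_norml subr0 => /andP[_ h].
  have h0 : 0 <= E P J / (8 * E0).
    by rewrite divr_ge0 ?(tb_energy_ge0 sys bJ)// mulr_ge0// ltW.
  by have := mu_gt0 J; rewrite half; lra.
rewrite (tb_add sys bJ) (tb_energy_add sys bJ) [mu J]mu_ch.
rewrite !mulr_suml -sumrB mulr_sumr -!big_split/= ler_sum// => i _.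
have bi := below_ch i bJ.
case: ifPn => [|_]; last exact: IH.
rewrite subrr mulr0 addr0.
have e0 := tb_energy_ge0 sys bi; have m0 := mu_gt0 (ch J i).
have e0' : 0 <= E P (ch J i) / (4 * E0) by rewrite divr_ge0// mulr_ge0// ltW.
case/orP => [h|h]; first by lra.
have := tb_young sys bi; rewrite ler_norml => /andP[_ h'].
have h2 : C * mu (ch J i) <= E P (ch J i) / (8 * E0).
  rewrite ler_pdivlMr ?mulr_gt0// (le_trans _ (ltW h))//.
  rewrite (_ : _ * (8 * E0) = 8 * C * E0 * mu (ch J i)); last by ring.
  by rewrite ler_wpM2r// ltW.
by rewrite half; lra.
Qed.

(** Each layer of stopping cubes is a fixed fraction of the previous one. The induction on the depth
    closes because (1 + 4C)(1 - 1/(4C)) <= 4C. *)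
Lemma all_stops_packing d P : all_stops d P P <= 4 * C * mu P.
Proof.
have C0 : 0 < C by apply: lt_le_trans C_ge1.
elim/ltn_ind: d P => d IH P.
suff H J : all_stops d J P <= (1 + 4 * C) * stopped d J P.
  apply: (le_trans (H P)).
  apply: (@le_trans _ _ ((1 + 4 * C) * ((1 - (4 * C)^-1) * mu P))).
    by rewrite ler_wpM2l ?first_stops_packing//; lra.
  rewrite mulrA ler_wpM2r ?(ltW (mu_gt0 _))// mulrDl mul1r mulrBr mulr1.
  rewrite mulfV ?gt_eqF ?mulr_gt0//.
  have : 0 <= (4 * C)^-1 by rewrite invr_ge0; lra.
  lra.
elim: d IH J => [|d IHd] IH J /=; first by rewrite mulr0.
rewrite mulr_sumr ler_sum// => i _; case: ifP => _.
  by rewrite mulrDl mul1r lerD2l IH.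
by apply: IHd => e ed; apply: IH; exact: ltnW.
Qed.

Lemma good_energy P J : ~~ stop P J -> E P J <= D * M * mu J.
Proof.
rewrite negb_or -leNgt -leNgt => /andP[_ h]; rewrite (le_trans h)//.
by rewrite ler_wpM2r ?(ltW (mu_gt0 _))// ler_peMl// ltW// M_gt0.
Qed.

(** A stopping cube inherits the energy bound of its parent up to the factor [D]. This is why
    [tb_trunc_le] is required up to [D * M]: it has to apply on the first stopping cubes as well. *)
Lemma good_child_energy P J i : below J P -> ~~ stop P J ->
  E P (ch J i) <= D * M * mu (ch J i).
Proof.
move=> bJ; rewrite negb_or -leNgt -leNgt => /andP[_ h].
apply: (@le_trans _ _ (E P J)).
  rewrite (tb_energy_add sys bJ) (bigD1 i)//= lerDl sumr_ge0// => j _.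
  exact/(tb_energy_ge0 sys)/below_ch.
rewrite (le_trans h)// [D * M]mulrC -mulrA ler_wpM2l//; exact/ltW/M_gt0.
Qed.

Lemma beta_le P J : below J P -> E P J <= D * M * mu J -> `|beta P J| <= B * mu J.
Proof.
move=> bJ h; apply: (le_trans (tb_young sys bJ)).
apply: (@le_trans _ _ ((D * M / (8 * E0) + C) * mu J)).
  rewrite [leRHS]mulrDl lerD2r mulrAC ler_wpM2r// invr_ge0 mulr_ge0//; exact: ltW.
by rewrite ler_wpM2r// ltW.
Qed.

Lemma good_root P : ~~ stop P P.
Proof.
rewrite negb_or -!leNgt (tb_root sys); apply/andP; split.
  by have := mu_gt0 P; lra.
rewrite (le_trans (tb_energy_root sys P))// ler_wpM2r ?(ltW (mu_gt0 _))//.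
apply: le_trans M_ge; apply: ler_peMl; first exact: ltW.
by move: C_ge1; lra.
Qed.

Lemma good_ge P J : ~~ stop P J -> mu J / 2 <= beta P J.
Proof. by rewrite negb_or -!leNgt => /andP[]. Qed.

Lemma all_stops_child d J P i :
  let P' := if stop P (ch J i) then ch J i else P in
  all_stops d (ch J i) P' <=
  if stop P (ch J i) then mu (ch J i) + all_stops d (ch J i) (ch J i)
  else all_stops d (ch J i) P.
Proof. by rewrite /=; case: ifP => // _; rewrite lerDr ltW. Qed.

End OneSystem.

End Trees.

(** * Testing the off-diagonal form on bounded functions *)

Section LocalTb.
Context {R : realFieldType} {I : Type} {iota : finType}.
Variables (ch : I -> iota -> I) (mu : I -> R) (k : I -> iota -> iota -> R).
Variables (B D M E0 C : R) (below : I -> I -> Prop).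
Variables (beta1 E1 tr1 beta2 E2 tr2 : I -> I -> R).
Notation tree := (dtree R iota).
Notation mass := (mass ch mu).
Notation stop1 := (stop mu M beta1 E1).
Notation stop2 := (stop mu M beta2 E2).
Notation kT := (fun J i j => k J j i).

Hypothesis mu_gt0 : forall J, 0 < mu J.
Hypothesis mu_ch : forall J, mu J = \sum_i mu (ch J i).
Hypothesis below_refl : forall P, below P P.
Hypothesis below_ch : forall J P i, below J P -> below (ch J i) P.
Hypothesis E0_gt0 : 0 < E0.
Hypothesis C_ge1 : 1 <= C.
Hypothesis M_ge : 8 * C * E0 <= M.
Hypothesis D_ge1 : 1 <= D.
Hypothesis mu_D : forall J i, mu J <= D * mu (ch J i).
Hypothesis B_ge : D * M / (8 * E0) + C <= B.
Hypothesis D_le : D <= B.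
Hypothesis hk : forall J i j, i != j -> `|k J i j| * mu J <= B.
Hypothesis sys1 : tb_system ch mu k B D M E0 C below beta1 E1 tr1.
Hypothesis sys2 : tb_system ch mu kT B D M E0 C below beta2 E2 tr2.

Fixpoint tform d P1 P2 J : R :=
  if d is e.+1 then
    \sum_i \sum_(j | j != i) k J i j * beta1 P1 (ch J i) * beta2 P2 (ch J j) +
    \sum_i (if stop1 P1 (ch J i) || stop2 P2 (ch J i) then 0
            else tform e P1 P2 (ch J i))
  else 0.

Let B_ge1 : 1 <= B.
Proof. exact: le_trans D_ge1 D_le. Qed.

Let B_gt0 : 0 < B.
Proof. exact: lt_le_trans B_ge1. Qed.

Let swap (f : iota -> iota -> R) : \sum_i \sum_(j | j != i) f i j =
  \sum_j \sum_(i | i != j) f i j.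
Proof.
rewrite (exchange_big_dep xpredT)//=; apply: eq_bigr => j _.
by apply: eq_bigl => i; rewrite eq_sym.
Qed.

(** The summation by parts: the off-diagonal terms at [J] are the increments of [tr1] weighted by
    [beta2] ([offdiag1]), so this sum is additive over the children ([W1_add]). It is the pairing of
    T b^1 with the restriction of b^2 to [J], without the diagonal contributions of the cubes where
    [tform] breaks off. [W2] has the two roles exchanged. *)
Let W1 d P1 P2 J := tform d P1 P2 J + tr1 P1 J * beta2 P2 J.
Let W2 d P1 P2 J := tform d P1 P2 J + tr2 P2 J * beta1 P1 J.

Let offdiag1 P1 P2 J i : below J P1 ->
  \sum_(j | j != i) k J j i * beta1 P1 (ch J j) * beta2 P2 (ch J i) =
  (tr1 P1 (ch J i) - tr1 P1 J) * beta2 P2 (ch J i).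
Proof.
move=> b1; rewrite (tb_trunc_add sys1 i b1) [_ + \sum_(_ | _) _]addrC addrK.
by rewrite mulr_suml.
Qed.

Let offdiag2 P1 P2 J i : below J P2 ->
  \sum_(j | j != i) k J i j * beta1 P1 (ch J i) * beta2 P2 (ch J j) =
  (tr2 P2 (ch J i) - tr2 P2 J) * beta1 P1 (ch J i).
Proof.
move=> b1; rewrite (tb_trunc_add sys2 i b1) [_ + \sum_(_ | _) _]addrC addrK.
by rewrite mulr_suml; apply: eq_bigr => j _; rewrite mulrAC.
Qed.

Let W1_add d P1 P2 J : below J P1 -> below J P2 ->
  W1 d.+1 P1 P2 J = \sum_i (if stop1 P1 (ch J i) || stop2 P2 (ch J i)
    then tr1 P1 (ch J i) * beta2 P2 (ch J i) else W1 d P1 P2 (ch J i)).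
Proof.
move=> b1 b2; rewrite /W1 /= swap (tb_add sys2 b2) mulr_sumr -!big_split/=.
apply: eq_bigr => i _; rewrite offdiag1//; case: ifP => _; ring.
Qed.

Let W2_add d P1 P2 J : below J P1 -> below J P2 ->
  W2 d.+1 P1 P2 J = \sum_i (if stop1 P1 (ch J i) || stop2 P2 (ch J i)
    then tr2 P2 (ch J i) * beta1 P1 (ch J i) else W2 d P1 P2 (ch J i)).
Proof.
move=> b1 b2; rewrite /W2 /= (tb_add sys1 b1) mulr_sumr -!big_split/=.
apply: eq_bigr => i _; rewrite offdiag2//; case: ifP => _; ring.
Qed.

Let beta1_le := beta_le mu_gt0 E0_gt0 B_ge sys1.
Let beta2_le := beta_le mu_gt0 E0_gt0 B_ge sys2.
Let energy1 := good_energy mu_gt0 E0_gt0 C_ge1 M_ge D_ge1 (E := E1) (beta := beta1).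
Let energy2 := good_energy mu_gt0 E0_gt0 C_ge1 M_ge D_ge1 (E := E2) (beta := beta2).
Let energy1_ch := good_child_energy below_ch E0_gt0 C_ge1 M_ge mu_D sys1.
Let energy2_ch := good_child_energy below_ch E0_gt0 C_ge1 M_ge mu_D sys2.

Let prod_le (x y m : R) : `|x| <= B -> `|y| <= B * m -> `|x * y| <= B ^+ 2 * m.
Proof. by move=> hx hy; rewrite normrM expr2 -mulrA ler_pM. Qed.

(** By additivity the bound is needed only where the recursion ends, at generation [d] or at a
    stopping cube. There only [tr1 * beta2] remains, and the energy bound of the parent still
    controls both factors. *)
Let W1_le d P1 P2 J : below J P1 -> below J P2 ->
  ~~ stop1 P1 J -> ~~ stop2 P2 J -> `|W1 d P1 P2 J| <= B ^+ 2 * mu J.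
Proof.
elim: d J => [|d IH] J b1 b2 g1 g2.
  rewrite /W1/= add0r prod_le//; first by rewrite (tb_trunc_le sys1)// energy1.
  by rewrite beta2_le// energy2.
rewrite W1_add// (le_trans (ler_norm_sum _ _ _))// [mu J]mu_ch mulr_sumr.
apply: ler_sum => i _; case: ifPn => [_|].
  by rewrite prod_le ?beta2_le ?(tb_trunc_le sys1) ?energy1_ch ?energy2_ch//;
    exact: below_ch.
by rewrite negb_or => /andP[h1 h2]; apply: IH => //; exact: below_ch.
Qed.

Let W2_le d P1 P2 J : below J P1 -> below J P2 ->
  ~~ stop1 P1 J -> ~~ stop2 P2 J -> `|W2 d P1 P2 J| <= B ^+ 2 * mu J.
Proof.
elim: d J => [|d IH] J b1 b2 g1 g2.
  rewrite /W2/= add0r prod_le//; first by rewrite (tb_trunc_le sys2)// energy2.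
  by rewrite beta1_le// energy1.
rewrite W2_add// (le_trans (ler_norm_sum _ _ _))// [mu J]mu_ch mulr_sumr.
apply: ler_sum => i _; case: ifPn => [_|].
  by rewrite prod_le ?beta1_le ?(tb_trunc_le sys2) ?energy1_ch ?energy2_ch//;
    exact: below_ch.
by rewrite negb_or => /andP[h1 h2]; apply: IH => //; exact: below_ch.
Qed.

Let tform_le d P1 P2 J : below J P1 -> below J P2 ->
  ~~ stop1 P1 J -> ~~ stop2 P2 J -> `|tform d P1 P2 J| <= 2 * B ^+ 2 * mu J.
Proof.
move=> b1 b2 g1 g2; have -> : tform d P1 P2 J =
    W1 d P1 P2 J - tr1 P1 J * beta2 P2 J by rewrite /W1 addrK.
rewrite (le_trans (ler_normB _ _))// (_ : 2 * B ^+ 2 * mu J = B ^+ 2 * mu J + B ^+ 2 * mu J);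
  last by ring.
rewrite lerD ?W1_le// prod_le ?beta2_le ?(tb_trunc_le sys1) ?energy1 ?energy2//.
Qed.

Let sq (x m : R) := x ^+ 2 / m.

(** Each of the six squares is at most [B ^+ 4 * mu J] on cubes that have not stopped, so the
    potential is nonnegative. In passing to the children a square grows by exactly the variance of
    the averages ([wvarE]), so the potential drops by the quantity that bounds the error in
    [one_step]. *)
Let potential d P1 P2 J (u v : R) := 6 * B ^+ 4 * mu J -
  (sq u (mu J) + sq v (mu J) + sq (beta1 P1 J) (mu J) + sq (beta2 P2 J) (mu J) +
   sq (W1 d P1 P2 J) (mu J) + sq (W2 d P1 P2 J) (mu J)).

Let sq_le (x m b : R) : 0 < m -> 0 <= b <= B ^+ 2 -> `|x| <= b * m ->
  sq x m <= B ^+ 4 * m.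
Proof.
move=> m0 /andP[b0 bB] xb; rewrite /sq ler_pdivrMr// -real_normK ?num_real//.
rewrite -mulrA -expr2 (_ : B ^+ 4 = (B ^+ 2) ^+ 2); last by rewrite -exprM.
have mge := ltW m0.
have xB : `|x| <= B ^+ 2 * m by rewrite (le_trans xb)// ler_wpM2r.
rewrite -exprMn !expr2; apply: ler_pM => //.
Qed.

Let potential_ge0 d P1 P2 J u v : below J P1 -> below J P2 ->
  ~~ stop1 P1 J -> ~~ stop2 P2 J -> `|u| <= mu J -> `|v| <= mu J ->
  0 <= potential d P1 P2 J u v.
Proof.
move=> b1 b2 g1 g2 hu hv; have m0 := mu_gt0 J.
have B2 : 1 <= B ^+ 2 by rewrite exprn_ege1.
have o1 : 0 <= (1 : R) <= B ^+ 2 by rewrite ler01.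
have o2 : 0 <= B <= B ^+ 2 by rewrite (ltW B_gt0) ler_eXnr.
have o3 : 0 <= B ^+ 2 <= B ^+ 2 by rewrite lexx (le_trans _ B2).
have s1 : sq u (mu J) <= B ^+ 4 * mu J by apply: sq_le o1 _; rewrite ?mul1r.
have s2 : sq v (mu J) <= B ^+ 4 * mu J by apply: sq_le o1 _; rewrite ?mul1r.
have s3 : sq (beta1 P1 J) (mu J) <= B ^+ 4 * mu J.
  by apply: sq_le o2 _ => //; rewrite beta1_le// energy1.
have s4 : sq (beta2 P2 J) (mu J) <= B ^+ 4 * mu J.
  by apply: sq_le o2 _ => //; rewrite beta2_le// energy2.
have s5 : sq (W1 d P1 P2 J) (mu J) <= B ^+ 4 * mu J.
  by apply: sq_le o3 _ => //; exact: W1_le.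
have s6 : sq (W2 d P1 P2 J) (mu J) <= B ^+ 4 * mu J.
  by apply: sq_le o3 _ => //; exact: W2_le.
rewrite /potential; lra.
Qed.

Let sq_ge0 x m : 0 < m -> 0 <= sq x m.
Proof. by move=> m0; rewrite /sq divr_ge0 ?sqr_ge0// ltW. Qed.

Let potential_le d P1 P2 J u v : potential d P1 P2 J u v <= 6 * B ^+ 4 * mu J.
Proof.
have m0 := mu_gt0 J.
have := sq_ge0 u m0; have := sq_ge0 v m0.
have := sq_ge0 (beta1 P1 J) m0; have := sq_ge0 (beta2 P2 J) m0.
have := sq_ge0 (W1 d P1 P2 J) m0; have := sq_ge0 (W2 d P1 P2 J) m0.
rewrite /potential; lra.
Qed.

(** [one_step] for the averages of six additive quantities: the masses of [s] and [t], the two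
    integrals of the accretive functions, [W1] and [W2]. *)
Let clean d J P1 P2 (s t : tree d.+1) : below J P1 -> below J P2 ->
  ~~ stop1 P1 J -> ~~ stop2 P2 J -> tbnd 1 s -> tbnd 1 t ->
  (forall i, ~~ stop1 P1 (ch J i) && ~~ stop2 P2 (ch J i)) ->
  let u i := mass (ch J i) (s i) in let v i := mass (ch J i) (t i) in
  let b1 i := beta1 P1 (ch J i) in let b2 i := beta2 P2 (ch J i) in
  `| \sum_i \sum_(j | j != i) k J i j * u i * v j
     - (mass J s / beta1 P1 J) * (mass J t / beta2 P2 J) * tform d.+1 P1 P2 J
     + \sum_i (u i / b1 i) * (v i / b2 i) * tform d P1 P2 (ch J i)| <=
  200 * B ^+ 3 * (potential d.+1 P1 P2 J (mass J s) (mass J t) -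
     \sum_i potential d P1 P2 (ch J i) (u i) (v i)).
Proof.
move=> bJ1 bJ2 g1 g2 s1 t1 gc; cbv zeta.
pose u i := mass (ch J i) (s i); pose v i := mass (ch J i) (t i).
pose b1 i := beta1 P1 (ch J i); pose b2 i := beta2 P2 (ch J i).
have nz J' : mu J' != 0 by rewrite gt_eqF.
have gc1 i : ~~ stop1 P1 (ch J i) by have /andP[] := gc i.
have gc2 i : ~~ stop2 P2 (ch J i) by have /andP[] := gc i.
have bi1 i : below (ch J i) P1 by exact: below_ch.
have bi2 i : below (ch J i) P2 by exact: below_ch.
have e1 i := energy1 (gc1 i); have e2 i := energy2 (gc2 i).
have sw i : (stop1 P1 (ch J i) || stop2 P2 (ch J i)) = false.
  by apply/negP; have := gc i; rewrite -negb_or => /negP.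
pose m i := mu (ch J i).
have mpos i : 0 < m i by exact: mu_gt0.
have nm i : m i != 0 by exact: nz.
pose av (f : iota -> R) i := f i / m i.
have avm f i : m i * av f i = f i by rewrite /av mulrC divfK.
have avle x f i : `|f i| <= x * m i -> `|av f i| <= x.
  by move=> h; rewrite /av normrM normfV (gtr0_norm (mpos i)) ler_pdivrMr.
have avge f i : m i / 2 <= f i -> 2^-1 <= av f i.
  by move=> h; rewrite /av ler_pdivlMr// mulrC.
have avB f i : `|f i| <= B * m i -> av f i <= B.
  by move=> h; rewrite (le_trans (ler_norm _))// avle.
pose w1 i := W1 d P1 P2 (ch J i); pose w2 i := W2 d P1 P2 (ch J i).
have tfE : tform d.+1 P1 P2 J = \sum_i \sum_(j | j != i) k J i j * b1 i * b2 j +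
     \sum_i tform d P1 P2 (ch J i).
  by rewrite /=; congr (_ + _); apply: eq_bigr => i _; rewrite sw.
have avJ f x : `|f| <= x * mu J -> `|f / mu J| <= x.
  by move=> h; rewrite normrM normfV (gtr0_norm (mu_gt0 J)) ler_pdivrMr.
have := @one_step _ _ B (mu J) m (av u) (av v) (av b1) (av b2) (av w1) (av w2)
  (fun i => tform d P1 P2 (ch J i)) (k J)
  (mass J s / mu J) (mass J t / mu J) (beta1 P1 J / mu J) (beta2 P2 J / mu J)
  (W1 d.+1 P1 P2 J / mu J) (W2 d.+1 P1 P2 J / mu J) (tr1 P1 J) (tr2 P2 J) B_ge1
  mpos (mu_ch J) (mu_gt0 J) (@hk J).
have hb1 i : 2^-1 <= av b1 i <= B.
  by rewrite avge ?avB//; [exact: beta1_le|exact: good_ge (gc1 i)].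
have hb2 i : 2^-1 <= av b2 i <= B.
  by rewrite avge ?avB//; [exact: beta2_le|exact: good_ge (gc2 i)].
move=> /(_ hb1 hb2).
move=> /(_ (fun i => tform_le d (bi1 i) (bi2 i) (gc1 i) (gc2 i))).
move=> /(_ (avJ _ _ (mass_le mu_gt0 mu_ch J s1)) (avJ _ _ (mass_le mu_gt0 mu_ch J t1))).
have hb1J : 2^-1 <= beta1 P1 J / mu J.
  by rewrite ler_pdivlMr// mulrC (good_ge g1).
have hb2J : 2^-1 <= beta2 P2 J / mu J.
  by rewrite ler_pdivlMr// mulrC (good_ge g2).
move=> /(_ hb1J hb2J (avJ _ _ (W1_le d.+1 bJ1 bJ2 g1 g2)) (avJ _ _ (W2_le d.+1 bJ1 bJ2 g1 g2))).
have sumE (f : iota -> R) F : F = \sum_i f i -> mu J * (F / mu J) = \sum_i m i * av f i.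
  move=> ->; rewrite mulrC divfK//; apply: eq_bigr => i _; by rewrite avm.
have W1E : W1 d.+1 P1 P2 J = \sum_i w1 i.
  by rewrite W1_add//; apply: eq_bigr => i _; rewrite sw.
have W2E : W2 d.+1 P1 P2 J = \sum_i w2 i.
  by rewrite W2_add//; apply: eq_bigr => i _; rewrite sw.
move=> /(_ (sumE _ _ erefl) (sumE _ _ erefl) (sumE _ _ (tb_add sys1 bJ1)) (sumE _ _ (tb_add sys2 bJ2))).
have H1 j : \sum_(i | i != j) k J i j * (m i * av b1 i) * (m j * av b2 j) +
   tform d P1 P2 (ch J j) = m j * av w1 j - tr1 P1 J * (m j * av b2 j).
  rewrite !avm; under eq_bigr => i _ do rewrite avm.
  by rewrite offdiag1// /w1 /W1 /b2; ring.
have H2 i : \sum_(j | j != i) k J i j * (m i * av b1 i) * (m j * av b2 j) +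
   tform d P1 P2 (ch J i) = m i * av w2 i - tr2 P2 J * (m i * av b1 i).
  rewrite !avm; under eq_bigr => j _ do rewrite avm.
  by rewrite offdiag2// /w2 /W2 /b1; ring.
move=> /(_ H1 H2).
have cancel_mu (x y : R) : x / mu J / (y / mu J) = x / y.
  by rewrite invfM invrK mulrACA mulVf// mulr1.
have cancel_m f g i : av f i / av g i = f i / g i.
  by rewrite /av invfM invrK mulrACA mulVf// mulr1.
rewrite !cancel_mu.
have lamE f g : \sum_i \sum_(j | j != i) k J i j * (m i * av f i) * (m j * av g j) =
    \sum_i \sum_(j | j != i) k J i j * f i * g j.
  by apply: eq_bigr => i _; apply: eq_bigr => j _; rewrite !avm.
have ratE : \sum_i av u i / av b1 i * (av v i / av b2 i) * tform d P1 P2 (ch J i) =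
    \sum_i u i / b1 i * (v i / b2 i) * tform d P1 P2 (ch J i).
  by apply: eq_bigr => i _; rewrite !cancel_m.
rewrite !lamE -tfE ratE.
move=> /le_trans; apply; rewrite ler_wpM2l//.
  by rewrite mulr_ge0// exprn_ge0// ltW.
rewrite le_eqVlt; apply/orP; left; apply/eqP.
have wv (F : R) (f : iota -> R) : F = \sum_i f i ->
    wvar m (av f) (F / mu J) = \sum_i sq (f i) (m i) - sq F (mu J).
  move=> FE; rewrite (@wvarE _ _ _ _ _ (mu J))//.
    congr (_ - _); last by rewrite /sq; field; exact: nz.
    by apply: eq_bigr => i _; rewrite /av /sq; field.
  exact: sumE.
rewrite !wv//; [|exact: (tb_add sys2)|exact: (tb_add sys1)].
rewrite /potential sumrB !big_split/= -mulr_sumr -mu_ch; ring.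
Qed.

Let ratio_le (x m y : R) : `|x| <= m -> m / 2 <= y -> 0 < m -> `|x / y| <= 2.
Proof.
move=> x1 y2 m0; have y0 : 0 < y by lra.
rewrite normrM normfV (gtr0_norm y0) ler_pdivrMr//; lra.
Qed.

Let K2 := 1217 * B ^+ 8.
Let stops1 := all_stops ch mu M beta1 E1.
Let stops2 := all_stops ch mu M beta2 E2.

(** If no child stops, [clean] lets the potentials telescope. If some child [i0] stops, all terms at
    [J] are estimated crudely by a multiple of [mu J]. This is at most a multiple of [mu (ch J i0)],
    which is available since [i0] is counted among the stopping cubes. *)
Let main d J P1 P2 (s t : tree d) : below J P1 -> below J P2 ->
  ~~ stop1 P1 J -> ~~ stop2 P2 J -> tbnd 1 s -> tbnd 1 t ->
  `|form ch mu k (fun=> 0) J s t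
     - (mass J s / beta1 P1 J) * (mass J t / beta2 P2 J) * tform d P1 P2 J| <=
  200 * B ^+ 3 * potential d P1 P2 J (mass J s) (mass J t) +
  K2 * (stops1 d J P1 + stops2 d J P2).
Proof.
have K20 : 0 <= K2 by rewrite /K2 mulr_ge0// exprn_ge0// ltW.
have B3 : 0 <= 200 * B ^+ 3 by rewrite mulr_ge0// exprn_ge0// ltW.
elim: d J P1 P2 s t => [|d IH] J P1 P2 s t bJ1 bJ2 g1 g2 s1 t1.
  rewrite /= !mulr0 subr0 normr0 !addr0 mulr0 addr0 mulr_ge0//.
  apply: potential_ge0 => //.
    by have := mass_le mu_gt0 mu_ch J s1; rewrite mul1r.
  by have := mass_le mu_gt0 mu_ch J t1; rewrite mul1r.
pose u i := mass (ch J i) (s i); pose v i := mass (ch J i) (t i).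
have bi1 i : below (ch J i) P1 by exact: below_ch.
have bi2 i : below (ch J i) P2 by exact: below_ch.
have hu i : `|u i| <= mu (ch J i).
  by rewrite -[leRHS]mul1r; apply: mass_le => //; exact: s1.
have hv i : `|v i| <= mu (ch J i).
  by rewrite -[leRHS]mul1r; apply: mass_le => //; exact: t1.
have [gc|] := boolP [forall i, ~~ stop1 P1 (ch J i) && ~~ stop2 P2 (ch J i)].
  have {}gc := forallP gc.
  have gc1 i : stop1 P1 (ch J i) = false by apply/negbTE; have /andP[] := gc i.
  have gc2 i : stop2 P2 (ch J i) = false by apply/negbTE; have /andP[] := gc i.
  have := clean bJ1 bJ2 g1 g2 s1 t1 gc => /=; rewrite -/u -/v.
  set lam := \sum_i \sum_(j | _) _; set aX := mass J s / _ * _ * _.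
  set S := \sum_i u i / _ * _ * _; set Pot := \sum_i _ => h.
  pose F i := form ch mu k (fun=> 0) (ch J i) (s i) (t i) -
    (u i / beta1 P1 (ch J i)) * (v i / beta2 P2 (ch J i)) * tform d P1 P2 (ch J i).
  have -> : form ch mu k (fun=> 0) J s t - aX = \sum_i F i + (lam - aX + S).
    rewrite /F sumrB -/S /= -/lam; ring.
  apply: (le_trans (ler_normD _ _)); apply: (le_trans (lerD (ler_norm_sum _ _ _) h)).
  have hF : \sum_i `|F i| <= 200 * B ^+ 3 * Pot +
      K2 * (\sum_i (stops1 d (ch J i) P1 + stops2 d (ch J i) P2)).
    rewrite !mulr_sumr -big_split/= ler_sum// => i _.
    by apply: IH => //; [rewrite gc1|rewrite gc2].
  have -> : stops1 d.+1 J P1 + stops2 d.+1 J P2 =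
      \sum_i (stops1 d (ch J i) P1 + stops2 d (ch J i) P2).
    rewrite big_split/=; congr (_ + _); apply: eq_bigr => i _.
      by rewrite gc1.
    by rewrite gc2.
  rewrite mulrBr; lra.
rewrite negb_forall => /existsP[i0]; rewrite negb_and !negbK => stop0.
pose Q1 i := if stop1 P1 (ch J i) then ch J i else P1.
pose Q2 i := if stop2 P2 (ch J i) then ch J i else P2.
have bq1 i : below (ch J i) (Q1 i) by rewrite /Q1; case: ifP.
have bq2 i : below (ch J i) (Q2 i) by rewrite /Q2; case: ifP.
have gq1 i : ~~ stop1 (Q1 i) (ch J i).
  by rewrite /Q1; case: ifPn => // _; exact: (good_root mu_gt0 E0_gt0 C_ge1 M_ge sys1).
have gq2 i : ~~ stop2 (Q2 i) (ch J i).
  by rewrite /Q2; case: ifPn => // _; exact: (good_root mu_gt0 E0_gt0 C_ge1 M_ge sys2).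
have fi i : `|form ch mu k (fun=> 0) (ch J i) (s i) (t i)| <=
   1200 * B ^+ 7 * mu (ch J i) + 8 * B ^+ 2 * mu (ch J i) +
   K2 * (stops1 d (ch J i) (Q1 i) + stops2 d (ch J i) (Q2 i)).
  have := IH (ch J i) (Q1 i) (Q2 i) (s i) (t i) (bq1 i) (bq2 i) (gq1 i) (gq2 i) (s1 i) (t1 i).
  rewrite -/(u i) -/(v i); set ff := form _ _ _ _ _ _ _; set aX := _ / _ * _ * _ => h.
  have h1 : `|aX| <= 8 * B ^+ 2 * mu (ch J i).
    rewrite normrM (_ : 8 * B ^+ 2 * mu (ch J i) = (2 * 2) * (2 * B ^+ 2 * mu (ch J i)));
      last by ring.
    apply: ler_pM => //; last by apply: tform_le.
    rewrite normrM; apply: ler_pM => //.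
      exact: (ratio_le (hu i) (good_ge (gq1 i)) (mu_gt0 _)).
    exact: (ratio_le (hv i) (good_ge (gq2 i)) (mu_gt0 _)).
  have h2 := potential_le d (Q1 i) (Q2 i) (ch J i) (u i) (v i).
  have h3 := ler_wpM2l B3 h2.
  have h4 : `|ff| <= `|ff - aX| + `|aX|.
    by rewrite -[X in `|X| <= _](subrK aX) ler_normD.
  have -> : 1200 * B ^+ 7 * mu (ch J i) = 200 * B ^+ 3 * (6 * B ^+ 4 * mu (ch J i)).
    rewrite (exprD B 3 4); ring.
  lra.
have hlam : `|\sum_i \sum_(j | j != i) k J i j * u i * v j| <= B * mu J.
  apply: (@le_trans _ _ (\sum_i \sum_j B / mu J * mu (ch J i) * mu (ch J j))).
    rewrite (le_trans (ler_norm_sum _ _ _))// ler_sum// => i _.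
    rewrite (le_trans (ler_norm_sum _ _ _))//.
    rewrite [leRHS](bigID (fun j => j != i))/= -[leLHS]addr0 lerD//; last first.
      by apply: sumr_ge0 => j _; rewrite !mulr_ge0 ?invr_ge0//; exact: ltW.
    apply: ler_sum => j ji; rewrite !normrM; apply: ler_pM => //.
      by rewrite mulr_ge0.
    by apply: ler_pM => //; rewrite ler_pdivlMr// hk// eq_sym.
  under eq_bigr => i _ do rewrite -mulr_sumr -mu_ch.
  by rewrite -mulr_suml -mulr_sumr -mu_ch divfK// gt_eqF.
have haX : `|mass J s / beta1 P1 J * (mass J t / beta2 P2 J) * tform d.+1 P1 P2 J|
    <= 8 * B ^+ 2 * mu J.
  rewrite normrM (_ : 8 * B ^+ 2 * mu J = (2 * 2) * (2 * B ^+ 2 * mu J)); last by ring.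
  apply: ler_pM => //; last exact: tform_le.
  rewrite normrM; apply: ler_pM => //.
    by apply: (ratio_le _ (good_ge g1)) => //; rewrite -[leRHS]mul1r mass_le.
  by apply: (ratio_le _ (good_ge g2)) => //; rewrite -[leRHS]mul1r mass_le.
have hst : mu (ch J i0) + \sum_i (stops1 d (ch J i) (Q1 i) + stops2 d (ch J i) (Q2 i))
    <= stops1 d.+1 J P1 + stops2 d.+1 J P2.
  rewrite /stops1 /stops2 /= -big_split/= (bigD1 i0)//= [leRHS](bigD1 i0)//= addrA.
  apply: lerD.
    rewrite /Q1 /Q2; have := mu_gt0 (ch J i0).
    by move: stop0; case: (stop1 _ _); case: (stop2 _ _) => //= _; lra.
  apply: ler_sum => i _; apply: lerD.
    exact: (all_stops_child ch mu_gt0 M beta1 E1 d J P1 i).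
  exact: (all_stops_child ch mu_gt0 M beta2 E2 d J P2 i).
(* 1200 comes from the potentials of the children (200 * 6), and 17 = 8 + 8 + 1 from the
   compensating terms of the children, that of [J], and the off-diagonal terms at [J]. One more
   factor [B] pays for [mu J <= B * mu (ch J i0)]. *)
have hmu : (1200 * B ^+ 7 + 17 * B ^+ 2) * mu J <= K2 * mu (ch J i0).
  have h0 : 1200 * B ^+ 7 + 17 * B ^+ 2 <= 1217 * B ^+ 7.
    have : B ^+ 2 <= B ^+ 7 by rewrite ler_weXn2l.
    lra.
  have h1 : mu J <= B * mu (ch J i0).
    by rewrite (le_trans (mu_D J i0))// ler_wpM2r// ltW.
  apply: (@le_trans _ _ (1217 * B ^+ 7 * (B * mu (ch J i0)))).
    apply: ler_pM => //; [|exact: ltW].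
    by rewrite addr_ge0// mulr_ge0// exprn_ge0// ltW.
  by rewrite /K2 (exprS B 7) le_eqVlt; apply/orP; left; apply/eqP; ring.
have hpot : 0 <= 200 * B ^+ 3 * potential d.+1 P1 P2 J (mass J s) (mass J t).
  by rewrite mulr_ge0// potential_ge0// -[leRHS]mul1r mass_le.
apply: (le_trans (ler_normB _ _)).
have hform : `|form ch mu k (fun=> 0) J s t| <=
   1200 * B ^+ 7 * mu J + 8 * B ^+ 2 * mu J +
   K2 * (\sum_i (stops1 d (ch J i) (Q1 i) + stops2 d (ch J i) (Q2 i))) + B * mu J.
  apply: (le_trans (ler_normD _ _)); apply: lerD => //.
  rewrite (le_trans (ler_norm_sum _ _ _))// [in mu J]mu_ch !mulr_sumr -!big_split/=.
  by apply: ler_sum => i _; exact: fi.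
have := ler_wpM2l K20 hst.
have : B * mu J <= B ^+ 2 * mu J.
  by rewrite ler_wpM2r ?ler_eXnr//; exact: ltW.
rewrite mulrDr; lra.
Qed.

(** The compensating term, the potential and the stopping cubes at the root; 9736 = 8 * 1217, since
    each of the two stopping families has total measure at most [4 * C * mu Q]. *)
Definition tb_const := 8 * B ^+ 2 + 1200 * B ^+ 7 + 9736 * B ^+ 8 * C.

(* Local testing for the form truncated at an arbitrary generation [d]: the
   compensated form of a cube [J] is [form] minus the product of the two ratios
   [mass / beta] times [tform], and one generation changes it by a sum of
   products of two martingale differences, up to the size of the cubes at which
   one of the accretive functions is replaced. *)
Lemma local_tb d Q (s t : tree d) : tbnd 1 s -> tbnd 1 t ->
  `|form ch mu k (fun=> 0) Q s t| <= tb_const * mu Q.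
Proof.
move=> s1 t1.
have g1 := good_root mu_gt0 E0_gt0 C_ge1 M_ge sys1 Q.
have g2 := good_root mu_gt0 E0_gt0 C_ge1 M_ge sys2 Q.
have bQ := below_refl Q.
have K20 : 0 <= K2 by rewrite /K2 mulr_ge0// exprn_ge0// ltW.
have B3 : 0 <= 200 * B ^+ 3 by rewrite mulr_ge0// exprn_ge0// ltW.
have := main bQ bQ g1 g2 s1 t1.
set ff := form _ _ _ _ _ _ _; set aX := _ / _ * _ * _ => h.
have h1 : `|aX| <= 8 * B ^+ 2 * mu Q.
  rewrite normrM (_ : 8 * B ^+ 2 * mu Q = (2 * 2) * (2 * B ^+ 2 * mu Q)); last by ring.
  apply: ler_pM => //; last exact: tform_le.
  rewrite normrM; apply: ler_pM => //.
    by apply: (ratio_le _ (good_ge g1)) => //; rewrite -[leRHS]mul1r mass_le.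
  by apply: (ratio_le _ (good_ge g2)) => //; rewrite -[leRHS]mul1r mass_le.
have h2 := potential_le d Q Q Q (mass Q s) (mass Q t).
have h3 := ler_wpM2l B3 h2.
have h4 : `|ff| <= `|ff - aX| + `|aX|.
  by rewrite -[X in `|X| <= _](subrK aX) ler_normD.
have p1 := all_stops_packing mu_gt0 mu_ch below_refl below_ch E0_gt0 C_ge1 M_ge sys1 d Q.
have p2 := all_stops_packing mu_gt0 mu_ch below_refl below_ch E0_gt0 C_ge1 M_ge sys2 d Q.
have h5 : K2 * (stops1 d Q Q + stops2 d Q Q) <= K2 * (4 * C * mu Q + 4 * C * mu Q).
  by rewrite ler_wpM2l// lerD.
have -> : tb_const * mu Q = 8 * B ^+ 2 * mu Q + 200 * B ^+ 3 * (6 * B ^+ 4 * mu Q) +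
   K2 * (4 * C * mu Q + 4 * C * mu Q).
  rewrite /tb_const /K2 (exprD B 3 4); ring.
lra.
Qed.

End LocalTb.

(** * Operations on trees *)

Section TreeOperations.
Context {R : realFieldType} {I : Type} {iota : finType}.
Variables (ch : I -> iota -> I) (mu : I -> R) (k : I -> iota -> iota -> R).
Notation tree := (dtree R iota).

Fixpoint tconst d (c : R) : tree d :=
  match d with 0 => c | e.+1 => fun=> tconst e c end.

Fixpoint tmap (f : R -> R) d : tree d -> tree d :=
  match d with 0 => fun t => f t | e.+1 => fun t i => tmap f (t i) end.

Fixpoint tgen (phi : I -> R) d (J : I) : tree d :=
  match d with 0 => phi J | e.+1 => fun i => tgen phi e (ch J i) end.

Lemma tall_tmap (P Q : pred R) f d (t : tree d) :
  (forall x, P x -> Q (f x)) -> tall P t -> tall Q (tmap f t).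
Proof. by move=> PQ; elim: d t => [|d IH] t /= h => [|i]; [exact: PQ|exact: IH]. Qed.

Lemma tall_tconst (P : pred R) d c : P c -> tall P (tconst d c).
Proof. by elim: d => //= d IH Pc i; exact: IH. Qed.

Lemma mass_tmap a d J (t : tree d) :
  mass ch mu J (tmap ( *%R a) t) = a * mass ch mu J t.
Proof.
elim: d J t => [|d IH] J t; rewrite /mass/= ?mulrA//.
by rewrite mulr_sumr; apply: eq_bigr => i _; exact: IH.
Qed.

Lemma norm2_tmap a d J (t : tree d) :
  norm2 ch mu J (tmap ( *%R a) t) = a ^+ 2 * norm2 ch mu J t.
Proof.
elim: d J t => [|d IH] J t; rewrite /norm2/= ?exprMn ?mulrA//.
by rewrite mulr_sumr; apply: eq_bigr => i _; exact: IH.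
Qed.

Lemma form_tmap w a b d J (s t : tree d) :
  form ch mu k w J (tmap ( *%R a) s) (tmap ( *%R b) t) =
  a * b * form ch mu k w J s t.
Proof.
elim: d J s t => [|d IH] J s t /=; first by ring.
rewrite mulrDr !mulr_sumr; congr (_ + _); first by apply: eq_bigr.
apply: eq_bigr => i _; rewrite mulr_sumr; apply: eq_bigr => j _.
rewrite !mass_tmap; ring.
Qed.

Hypothesis mu_gt0 : forall J, 0 < mu J.
Hypothesis mu_ch : forall J, mu J = \sum_i mu (ch J i).

Lemma mass_tconst d J c : mass ch mu J (tconst d c) = c * mu J.
Proof.
elim: d J => [|d IH] J //=; rewrite [mu J]mu_ch mulr_sumr.
by apply: eq_bigr => i _; exact: IH.
Qed.

Lemma norm2_tconst d J c : norm2 ch mu J (tconst d c) = c ^+ 2 * mu J.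
Proof.
elim: d J => [|d IH] J //=; rewrite [mu J]mu_ch mulr_sumr.
by apply: eq_bigr => i _; exact: IH.
Qed.

Lemma amass_ge0 d J (t : tree d) : 0 <= amass ch mu J t.
Proof.
elim: d J t => [|d IH] J t; rewrite /amass/=; first by rewrite mulr_ge0// ltW.
by apply: sumr_ge0 => i _; exact: IH.
Qed.

Lemma norm2_ge0 d J (t : tree d) : 0 <= norm2 ch mu J t.
Proof.
elim: d J t => [|d IH] J t; rewrite /norm2/=.
  by rewrite mulr_ge0 ?sqr_ge0// ltW.
by apply: sumr_ge0 => i _; exact: IH.
Qed.

Lemma mass_le_amass d J (t : tree d) : `|mass ch mu J t| <= amass ch mu J t.
Proof.
elim: d J t => [|d IH] J t; rewrite /mass /amass/=.
  by rewrite normrM (gtr0_norm (mu_gt0 J)).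
by rewrite (le_trans (ler_norm_sum _ _ _))// ler_sum// => i _; exact: IH.
Qed.

Lemma amass_child_le d J (t : tree d.+1) i :
  amass ch mu (ch J i) (t i) <= amass ch mu J t.
Proof.
rewrite [leRHS]/amass/= (bigD1 i)//= lerDl sumr_ge0// => j _; exact: amass_ge0.
Qed.

(** Settles the degenerate case of the sparse domination, where an average vanishes and cannot serve
    as a stopping level. *)
Lemma form_amass0 w d J (s t : tree d) :
  amass ch mu J s = 0 \/ amass ch mu J t = 0 -> form ch mu k w J s t = 0.
Proof.
elim: d J s t => [|d IH] J s t /=; rewrite /amass/=.
  have mz := gt_eqF (mu_gt0 J).
  by case=> /eqP; rewrite mulf_eq0 mz orbF normr_eq0 => /eqP ->;
    rewrite ?mulr0 ?mul0r.
move=> h.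
have h' : (forall i, amass ch mu (ch J i) (s i) = 0) \/
          (forall i, amass ch mu (ch J i) (t i) = 0).
  case: h => h; [left|right] => i.
    by apply: (psumr_eq0P _ h) => // j _; exact: amass_ge0.
  by apply: (psumr_eq0P _ h) => // j _; exact: amass_ge0.
rewrite big1 ?add0r => [|i _]; last by apply: IH; case: h' => h'; [left|right].
rewrite big1// => i _; rewrite big1// => j _.
have m0 J' (z : tree d) : amass ch mu J' z = 0 -> mass ch mu J' z = 0.
  move=> z0; apply/eqP; rewrite -normr_le0 -z0; exact: mass_le_amass.
case: h' => h'; first by rewrite (m0 _ _ (h' i)) mulr0 mul0r.
by rewrite (m0 _ _ (h' j)) mulr0.
Qed.

End TreeOperations.

(** * From testing on bounded functions to L2 *)

Section LocalToGlobal.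
Context {R : realFieldType} {I : Type} {iota : finType}.
Variables (ch : I -> iota -> I) (mu : I -> R) (k : I -> iota -> iota -> R).
Variables (w : I -> R) (D K : R).
Notation tree := (dtree R iota).
Notation mass := (mass ch mu).
Notation amass := (amass ch mu).
Notation norm2 := (norm2 ch mu).
Notation form := (form ch mu k w).

Hypothesis mu_gt0 : forall J, 0 < mu J.
Hypothesis mu_ch : forall J, mu J = \sum_i mu (ch J i).
Hypothesis D_ge1 : 1 <= D.
Hypothesis mu_D : forall J i, mu J <= D * mu (ch J i).
Hypothesis testing : forall d J (s t : tree d), tbnd 1 s -> tbnd 1 t ->
  `|form J s t| <= K * mu J.

Let K_ge0 J : 0 <= K * mu J.
Proof.
have b : tbnd 1 (0 : tree 0) by rewrite /tbnd/= normr0.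
exact: le_trans (normr_ge0 _) (testing J b b).
Qed.

Let form_bnd x y d J (s t : tree d) : 0 < x -> 0 < y -> tbnd x s -> tbnd y t ->
  `|form J s t| <= K * x * y * mu J.
Proof.
move=> x0 y0 sx ty.
have b c (z : tree d) : 0 < c -> tbnd c z -> tbnd 1 (tmap ( *%R c^-1) z).
  move=> c0; apply: tall_tmap => r /= rc.
  by rewrite normrM normfV (gtr0_norm c0) mulrC ler_pdivrMr// mul1r.
have := testing J (b _ _ x0 sx) (b _ _ y0 ty).
rewrite form_tmap normrM !normrM !normfV (gtr0_norm x0) (gtr0_norm y0).
rewrite -invfM mulrC ler_pdivrMr ?mulr_gt0// => /le_trans; apply.
by rewrite le_eqVlt; apply/orP; left; apply/eqP; ring.
Qed.

Section Stopping.
Variables x y : R.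
Hypothesis x0 : 0 < x.
Hypothesis y0 : 0 < y.

Let high d J (s t : tree d) := (x * mu J < amass J s) || (y * mu J < amass J t).

Fixpoint at_high (phi : forall d, I -> tree d -> tree d -> R) d J :
    tree d -> tree d -> R :=
  match d return tree d -> tree d -> R with
  | 0 => fun _ _ => 0
  | e.+1 => fun s t => \sum_i (if @high e (ch J i) (s i) (t i)
      then phi e (ch J i) (s i) (t i) else at_high phi (ch J i) (s i) (t i))
  end.

(** The good part of a Calderon-Zygmund decomposition of [z]. The cubes are selected by [s] and [t]
    jointly, so that both functions are averaged on the same cubes. *)
Fixpoint cutoff d J : tree d -> tree d -> tree d -> tree d :=
  match d return tree d -> tree d -> tree d -> tree d with
  | 0 => fun z _ _ => z
  | e.+1 => fun z s t i => if @high e (ch J i) (s i) (t i)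
      then tconst e (mass (ch J i) (z i) / mu (ch J i))
      else cutoff (ch J i) (z i) (s i) (t i)
  end.

Lemma at_high_le phi psi d J (s t : tree d) :
  (forall e J' (s' t' : tree e), (e < d)%N -> phi e J' s' t' <= psi e J' s' t') ->
  at_high phi J s t <= at_high psi J s t.
Proof.
elim: d J s t => [|d IH] J s t h //=; apply: ler_sum => i _.
case: ifP => _; first exact: h.
by apply: IH => e J' s' t' ed; apply: h; exact: ltnW.
Qed.

Lemma at_highD phi psi d J (s t : tree d) :
  at_high (fun e J s t => phi e J s t + psi e J s t) J s t =
  at_high phi J s t + at_high psi J s t.
Proof.
elim: d J s t => [|d IH] J s t /=; first by rewrite addr0.
by rewrite -big_split/=; apply: eq_bigr => i _; case: ifP.
Qed.

Lemma at_highZ c phi d J (s t : tree d) :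
  at_high (fun e J s t => c * phi e J s t) J s t = c * at_high phi J s t.
Proof.
elim: d J s t => [|d IH] J s t /=; first by rewrite mulr0.
by rewrite mulr_sumr; apply: eq_bigr => i _; case: ifP.
Qed.

Lemma high_packing d J (s t : tree d) :
  at_high (fun _ J _ _ => mu J) J s t <= amass J s / x + amass J t / y.
Proof.
have g0 e J' (z : tree e) c : 0 < c -> 0 <= amass J' z / c.
  by move=> c0; rewrite divr_ge0 ?amass_ge0// ltW.
elim: d J s t => [|d IH] J s t /=; first by rewrite addr_ge0 ?g0.
rewrite /amass /= !mulr_suml -big_split/= ler_sum// => i _; case: ifPn => [|_].
  case/orP => h; [rewrite -[leLHS]addr0|rewrite -[leLHS]add0r]; rewrite lerD ?g0//.
    by rewrite ler_pdivlMr// mulrC ltW.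
  by rewrite ler_pdivlMr// mulrC ltW.
exact: IH.
Qed.

Lemma mass_cutoff d J (z s t : tree d) : mass J (cutoff J z s t) = mass J z.
Proof.
elim: d J z s t => // d IH J z s t; apply: eq_bigr => i _ /=.
case: ifP => _; last exact: IH.
by apply: etrans (mass_tconst mu_ch _ _ _) _; rewrite divfK// gt_eqF.
Qed.

Let cutoff_bnd (sel : bool) d J (s t : tree d) :
  ~~ high J s t ->
  tbnd (D * (if sel then x else y)) (cutoff J (if sel then s else t) s t).
Proof.
set c := if sel then x else y.
have c0 : 0 < c by rewrite /c; case: ifP.
have nh e J' (s' t' : tree e) : ~~ high J' s' t' ->
    amass J' (if sel then s' else t') <= c * mu J'.
  by rewrite negb_or -!leNgt /c; case: sel c c0 => c c0 /andP[].
elim: d J s t => [|d IH] J s t /= h.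
  have := nh _ _ _ _ h; rewrite /amass/= ler_pM2r// => h'.
  rewrite /tbnd/= (le_trans h')// ler_peMl// ltW//.
move=> i; case: ifPn => [_|]; last first.
  by have := IH (ch J i) (s i) (t i); case: (sel).
apply: tall_tconst => /=; rewrite normrM normfV (gtr0_norm (mu_gt0 _)).
rewrite ler_pdivrMr//; apply: (le_trans (mass_le_amass ch mu_gt0 _ _)).
apply: (@le_trans _ _ (amass J (if sel then s else t))).
  by case: (sel); exact: amass_child_le.
rewrite (le_trans (nh _ _ _ _ h))// [D * c]mulrC -mulrA ler_wpM2l//.
exact: ltW.
Qed.

(** Off-diagonal terms see only masses, and averaging preserves these. The form therefore changes
    only inside the high cubes, where the averaged functions are constants bounded by [D * x] and
    [D * y]. *)
Let cutoff_form d J (s t : tree d) : ~~ high J s t ->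
  `|form J s t| <= `|form J (cutoff J s s t) (cutoff J t s t)| +
    at_high (fun e J s t => `|form J s t| + K * D ^+ 2 * x * y * mu J) J s t.
Proof.
move=> h.
suff H : `|form J s t - form J (cutoff J s s t) (cutoff J t s t)| <=
    at_high (fun e J s t => `|form J s t| + K * D ^+ 2 * x * y * mu J) J s t.
  rewrite -[X in `|X| <= _](subrK (form J (cutoff J s s t) (cutoff J t s t))).
  by rewrite (le_trans (ler_normD _ _))// addrC lerD2l.
elim: d J s t h => [|d IH] J s t h /=; first by rewrite subrr normr0.
rewrite opprD addrACA -sumrB.
have -> : \sum_i \sum_(j | j != i) k J i j * mass (ch J i) (s i) * mass (ch J j) (t j) -
  \sum_i \sum_(j | j != i) k J i j *
   mass (ch J i) (if high (ch J i) (s i) (t i)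
      then tconst d (mass (ch J i) (s i) / mu (ch J i))
      else cutoff (ch J i) (s i) (s i) (t i)) *
   mass (ch J j) (if high (ch J j) (s j) (t j)
      then tconst d (mass (ch J j) (t j) / mu (ch J j))
      else cutoff (ch J j) (t j) (s j) (t j)) = 0.
  apply/eqP; rewrite subr_eq0; apply/eqP; apply: eq_bigr => i _; apply: eq_bigr => j _.
  have e (z s' t' : tree d) J' : mass J' (if high J' s' t'
      then tconst d (mass J' z / mu J') else cutoff J' z s' t') = mass J' z.
    by case: ifP => _; rewrite ?mass_cutoff// mass_tconst// divfK// gt_eqF.
  by rewrite !e.
rewrite addr0 (le_trans (ler_norm_sum _ _ _))// ler_sum// => i _.
case: ifPn => [hi|]; last exact: IH.
apply: (le_trans (ler_normB _ _)); rewrite lerD2l.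
have b (sel : bool) : `|mass (ch J i) (if sel then s i else t i) / mu (ch J i)| <=
    D * (if sel then x else y).
  rewrite normrM normfV (gtr0_norm (mu_gt0 _)) ler_pdivrMr//.
  apply: (le_trans (mass_le_amass ch mu_gt0 _ _)).
  apply: (@le_trans _ _ (amass J (if sel then s else t))).
    by case: sel; exact: amass_child_le.
  move: h; rewrite negb_or -!leNgt => /andP[h1 h2].
  apply: (@le_trans _ _ ((if sel then x else y) * mu J)); first by case: sel.
  rewrite [D * _]mulrC -mulrA ler_wpM2l//; case: sel; exact: ltW.
have D0 : 0 < D by apply: lt_le_trans D_ge1.
have := form_bnd (ch J i) (mulr_gt0 D0 x0) (mulr_gt0 D0 y0)
  (tall_tconst d (P := fun r => `|r| <= D * x) (b true))
  (tall_tconst d (P := fun r => `|r| <= D * y) (b false)).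
by move=> /le_trans; apply; rewrite le_eqVlt; apply/orP; left; apply/eqP; ring.
Qed.

Lemma stopping_form d J (s t : tree d) :
  amass J s <= x / 4 * mu J -> amass J t <= y / 4 * mu J ->
  `|form J s t| <= 2 * K * D ^+ 2 * x * y * mu J +
    at_high (fun e J s t => `|form J s t|) J s t.
Proof.
move=> hs ht; have m0 := mu_gt0 J.
have xm : 0 < x * mu J by rewrite mulr_gt0.
have ym : 0 < y * mu J by rewrite mulr_gt0.
have nh : ~~ high J s t by rewrite negb_or -!leNgt; apply/andP; split; lra.
have D0 : 0 < D by apply: lt_le_trans D_ge1.
apply: (le_trans (cutoff_form nh)).
rewrite at_highD at_highZ.
have h1 : `|form J (cutoff J s s t) (cutoff J t s t)| <= K * D ^+ 2 * x * y * mu J.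
  have := form_bnd J (mulr_gt0 D0 x0) (mulr_gt0 D0 y0)
    (cutoff_bnd true nh) (cutoff_bnd false nh).
  by move=> /le_trans; apply; rewrite le_eqVlt; apply/orP; left; apply/eqP; ring.
have h2 := high_packing J s t.
have h3 : amass J s / x + amass J t / y <= mu J.
  have a1 : amass J s / x <= mu J / 4 by rewrite ler_pdivrMr//; lra.
  have a2 : amass J t / y <= mu J / 4 by rewrite ler_pdivrMr//; lra.
  lra.
have Kxy : 0 <= K * D ^+ 2 * x * y.
  have K0 : 0 <= K by have := K_ge0 J; rewrite pmulr_lge0.
  by rewrite !mulr_ge0// ?exprn_ge0//; exact: ltW.
have := ler_wpM2l Kxy (le_trans h2 h3).
lra.
Qed.

End Stopping.

(** The integral over [J] of the product of the dyadic maximal functions of [s] and [t]; [m1] and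
    [m2] carry the largest averages met on the way down. [maxsq] is the integral of the square of
    one of them. *)
Fixpoint maxprod (m1 m2 : R) d J : tree d -> tree d -> R :=
  match d return tree d -> tree d -> R with
  | 0 => fun s t => Num.max m1 (@amass 0 J s / mu J) * Num.max m2 (@amass 0 J t / mu J) * mu J
  | e.+1 => fun s t => \sum_i maxprod (Num.max m1 (@amass e.+1 J s / mu J))
      (Num.max m2 (@amass e.+1 J t / mu J)) (ch J i) (s i) (t i)
  end.

Fixpoint maxsq (m : R) d J : tree d -> R :=
  match d return tree d -> R with
  | 0 => fun s => Num.max m (@amass 0 J s / mu J) ^+ 2 * mu J
  | e.+1 => fun s => \sum_i maxsq (Num.max m (@amass e.+1 J s / mu J)) (ch J i) (s i)
  end.

Let avg_ge0 d J (s : tree d) : 0 <= amass J s / mu J.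
Proof. by rewrite divr_ge0 ?amass_ge0// ltW. Qed.

Let maxprod_mono m1 m2 m1' m2' d J (s t : tree d) : 0 <= m1 <= m1' ->
  0 <= m2 <= m2' -> maxprod m1 m2 J s t <= maxprod m1' m2' J s t.
Proof.
have mx (a b c : R) : 0 <= a <= b -> 0 <= Num.max a c <= Num.max b c.
  by move=> /andP[a0 ab]; rewrite le_max a0/= ge_max !le_max ab lexx orbT.
elim: d m1 m2 m1' m2' J s t => [|d IH] m1 m2 m1' m2' J s t h1 h2 /=.
  have /andP[a0 ab] := mx _ _ (amass J s / mu J) h1.
  have /andP[c0 cd] := mx _ _ (amass J t / mu J) h2.
  by apply: ler_wpM2r; [exact: ltW|exact: ler_pM].
by apply: ler_sum => i _; apply: IH; exact: mx.
Qed.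

Let maxprod_ge0 m1 m2 d J (s t : tree d) : 0 <= m1 -> 0 <= m2 ->
  0 <= maxprod m1 m2 J s t.
Proof.
elim: d m1 m2 J s t => [|d IH] m1 m2 J s t m10 m20 /=.
  by rewrite !mulr_ge0// ?le_max ?m10 ?m20// ltW.
by apply: sumr_ge0 => i _; apply: IH; rewrite le_max ?m10 ?m20.
Qed.

Let at_high_mu_le x y d J (s t : tree d) :
  at_high x y (fun _ J _ _ => mu J) J s t <= mu J.
Proof.
elim: d J s t => [|d IH] J s t /=; first exact: ltW.
by rewrite [leRHS]mu_ch ler_sum// => i _; case: ifP => _ //; exact: IH.
Qed.

(** Off the high cubes the maximal functions are at least [m1] and [m2]; inside, forgetting the
    larger cubes only lowers them. *)
Let maxprod_ge x y m1 m2 d J (s t : tree d) : 0 <= m1 -> 0 <= m2 ->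
  m1 * m2 * (mu J - at_high x y (fun _ J _ _ => mu J) J s t) +
  at_high x y (fun e => @maxprod 0 0 e) J s t <= maxprod m1 m2 J s t.
Proof.
elim: d m1 m2 J s t => [|d IH] m1 m2 J s t m10 m20 /=.
  rewrite subr0 addr0 ler_wpM2r ?(ltW (mu_gt0 _))// ler_pM// le_max lexx//.
set m1' := Num.max _ _; set m2' := Num.max _ _.
have h1 : m1 <= m1' by rewrite le_max lexx.
have h2 : m2 <= m2' by rewrite le_max lexx.
have m1'0 := le_trans m10 h1; have m2'0 := le_trans m20 h2.
rewrite [in mu J]mu_ch -sumrB mulr_sumr -big_split/= ler_sum// => i _.
case: ifP => _.
  by rewrite subrr mulr0 add0r maxprod_mono// lexx.
apply: le_trans (IH _ _ _ _ _ m1'0 m2'0); rewrite lerD2r ler_wpM2r//; last exact: ler_pM.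
by rewrite subr_ge0 at_high_mu_le.
Qed.

Let form_le_maxprod d J (s t : tree d) :
  `|form J s t| <= 64 * K * D ^+ 2 * maxprod 0 0 J s t.
Proof.
elim/ltn_ind: d J s t => d IH J s t.
have K0 : 0 <= K by have := K_ge0 J; rewrite pmulr_lge0.
have D0 : 0 < D by apply: lt_le_trans D_ge1.
have KD0 : 0 <= 64 * K * D ^+ 2 by rewrite !mulr_ge0 ?(ltW D0).
have m0 := mu_gt0 J.
set a := amass J s / mu J; set b := amass J t / mu J.
have a0 : 0 <= a by exact: avg_ge0. have b0 : 0 <= b by exact: avg_ge0.
have aE : amass J s = a * mu J by rewrite divfK// gt_eqF.
have bE : amass J t = b * mu J by rewrite divfK// gt_eqF.
have mpE : maxprod 0 0 J s t = maxprod a b J s t.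
  case: d s t {IH} @a @b a0 b0 aE bE => [|d] s t a b a0 b0 aE bE /=;
  by rewrite -/a -/b !maxxx !(max_idPr _).
have [az|anz] := eqVneq a 0.
  rewrite (form_amass0 k mu_gt0); last by left; rewrite aE az mul0r.
  by rewrite normr0 mulr_ge0// maxprod_ge0.
have [bz|bnz] := eqVneq b 0.
  rewrite (form_amass0 k mu_gt0); last by right; rewrite bE bz mul0r.
  by rewrite normr0 mulr_ge0// maxprod_ge0.
(* With levels four times the averages the high cubes fill at most half of [J]. The local term 2 * 4
   * 4 = 32 times [K * D ^+ 2 * a * b * mu J] is then paid by the other half, where the product of
   the maximal functions is at least [a * b]; hence 64. *)
have x0 : 0 < 4 * a by rewrite mulr_gt0// lt0r anz.
have y0 : 0 < 4 * b by rewrite mulr_gt0// lt0r bnz.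
have := @stopping_form _ _ x0 y0 d J s t.
have -> : 4 * a / 4 = a by field.
have -> : 4 * b / 4 = b by field.
rewrite -aE -bE => /(_ (lexx _) (lexx _)) hf.
have hp := high_packing x0 y0 J s t.
have hh : at_high (4 * a) (4 * b) (fun e J' s' t' => `|form J' s' t'|) J s t <=
   64 * K * D ^+ 2 * at_high (4 * a) (4 * b) (fun e => @maxprod 0 0 e) J s t.
  by rewrite -at_highZ; apply: at_high_le => e J' s' t' ed; exact: IH.
have mp := @maxprod_ge (4 * a) (4 * b) a b d J s t a0 b0.
have hp' : at_high (4 * a) (4 * b) (fun _ J _ _ => mu J) J s t <= mu J / 2.
  apply: (le_trans hp); rewrite aE bE.
  have -> : a * mu J / (4 * a) + b * mu J / (4 * b) = mu J / 2.
    by field; rewrite anz bnz.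
  exact: lexx.
have ab0 : 0 <= a * b by rewrite mulr_ge0.
have : a * b * (mu J / 2) <= a * b * (mu J - at_high (4 * a) (4 * b) (fun _ J _ _ => mu J) J s t).
  by rewrite ler_wpM2l//; lra.
move=> /(fun h => le_trans (lerD h (lexx _)) mp); rewrite -mpE => /(ler_wpM2l KD0).
move: hf hh; move: (at_high _ _ _ _ _ _) (at_high _ _ _ _ _ _) (maxprod _ _ _ _ _) => A1 A2 A3.
lra.
Qed.

(** Doob's inequality in a form that allows induction. With M the running maximum and x the current
    average of |s|, raising M to x does not increase M^2 - 2 M x, by (M - x)^2 >= 0. At the last
    generation the claim is (M - 2|s|)^2 >= 0. At the root the bracket is negative or zero. *)
Let maxsq_le m d J (s : tree d) : 0 <= m ->
  maxsq m J s / 2 <= 2 * norm2 J s +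
    (Num.max m (amass J s / mu J) ^+ 2 * mu J -
     2 * Num.max m (amass J s / mu J) * amass J s).
Proof.
elim: d m J s => [|d IH] m J s m_ge0 /=.
  rewrite /norm2 /amass/=; set M := Num.max _ _; have m0 := mu_gt0 J.
  have := mulr_ge0 (sqr_ge0 (M - 2 * `|s|)) (ltW m0).
  have -> : (M - 2 * `|s|) ^+ 2 * mu J =
     M ^+ 2 * mu J - 4 * (M * (`|s| * mu J)) + 4 * (s ^+ 2 * mu J).
    by rewrite sqrrB exprMn real_normK ?num_real//; ring.
  lra.
set M := Num.max _ _.
have M0 : 0 <= M by rewrite le_max m_ge0.
have -> : M ^+ 2 * mu J - 2 * M * amass J s =
    \sum_i (M ^+ 2 * mu (ch J i) - 2 * M * amass (ch J i) (s i)).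
  by rewrite sumrB -!mulr_sumr -mu_ch.
rewrite /norm2/= mulr_suml mulr_sumr -big_split/= ler_sum// => i _.
apply: (le_trans (IH M (ch J i) (s i) M0)); rewrite lerD2l.
have mi := mu_gt0 (ch J i).
set x := amass _ (s i) / _; have xE : amass (ch J i) (s i) = x * mu (ch J i).
  by rewrite divfK// gt_eqF.
rewrite xE [2 * _ * _]mulrA [2 * M * _]mulrA -!mulrBl ler_wpM2r ?(ltW mi)//.
case: (leP M x) => Mx; last exact: lexx.
have := sqr_ge0 (M - x); rewrite sqrrB; lra.
Qed.

Let maxprod_le m1 m2 d J (s t : tree d) : 0 <= m1 -> 0 <= m2 ->
  maxprod m1 m2 J s t <= (maxsq m1 J s + maxsq m2 J t) / 2.
Proof.
elim: d m1 m2 J s t => [|d IH] m1 m2 J s t m10 m20 /=.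
  set a := Num.max _ _; set b := Num.max _ _.
  rewrite -mulrDl [leRHS]mulrAC ler_wpM2r ?(ltW (mu_gt0 _))//.
  have := sqr_ge0 (a - b); rewrite sqrrB; lra.
rewrite -big_split [leRHS]mulr_suml ler_sum// => i _; apply: IH;
  by rewrite le_max ?m10 ?m20.
Qed.

(* Sparse domination: stopping at the cubes where an average of [|s|] or [|t|]
   has quadrupled bounds the form by the integral of the product of the two
   dyadic maximal functions, and Doob's inequality concludes. *)
Lemma form_L2_le d J (s t : tree d) :
  `|form J s t| <= 128 * K * D ^+ 2 * (norm2 J s + norm2 J t).
Proof.
have K0 : 0 <= K by have := K_ge0 J; rewrite pmulr_lge0.
have D0 : 0 < D by apply: lt_le_trans D_ge1.
have KD0 : 0 <= 64 * K * D ^+ 2 by rewrite !mulr_ge0 ?(ltW D0).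
apply: (le_trans (form_le_maxprod J s t)).
have sq (z : tree d) : maxsq 0 J z <= 4 * norm2 J z.
  have := maxsq_le J z (lexx 0); rewrite (max_idPr (avg_ge0 J z)).
  set x := amass J z / mu J; have xE : amass J z = x * mu J.
    by rewrite divfK// gt_eqF.
  have : 0 <= x ^+ 2 * mu J by rewrite mulr_ge0 ?sqr_ge0// ltW.
  rewrite xE; lra.
have := ler_wpM2l KD0 (le_trans (maxprod_le J s t (lexx 0) (lexx 0))
  (ler_wpM2r _ (lerD (sq s) (sq t)))).
rewrite invr_ge0 ler0n => /(_ isT); lra.
Qed.

End LocalToGlobal.

(** * The diagonal coefficients *)

Section Diagonal.
Context {R : realFieldType} {I : Type} {iota : finType}.
Variables (ch : I -> iota -> I) (mu : I -> R) (k : I -> iota -> iota -> R).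
Variables (w : I -> R) (C C1 K K2 L : R) (below : I -> I -> Prop) (top : I).
Variables (kappa th : I -> R).
Variables (M : R) (beta E : I -> I -> R).
Notation tree := (dtree R iota).
Notation mass := (mass ch mu).
Notation amass := (amass ch mu).
Notation norm2 := (norm2 ch mu).
Notation form := (form ch mu k (fun=> 0)).
Notation stops := (first_stops ch mu M beta E).
Notation one d := (tconst d 1 : tree d).

Hypothesis mu_gt0 : forall J, 0 < mu J.
Hypothesis mu_ch : forall J, mu J = \sum_i mu (ch J i).
Hypothesis below_ch : forall J P i, below J P -> below (ch J i) P.
Hypothesis C_ge1 : 1 <= C.
Hypothesis C1_ge0 : 0 <= C1.
Hypothesis K_ge0 : 0 <= K.
Hypothesis K2_gt0 : 0 < K2.
Hypothesis L_gt0 : 0 < L.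
Hypothesis packing : forall d Q, stops (fun=> 0) mu d Q Q <= (1 - (4 * C)^-1) * mu Q.
Hypothesis form_one : forall d J, `|form J (one d) (one d)| <= K * mu J.
Hypothesis form_L2 : forall d J (s t : tree d),
  `|form J s t| <= K2 * (norm2 J s + norm2 J t).
Hypothesis w_ch : forall J, w J = \sum_i w (ch J i) +
  \sum_i \sum_(j | j != i) k J i j * mu (ch J i) * mu (ch J j).
Hypothesis corona : forall Q, exists d, stops (fun J => `|w J|) (fun=> 0) d Q Q <= C1 * mu Q.
Hypothesis kappa_top : kappa top = 0.
Hypothesis kappa_ch : forall J i, below J top ->
  kappa (ch J i) = kappa J + \sum_(j | j != i) k J i j * mu (ch J j).
Hypothesis th_ge0 : forall J, below J top -> 0 <= th J.
Hypothesis th_ch : forall J, below J top -> th J = \sum_i th (ch J i).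
Hypothesis w_kappa : forall J, below J top -> `|w J + kappa J * mu J| <= L * mu J + th J.
Hypothesis below_refl : below top top.

(** [kappa J] stands for the constant value on [J] of the adjoint applied to the indicator of [top]
    minus [J]. Thus [kap d top] is the adjoint image of 1_top without its diagonal part at
    generation [d]. *)
Let kap d J : tree d := tgen ch kappa d J.

Let form_kappa d J (s : tree d) : below J top ->
  tfold ch (fun J x => x * (kappa J * mu J)) J s = form J s (one d) + kappa J * mass J s.
Proof.
elim: d J s => [|d IH] J s bJ /=; first by rewrite mulr0 add0r /mass/=; ring.
rewrite (eq_bigr (fun i => form (ch J i) (s i) (one d) +
    kappa (ch J i) * mass (ch J i) (s i))); last by move=> i _; rewrite IH//; exact: below_ch.
rewrite big_split/= -addrA; congr (_ + _).
have -> : mass J s = \sum_i mass (ch J i) (s i) by [].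
rewrite mulr_sumr -big_split/=; apply: eq_bigr => i _.
rewrite kappa_ch// mulrDl addrC mulr_suml; congr (_ + _).
apply: eq_bigr => j _.
by rewrite mass_tconst// mul1r; ring.
Qed.

Let mass_kap d J : below J top ->
  mass J (kap d J) = form J (one d) (one d) + kappa J * mu J.
Proof.
move=> bJ; rewrite -[in kappa J * mu J](mul1r (mu J)) -(mass_tconst mu_ch d J 1) -form_kappa//.
elim: d J bJ => [|d IH] J bJ; rewrite /mass/= ?mul1r//.
by apply: eq_bigr => i _; apply: IH; exact: below_ch.
Qed.

Let norm2_kap d J : below J top ->
  norm2 J (kap d J) = form J (kap d J) (one d) + kappa J * mass J (kap d J).
Proof.
move=> bJ; rewrite -form_kappa//.
elim: d J bJ => [|d IH] J bJ; rewrite /norm2/= ?expr2 ?mulrA//.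
by apply: eq_bigr => i _; apply: IH; exact: below_ch.
Qed.

(** Self-duality: the norm N of [kap] is the form at [kap] and 1. Since [form_L2] bounds by a sum of
    squares, it is applied to [kap / (2 * K2)], so that half of N can be absorbed: N <= N/2 + 2 K2^2
    mu. *)
Let norm2_kap_le d : norm2 top (kap d top) <= 4 * K2 ^+ 2 * mu top.
Proof.
set N := norm2 _ _.
have NE : N = form top (kap d top) (one d) by rewrite /N norm2_kap// kappa_top mul0r addr0.
have c0 : 0 < (2 * K2)^-1 by rewrite invr_gt0 mulr_gt0.
have := form_L2 top (tmap ( *%R (2 * K2)^-1) (kap d top)) (tmap ( *%R 1) (one d)).
rewrite form_tmap !norm2_tmap -/N -NE norm2_tconst// expr1n !mul1r mulr1.
move=> /(le_trans (ler_norm _)) h.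
have : 4 * K2 * ((2 * K2)^-1 * N) <= 4 * K2 * (K2 * ((2 * K2)^-1 ^+ 2 * N + mu top)).
  by rewrite ler_wpM2l// mulr_ge0// ltW.
have -> : 4 * K2 * ((2 * K2)^-1 * N) = 2 * N by field; rewrite gt_eqF.
have -> : 4 * K2 * (K2 * ((2 * K2)^-1 ^+ 2 * N + mu top)) = N + 4 * K2 ^+ 2 * mu top.
  by field; rewrite gt_eqF.
lra.
Qed.

Let tail d J := norm2 J (kap d J) / L.

Let tail_ge0 d J : 0 <= tail d J.
Proof. by rewrite divr_ge0 ?norm2_ge0 ?(ltW L_gt0). Qed.

(** A first bound, useless as it stands because it involves [L]: [w J + kappa J * mu J] is the
    pairing of 1_J with the adjoint image of 1_top, and [kappa J * mu J] is the integral of [kap] up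
    to the off-diagonal form of 1. The integral is estimated by |t| <= L + t^2 / L. *)
Let w_le d J : below J top -> `|w J| <= (2 * L + K) * mu J + th J + tail d J.
Proof.
move=> bJ.
have h1 : `|kappa J * mu J| <= amass J (kap d J) + K * mu J.
  have -> : kappa J * mu J = mass J (kap d J) - form J (one d) (one d).
    by rewrite mass_kap// addrC addKr.
  by rewrite (le_trans (ler_normB _ _))// lerD// mass_le_amass.
have h2 : amass J (kap d J) <= L * mu J + tail d J.
  rewrite /tail; move: (kap d J) => t; elim: d J t {bJ h1} => [|d IH] J t.
    rewrite /amass /norm2/= mulrAC -mulrDl ler_wpM2r ?(ltW (mu_gt0 _))//.
    rewrite -(ler_pM2r L_gt0) mulrDl divfK ?gt_eqF// -(real_normK (num_real t)).
    have := sqr_ge0 (`|t| - L); rewrite sqrrB.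
    have := mulr_ge0 (normr_ge0 t) (ltW L_gt0); rewrite -expr2; lra.
  rewrite /amass /norm2/= [mu J]mu_ch mulr_sumr mulr_suml -big_split/=.
  by apply: ler_sum => i _; exact: IH.
have h3 : `|w J| <= `|w J + kappa J * mu J| + `|kappa J * mu J|.
  by rewrite -[X in `|X| <= _](addrK (kappa J * mu J)) ler_normB.
have := w_kappa bJ; lra.
Qed.

(** By [w_ch] the difference of [w] and the off-diagonal form of 1 is a sum over the children. It
    descends until a cube stops or the generation is exhausted. *)
Let w_first_stops d J P :
  `|w J - form J (one d) (one d)| <=
  stops (fun J => `|w J|) (fun=> 0) d J P + stops (fun=> 0) (fun J => `|w J|) d J P +
  K * stops (fun=> 0) mu d J P.
Proof.
elim: d J => [|d IH] J /=; first by rewrite mulr0 subr0 mulr0 !addr0.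
have -> : w J - (\sum_i form (ch J i) (one d) (one d) + \sum_i
     \sum_(j | j != i) k J i j * mass (ch J i) (one d) * mass (ch J j) (one d)) =
    \sum_i (w (ch J i) - form (ch J i) (one d) (one d)).
  rewrite w_ch sumrB opprD addrACA -[RHS]addr0; congr (_ + _).
  apply/eqP; rewrite subr_eq0; apply/eqP.
  apply: eq_bigr => i _; apply: eq_bigr => j _.
  by rewrite !mass_tconst// !mul1r.
rewrite (le_trans (ler_norm_sum _ _ _))// mulr_sumr -!big_split/= ler_sum// => i _.
case: ifP => _; last exact: IH.
by rewrite (le_trans (ler_normB _ _))// add0r lerD2l form_one.
Qed.

Let c := 4 * C * (C1 + 2 * K).
Let eta := (4 * C)^-1.

Let eta01 : 0 <= 1 - eta.
Proof.
rewrite subr_ge0 /eta invf_le1 ?mulr_gt0//; last exact: lt_le_trans C_ge1.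
by move: C_ge1; lra.
Qed.

(** Stopping cubes lie at different depths, whereas their tails must refer to one common finest
    generation to be summed. Hence bounds for all large [d], with a maximum over the children. *)
Let absorb_step x : 0 <= x ->
  (forall S, below S top -> exists D0, forall d, (D0 <= d)%N ->
    `|w S| <= x * mu S + th S + tail d S) ->
  forall e J P, below J top -> exists D0, forall d, (D0 <= d)%N ->
    stops (fun=> 0) (fun J => `|w J|) e J P <=
    x * stops (fun=> 0) mu e J P + th J + tail d J.
Proof.
move=> x0 hx; elim=> [|e IH] J P bJ.
  by exists 0 => d _ /=; rewrite mulr0 add0r addr_ge0// th_ge0.
have bi i : below (ch J i) top by exact: below_ch.
have [D1 hD1] : exists D1 : iota -> nat, forall i d, (D1 i <= d)%N ->
    (if stop mu M beta E P (ch J i) then `|w (ch J i)|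
     else stops (fun=> 0) (fun J => `|w J|) e (ch J i) P) <=
    x * (if stop mu M beta E P (ch J i) then mu (ch J i)
         else stops (fun=> 0) mu e (ch J i) P) + th (ch J i) + tail d (ch J i).
  apply/(@fin_all_exists _ (fun=> nat) (fun i D => forall d, (D <= d)%N -> _)) => i.
  by case: ifP => _; [exact: hx|exact: IH].
exists (\max_i D1 i).+1 => -[//|d]; rewrite ltnS => Dd /=.
rewrite th_ch// /tail/= /norm2/= mulr_suml mulr_sumr -!big_split/=.
apply: ler_sum => i _; apply: hD1; apply: leq_trans Dd; exact: leq_bigmax.
Qed.

(** One iteration multiplies the coefficient that contains [L] by [1 - eta], the fraction that the
    stopping cubes can cover; [c] is the fixed point of c = C1 + 2 K + (1 - eta) c. The terms [th]
    and [tail] are additive, so they do not accumulate. *)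
Let absorb j Q : below Q top -> exists D0, forall d, (D0 <= d)%N ->
  `|w Q| <= (c + (1 - eta) ^+ j * (2 * L + K)) * mu Q + th Q + tail d Q.
Proof.
have LK : 0 <= 2 * L + K by rewrite addr_ge0// mulr_ge0// ltW.
have C0 : 0 < C by apply: lt_le_trans C_ge1.
have c0 : 0 <= c by rewrite /c mulr_ge0 ?addr_ge0 ?mulr_ge0// ltW.
elim: j Q => [|j IH] Q bQ.
  exists 0 => d _; rewrite expr0 mul1r (le_trans (w_le d bQ))//.
  by rewrite !lerD2r ler_wpM2r ?(ltW (mu_gt0 _))// lerDr.
have x0 : 0 <= c + (1 - eta) ^+ j * (2 * L + K).
  by rewrite addr_ge0// mulr_ge0// exprn_ge0.
have [e he] := corona Q.
have [D0 hD0] := absorb_step x0 IH e Q bQ; exists D0 => d /hD0 h.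
have h1 := w_first_stops e Q Q.
have h2 := form_one e Q.
have h3 : `|w Q| <= `|w Q - form Q (one e) (one e)| + `|form Q (one e) (one e)|.
  by rewrite -[X in `|X| <= _](subrK (form Q (one e) (one e))) ler_normD.
have pk := packing e Q.
have h4 : K * stops (fun=> 0) mu e Q Q <= K * mu Q.
  by rewrite ler_wpM2l// first_stops_le.
have h5 := ler_wpM2l x0 pk.
have -> : (c + (1 - eta) ^+ j.+1 * (2 * L + K)) * mu Q =
   (C1 + 2 * K) * mu Q + (c + (1 - eta) ^+ j * (2 * L + K)) * ((1 - eta) * mu Q).
  rewrite [_ ^+ j.+1]exprSr.
  have -> : c = C1 + 2 * K + c * (1 - eta).
    by rewrite /c /eta; field; rewrite gt_eqF.
  rewrite /c /eta; field; by rewrite gt_eqF.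
move: h5; rewrite -/eta; lra.
Qed.

(* Off the stopping cubes [w] is under control, and on them it is recovered
   by iteration; the remainder after [j] steps is controlled because the
   truncated singular integrals [kappa] are bounded in L2. *)
Lemma diagonal_le j : `|w top| <=
  (4 * C * (C1 + 2 * K) + (1 - (4 * C)^-1) ^+ j * (2 * L + K)) * mu top + th top +
  4 * K2 ^+ 2 * mu top / L.
Proof.
have [d h] := absorb j below_refl; apply: (le_trans (h d (leqnn d))).
by rewrite lerD2l ler_wpM2r ?norm2_kap_le// invr_ge0 ltW.
Qed.

End Diagonal.

Require Import Defs.
From mathcomp Require Import all_classical all_reals all_analysis.
From mathcomp Require Import measurable_realfun zify.

Import numFieldNormedType.Exports.

Local Open Scope classical_set_scope.
Local Open Scope ring_scope.

(** * Dyadic cubes *)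

Section Cubes.
Context {R : realType} (n : nat).

Definition cubei := (int * 'rV[int]_n)%type.
Definition corner := {ffun 'I_n -> bool}.
Implicit Types (J P : cubei) (x : 'rV[R]_n) (e : corner).

Definition cube J : set 'rV[R]_n := dyadic_cube J.1 J.2.
Definition child J e : cubei := (J.1 - 1, \row_i (2 * J.2 ord0 i + (e i)%:Z)).
Definition side J : R := 2 ^ J.1.
Definition cmu J : R := side J ^+ n.

Lemma side_gt0 J : 0 < side J. Proof. by rewrite exprz_gt0. Qed.

Lemma side_child J e : side J = 2 * side (child J e).
Proof.
rewrite /side /=.
by rewrite -[X in X * _]expr1z -expfzDr// addrC subrK.
Qed.

Lemma cmu_gt0 J : 0 < cmu J. Proof. by rewrite exprn_gt0// side_gt0. Qed.

Lemma cmu_child J e : cmu J = 2 ^+ n * cmu (child J e).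
Proof. by rewrite /cmu (side_child J e) exprMn. Qed.

Lemma cmu_sum J : cmu J = \sum_e cmu (child J e).
Proof.
rewrite (eq_bigr (fun=> cmu (child J [ffun=> false]))).
  by rewrite sumr_const card_ffun card_bool card_ord (cmu_child J [ffun=> false])
             -natrX mulr_natl.
by move=> e _; rewrite /cmu /side.
Qed.

Lemma dyadic_cubei J : dyadic (cube J).
Proof. by exists J.1, J.2. Qed.

Lemma cubeP J x : cube J x <-> forall i,
  (J.2 ord0 i)%:~R * side J <= x ord0 i < (J.2 ord0 i + 1)%:~R * side J.
Proof. by []. Qed.

Lemma cube_child_sub J e : cube (child J e) `<=` cube J.
Proof.
move=> x /cubeP h; apply/cubeP => i; have := h i.
rewrite mxE (side_child J e); have := side_gt0 (child J e).
set s := side _; rewrite !rmorphD rmorphM/=.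
by case: (e i) => /= s0 /andP[h1 h2]; apply/andP; split; lra.
Qed.

Definition corner_of J x : corner :=
  [ffun i => (2 * J.2 ord0 i + 1)%:~R * (side J / 2) <= x ord0 i].

Lemma cube_childP J x e : cube J x -> cube (child J e) x <-> e = corner_of J x.
Proof.
have sE : side J / 2 = side (child J e).
  by rewrite (side_child J e) mulrC mulKf.
have s0 := side_gt0 (child J e).
move=> /cubeP h; split => [/cubeP h'|->].
  apply/ffunP => i; rewrite ffunE sE; have := h' i; rewrite mxE.
  set s := side _ in s0 *.
  by case: (e i) => /= /andP[h1 h2]; apply/esym; [exact: h1|];
    apply/negbTE; rewrite -ltNge; move: h2; rewrite addr0.
apply/cubeP => i; have := h i; rewrite mxE ffunE.
rewrite (_ : side (child J (corner_of J x)) = side J / 2); last by rewrite sE.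
have -> : side J = 2 * (side J / 2) by rewrite mulrC divfK.
rewrite [2 * _ / 2]mulrAC divff// mul1r.
have : 0 < side J / 2 by rewrite sE.
move: (side J / 2) => q q0; rewrite !rmorphD !rmorphM/= => /andP[h1 h2].
by case: (lerP ((2%:~R * (J.2 ord0 i)%:~R + 1%:~R) * q) (x ord0 i)) => /= h3;
  apply/andP; split; lra.
Qed.

Lemma cube_inj (k : int) (m m' : 'rV[int]_n) x :
  cube (k, m) x -> cube (k, m') x -> m = m'.
Proof.
move=> /cubeP h /cubeP h'; apply/rowP => i.
have := h i; have := h' i; rewrite /= -!ler_pdivlMr ?side_gt0// -!ltr_pdivrMr ?side_gt0//.
move=> /floor_def + /floor_def; rewrite /side/= => <- <-; by [].
Qed.

Lemma indic_cube_sum J x : \1_(cube J) x = \sum_e (\1_(cube (child J e)) x : R).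
Proof.
have [xJ|xJ] := pselect (cube J x).
  rewrite indicE mem_set// (bigD1 (corner_of J x))//= indicE mem_set; last exact/cube_childP.
  rewrite big1 ?addr0// => e /eqP eJ; rewrite indicE memNset//.
  by move/(cube_childP _ xJ).
rewrite indicE memNset// big1// => e _; rewrite indicE memNset// => /cube_child_sub.
exact.
Qed.

Lemma measurable_cube J : measurable (cube J).
Proof. exact: measurable_rV_box. Qed.

Lemma lebesgue_cube J : lebesgue_rV n (cube J) = (cmu J)%:E.
Proof.
rewrite /cube /dyadic_cube lebesgue_rV_box; last first.
  move=> i; rewrite ler_wpM2r ?exprz_ge0// ler_int lerDl//.
congr (_%:E); rewrite (eq_bigr (fun=> side J)); first by rewrite prodr_const card_ord.
by move=> i _; rewrite -mulrBl -rmorphB/= addrAC subrr add0r mul1r.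
Qed.

(** Descent in the tree instead of inclusion of sets: properties are carried down one generation at
    a time by induction. *)
Inductive below : cubei -> cubei -> Prop :=
| below_refl P : below P P
| below_child J P e : below J P -> below (child J e) P.

Lemma below_sub J P : below J P -> cube J `<=` cube P.
Proof.
by move=> h; elim: h => {J P} [P|J P e _ IH] x; [|move=> /cube_child_sub /IH].
Qed.

Lemma below_trans J1 J2 J3 : below J1 J2 -> below J2 J3 -> below J1 J3.
Proof.
move=> h; elim: h J3 => {J1 J2} [P|J P e _ IH] J3 h3 //.
by apply: below_child; exact: IH.
Qed.

End Cubes.
Arguments side {R n} J.
Arguments cmu {R n} J.

(** * Integrals of real-valued functions *)

Section RealIntegral.
Context {d : measure_display} {T : measurableType d} {R : realType}.
Variable mu : {measure set T -> \bar R}.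
Implicit Types (f g : T -> R) (A B : set T).

Definition igr f := mu.-integrable setT (EFin \o f).
Definition Int f : R := \int[mu]_x f x.

Lemma igr_meas f : igr f -> measurable_fun setT f.
Proof. by move=> /measurable_int /measurable_EFinP. Qed.

Lemma igr0 : igr (fun=> 0).
Proof. exact: integrable0. Qed.

Lemma igrD f g : igr f -> igr g -> igr (fun x => f x + g x).
Proof. by move=> hf hg; have := integrableD measurableT hf hg. Qed.

Lemma igrB f g : igr f -> igr g -> igr (fun x => f x - g x).
Proof. by move=> hf hg; have := integrableB measurableT hf hg. Qed.

Lemma igrZ a f : igr f -> igr (fun x => a * f x).
Proof. by move=> hf; have := integrableZl measurableT a hf. Qed.

Lemma igr_norm f : igr f -> igr (fun x => `|f x|).
Proof. exact: integrable_norm. Qed.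

Lemma igr_sum (I : Type) (s : seq I) (P : pred I) (f : I -> T -> R) :
  (forall i, P i -> igr (f i)) -> igr (fun x => \sum_(i <- s | P i) f i x).
Proof.
move=> h; have := integrable_sum measurableT s h.
by apply: eq_integrable => // x _ /=; rewrite sumEFin.
Qed.

Lemma igr_le f g : measurable_fun setT f -> (forall x, `|f x| <= g x) ->
  igr g -> igr f.
Proof.
move=> mf fg; apply: le_integrable => //; first exact/measurable_EFinP.
by move=> x _ /=; rewrite lee_fin (le_trans (fg x))// ler_norm.
Qed.

Lemma meas_indicM A f : measurable A -> measurable_fun setT f ->
  measurable_fun setT (fun x => \1_A x * f x).
Proof. by move=> mA mf; apply: measurable_funM => //; exact: measurable_indic. Qed.

Lemma indic01 A x : 0 <= (\1_A x : R) <= 1.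
Proof. by rewrite indicE; case: (x \in A); rewrite lexx ler01. Qed.

Lemma norm_indicM A f x : `|\1_A x * f x| <= `|f x|.
Proof.
have /andP[a0 a1] := indic01 A x.
by rewrite normrM ger0_norm// ler_piMl.
Qed.

Lemma indicMM A B f x : \1_A x * (\1_B x * f x) = \1_(A `&` B) x * f x.
Proof. by rewrite indicI mulrA. Qed.

Lemma igr_indicM A f : measurable A -> igr f -> igr (fun x => \1_A x * f x).
Proof.
move=> mA hf; apply: igr_le (igr_norm hf); last by move=> x; exact: norm_indicM.
by apply: meas_indicM => //; exact: igr_meas.
Qed.

Lemma indicM_norm A f x : \1_A x * `|f x| = `|\1_A x * f x|.
Proof. by have /andP[a0 _] := indic01 A x; rewrite normrM (ger0_norm a0). Qed.

Lemma igr_indic_norm A f : igr (fun x => \1_A x * f x) -> igr (fun x => \1_A x * `|f x|).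
Proof.
move=> /igr_norm; congr igr; apply/funext => x; by rewrite indicM_norm.
Qed.

Lemma indicM_restrict A f : (fun x => \1_A x * f x) = f \_ A.
Proof. by apply/funext => x; rewrite patchE indicE; case: ifP; rewrite ?mul1r ?mul0r. Qed.

Lemma igr_indicP A f : measurable A ->
  igr (fun x => \1_A x * f x) <-> mu.-integrable A (EFin \o f).
Proof.
move=> mA; rewrite integrable_mkcond// /igr.
rewrite (_ : EFin \o (fun x => \1_A x * f x) = (EFin \o f) \_ A)//.
by apply/funext => x; rewrite /= patchE indicE; case: ifP; rewrite ?mul1r ?mul0r.
Qed.

Lemma Int_indicM A f : Int (fun x => \1_A x * f x) = \int[mu]_(x in A) f x.
Proof. by rewrite /Int [RHS]Rintegral_mkcond indicM_restrict. Qed.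

Lemma EFin_Int f : igr f -> (Int f)%:E = (\int[mu]_x (f x)%:E)%E.
Proof. by move=> hf; rewrite /Int /Rintegral fineK// integrable_fin_num. Qed.

Lemma IntD f g : igr f -> igr g -> Int (fun x => f x + g x) = Int f + Int g.
Proof. by move=> hf hg; rewrite /Int RintegralD. Qed.

Lemma IntB f g : igr f -> igr g -> Int (fun x => f x - g x) = Int f - Int g.
Proof. by move=> hf hg; rewrite /Int RintegralB. Qed.

Lemma IntZ a f : igr f -> Int (fun x => a * f x) = a * Int f.
Proof. by move=> hf; rewrite /Int RintegralZl. Qed.

Lemma Int0 : Int (fun=> 0) = 0.
Proof. by rewrite /Int /Rintegral integral0. Qed.

Lemma Int_sum (I : Type) (s : seq I) (P : pred I) (f : I -> T -> R) :
  (forall i, P i -> igr (f i)) ->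
  Int (fun x => \sum_(i <- s | P i) f i x) = \sum_(i <- s | P i) Int (f i).
Proof.
move=> h; elim: s => [|i s IH].
  by rewrite big_nil -[RHS]Int0; congr Int; apply/funext => x; rewrite big_nil.
rewrite big_cons -IH; case: ifPn => Pi.
  rewrite -IntD; [|exact: h|exact: igr_sum].
  by congr Int; apply/funext => x; rewrite big_cons Pi.
by congr Int; apply/funext => x; rewrite big_cons (negbTE Pi).
Qed.

Lemma Int_ge0 f : (forall x, 0 <= f x) -> 0 <= Int f.
Proof. by move=> h; apply: Rintegral_ge0. Qed.

Lemma le_Int f g : igr f -> igr g -> (forall x, f x <= g x) -> Int f <= Int g.
Proof. by move=> hf hg h; apply: le_Rintegral. Qed.

Lemma le_norm_Int f : igr f -> `|Int f| <= Int (fun x => `|f x|).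
Proof. by move=> hf; apply: le_normr_Rintegral. Qed.

Lemma Int_norm_le f g : measurable_fun setT f -> igr g -> (forall x, `|f x| <= g x) ->
  `|Int f| <= Int g.
Proof.
move=> mf hg fg; have hf := igr_le mf fg hg.
by apply: (le_trans (le_norm_Int hf)); apply: le_Int => //; exact: igr_norm.
Qed.

Lemma igr_indic A : measurable A -> (mu A < +oo)%E -> igr \1_A.
Proof.
move=> mA Afin; apply/integrableP; split; first exact/measurable_EFinP/measurable_indic.
rewrite (eq_integral (fun x => (\1_A x)%:E)); first by rewrite integral_indic// setIT.
by move=> x _ /=; rewrite ger0_norm//; have /andP[] := indic01 A x.
Qed.

Lemma Int_indic A : measurable A -> Int \1_A = fine (mu A).
Proof. by move=> mA; rewrite /Int /Rintegral integral_indic// setIT. Qed.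

End RealIntegral.

(** * Nesting of dyadic cubes; functions determined by their integrals over cubes *)

Section DyadicStructure.
Context {R : realType} (n : nat).
Notation cubei := (cubei n).
Notation cube := (@cube R n).
Implicit Types (J P : cubei) (x : 'rV[R]_n).

Definition parent J : cubei := (J.1 + 1, \row_i (J.2 ord0 i %/ 2)%Z).
Definition parity J : corner n := [ffun i => (J.2 ord0 i %% 2)%Z == 1].

Lemma parentK J : child (parent J) (parity J) = J.
Proof.
case: J => k m; rewrite /child /parent /=; congr pair; first by rewrite addrK.
apply/rowP => i; rewrite !mxE ffunE /=.
have := divz_eq (m ord0 i) 2; have := modz_ge0 (m ord0 i) (isT : 2 != 0 :> int).
have := ltz_pmod (m ord0 i) (isT : 0 < 2 :> int).
move: (_ %/ _)%Z (_ %% _)%Z => q r; case: eqP => /= H r2 r0 E;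
  rewrite -[RHS]/(m ord0 i) E; lia.
Qed.

Lemma below_parent J P : below (parent J) P -> below J P.
Proof. by move=> h; rewrite -(parentK J); exact: below_child. Qed.

Definition cube_at (k : int) x : cubei := (k, \row_i Num.floor (x ord0 i / 2 ^ k)).

Lemma cube_atP k x : cube (cube_at k x) x.
Proof.
apply/cubeP => i; rewrite mxE /side /= -ler_pdivlMr ?exprz_gt0// -ltr_pdivrMr ?exprz_gt0//.
by rewrite floor_le_tmp floorD1_gt.
Qed.

Lemma below_iter_parent j J : below J (iter j parent J).
Proof.
elim: j J => [|j IH] J; first exact: below_refl.
by apply: below_parent; rewrite iterSr; exact: IH.
Qed.

Lemma iter_parent_level j J : (iter j parent J).1 = J.1 + j%:Z.
Proof.
elim: j => [|j IH] /=; first by rewrite addr0.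
by rewrite IH -addrA -natz natr1 natz.
Qed.

Lemma cube_nested J P x : cube J x -> cube P x -> J.1 <= P.1 -> below J P.
Proof.
move=> xJ xP JP; pose j := `|P.1 - J.1|%N.
have lv : (iter j parent J).1 = P.1.
  by rewrite iter_parent_level /j; lia.
suff <- : iter j parent J = P by exact: below_iter_parent.
have := below_sub (below_iter_parent j J) xJ.
move: (iter j parent J) lv => [k m]; case: P xP {JP j xJ} => [k' m'] xP /= -> h.
by congr pair; exact: (cube_inj h xP).
Qed.

Lemma cube_meet J P : [\/ cube J `&` cube P = set0,
  cube J `<=` cube P | cube P `<=` cube J].
Proof.
have [e|/set0P[x [xJ xP]]] := eqVneq (cube J `&` cube P) set0; first exact: Or31.
have [h|h] := lerP J.1 P.1.
  by apply: Or32; exact: below_sub (cube_nested xJ xP h).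
by apply: Or33; exact: below_sub (cube_nested xP xJ (ltW h)).
Qed.

Lemma cube_pair_disjoint (k : int) (m m' : 'rV[int]_n) : m <> m' ->
  cube (k, m) `&` cube (k, m') = set0.
Proof. by move=> mm'; rewrite -subset0 => x [h1 h2]; exact/mm'/(cube_inj h1 h2). Qed.

Lemma small_side (dl : R) : 0 < dl -> exists N : nat, (2 : R) ^ (- N%:Z) < dl.
Proof.
move=> d0; exists (Num.bound dl^-1).
have h : dl^-1 < 2 ^+ Num.bound dl^-1.
  have := archi_boundP (ltW (etrans (invr_gt0 dl) d0)).
  move=> /lt_le_trans; apply; rewrite -natrX ler_nat; exact: ltnW (ltn_expl _ _).
by rewrite -[X in X < _]invr_expz invf_plt ?posrE// exprn_gt0.
Qed.

Definition cubes_or_empty : set (set 'rV[R]_n) := [set A | A = set0 \/ exists J, A = cube J].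

Lemma cubes_setI_closed : setI_closed cubes_or_empty.
Proof.
move=> A B [->|[J ->]]; first by rewrite set0I; left.
move=> [->|[P ->]]; first by rewrite setI0; left.
have [->|h|h] := cube_meet J P; first by left.
  by right; exists J; apply/setIidPl.
by right; exists P; apply/setIidPr.
Qed.

Lemma countable_cubei : countable [set: cubei].
Proof. exact: countableP. Qed.

(** A half-space x_i < a is the countable union of the dyadic cubes inside it: around x take a cube
    of side less than a - x_i. *)
Lemma measurable_sub_cubes (A : set 'rV[R]_n) : measurable A -> <<s cubes_or_empty >> A.
Proof.
suff : measurable `<=` <<s cubes_or_empty >> by apply.
apply: smallest_sub; first exact: smallest_sigma_algebra.
move=> B; rewrite -bigcup_seq/= => -[i _ [C mC <-]].
suff : measurable_fun setT (@rV_coord R n i :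
    g_sigma_algebraType cubes_or_empty -> measurableTypeR R).
  by move=> /(_ measurableT _ mC); rewrite setTI.
apply: (measurability _ (RGenInftyO.measurableE R)).
move=> _ [_ [a ->] <-]; rewrite setTI.
have -> : rV_coord i @^-1` `]-oo, a[ =
    \bigcup_(J : cubei) (if `[< cube J `<=` rV_coord i @^-1` `]-oo, a[ >] then cube J else set0).
  apply/seteqP; split => [x /= xa|x [J _]]; last by case: asboolP => // h; exact: h.
  move: (xa); rewrite in_itv/= => xa'.
  have [N hN] := small_side (etrans (subr_gt0 _ _) xa').
  exists (cube_at (- N%:Z) x) => //; case: asboolP => [_|[]]; first exact: cube_atP.
  move=> y /cubeP /(_ i) /andP[_ hy].
  have /cubeP /(_ i) /andP[hx _] := cube_atP (- N%:Z) x.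
  rewrite /rV_coord /= in_itv/=; move: hx hy hN xa'; rewrite /rV_coord/= /side/=.
  rewrite rmorphD/= mulrDl mul1r; set z := _ * _; set s := _ ^ _; lra.
apply: countable_bigcupT_measurable; first exact: countable_cubei.
move=> J; case: ifP => _; last exact: measurable0.
by apply: sub_sigma_algebra; right; exists J.
Qed.

Local Notation mu := (lebesgue_rV n : {measure set 'rV[R]_n -> \bar R}).

Lemma Int_bigcup (h : 'rV[R]_n -> R) (F : (set 'rV[R]_n)^nat) :
  igr mu h -> (forall i, measurable (F i)) -> nondecreasing_seq F ->
  (forall i, Int mu (fun x => \1_(F i) x * h x) = 0) ->
  Int mu (fun x => \1_(\bigcup_i F i) x * h x) = 0.
Proof.
move=> ih mF ndF F0.
have mU : measurable (\bigcup_i F i) by exact: bigcup_measurable.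
have mh := igr_meas ih.
have ind k := EFin_Int (igr_indicM (mF k) ih).
have [| | | | |_ _] := @dominated_convergence _ _ _ mu setT measurableT
  (fun k x => (\1_(F k) x * h x)%:E) (fun x => (\1_(\bigcup_i F i) x * h x)%:E)
  (fun x => `|h x|%:E).
- by move=> k; apply/measurable_EFinP; exact: meas_indicM.
- by apply/measurable_EFinP; exact: meas_indicM.
- apply: aeW => x _; apply: cvg_near_cst; have [xU|xU] := pselect ((\bigcup_i F i) x).
    case: (xU) => i _ Fi; near=> k; rewrite !indicE !mem_set//.
    have : (i <= k)%N by near: k; exact: nbhs_infty_ge.
    by move=> /ndF /subsetPset; exact.
  near=> k; rewrite !indicE !memNset// => Fk; by apply: xU; exists k.
- exact: igr_norm.
- by apply: aeW => x k _; rewrite /= lee_fin norm_indicM.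
rewrite (_ : [sequence _]_n = fun=> 0%E); last first.
  by apply/funext => k /=; rewrite -ind F0.
move=> /cvg_lim; rewrite lim_cst// => /(_ (@ereal_hausdorff _)) e.
by apply: EFin_inj; rewrite EFin_Int ?e//; exact: igr_indicM.
Unshelve. all: by end_near.
Qed.

(** Cubes and the empty set form a pi-system that generates the Borel sets, and the sets of zero
    integral form a lambda-system. *)
Lemma Int_measurable0 (h : 'rV[R]_n -> R) J0 :
  igr mu (fun x => \1_(cube J0) x * h x) ->
  (forall J, cube J `<=` cube J0 -> Int mu (fun x => \1_(cube J) x * h x) = 0) ->
  forall A, measurable A -> Int mu (fun x => \1_A x * (\1_(cube J0) x * h x)) = 0.
Proof.
move=> ih h0 A mA.
set f := fun x => \1_(cube J0) x * h x in ih *.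
pose G := [set A | measurable A /\ Int mu (fun x => \1_A x * f x) = 0].
have mC J := @measurable_cube R n J.
suff : <<s cubes_or_empty >> `<=` G by move=> /(_ _ (measurable_sub_cubes mA)) [].
apply: lambda_system_subset => //; first exact: cubes_setI_closed.
- split => //.
  + split=> //; rewrite -[RHS](h0 J0)//; congr Int; apply/funext => x.
    by rewrite indicT mul1r.
  + move=> B D DB [mB B0] [mD D0]; split; first exact: measurableD.
    rewrite (_ : (fun x => _) = fun x => \1_B x * f x - \1_D x * f x).
      by rewrite IntB ?B0 ?D0 ?subrr//; exact: igr_indicM.
    apply/funext => x; rewrite -mulrBl; congr (_ * _); rewrite !indicE in_setD.
    have [xD|xD] := boolP (x \in D); rewrite ?andbF ?andbT ?subr0//.
    by rewrite (_ : x \in B) ?subrr//; apply/mem_set/DB; rewrite inE in xD.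
  + move=> F ndF HF; split; first by apply: bigcup_measurable => k _; have [] := HF k.
    by apply: Int_bigcup => // k; have [] := HF k.
- move=> B [->|[J ->]].
    split => //; rewrite -[RHS](Int0 mu); congr Int; apply/funext => x.
    by rewrite indic0 mul0r.
  split=> //; have [e|JJ0|J0J] := cube_meet J J0.
  + rewrite -[RHS](Int0 mu); congr Int; apply/funext => x.
    by rewrite /f indicMM e indic0 mul0r.
  + rewrite -[RHS](h0 J)//; congr Int; apply/funext => x.
    by rewrite /f indicMM; move/setIidPl : JJ0 => ->.
  + rewrite -[RHS](h0 J0)//; congr Int; apply/funext => x.
    by rewrite /f indicMM; move/setIidPr : J0J => ->.
Qed.

Lemma dyadic_ae0 (h : 'rV[R]_n -> R) : measurable_fun setT h ->
  (forall J, igr mu (fun x => \1_(cube J) x * h x)) ->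
  (forall J, Int mu (fun x => \1_(cube J) x * h x) = 0) ->
  ae_eq mu setT h (fun=> 0).
Proof.
move=> mh ih h0.
have H J : {ae mu, forall x, cube J x -> h x = 0}.
  have H0 : ae_eq mu setT (EFin \o (fun x => \1_(cube J) x * h x)) (cst 0%E).
    apply: integral_ae_eq => //; first exact: ih.
    move=> E _ mE; rewrite integral0.
    have : Int mu (fun x => \1_E x * (\1_(cube J) x * h x)) = 0.
      by apply: Int_measurable0.
    rewrite Int_indicM => e; rewrite -(@fineK _ (integral _ _ _)).
      by rewrite -[fine _]/(Rintegral _ _ _) e.
    apply: integrable_fin_num => //.
    by apply/(igr_indicP _ (fun x => \1_(cube J) x * h x) mE)/igr_indicM.
  apply: filterS H0 => x e0 xJ; have e := e0 Logic.I.
  have [] : (\1_(cube J) x * h x)%:E = 0%:E := e.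
  by rewrite indicE mem_set// mul1r.
have H1 : {ae mu, forall x, forall J, cube J x -> h x = 0}.
  have [N HN] : exists f : nat -> cubei, forall J, exists k, f k = J.
    exists (fun k => odflt (0, 0) (unpickle k)) => J; exists (pickle J).
    by rewrite pickleK.
  have H0 : {ae mu, forall x, forall k, cube (N k) x -> h x = 0}.
    apply/ae_foralln => k; exact: H.
  by apply: filterS H0 => x hx J; have [k <-] := HN J; exact: hx.
by apply: filterS H1 => x /= /(_ (cube_at 0 x) (cube_atP 0 x)).
Qed.

End DyadicStructure.

(** * Square-integrable functions and dyadic martingales *)

Section SquareIntegrable.
Context {d : measure_display} {T : measurableType d} {R : realType}.
Variable mu : {measure set T -> \bar R}.
Implicit Types (f g : T -> R) (A B : set T).

Definition sqi f := measurable_fun setT f /\ igr mu (fun x => f x ^+ 2).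
Definition sqn f := Int mu (fun x => f x ^+ 2).

Lemma sqn_ge0 f : 0 <= sqn f.
Proof. by apply: Int_ge0 => x; exact: sqr_ge0. Qed.

Lemma prod_le_sqr (x y : R) : `|x * y| <= (x ^+ 2 + y ^+ 2) / 2.
Proof.
rewrite normrM; have := sqr_ge0 (`|x| - `|y|).
rewrite sqrrB !real_normK ?num_real//; lra.
Qed.

Lemma sqi_mul f g : sqi f -> sqi g -> igr mu (fun x => f x * g x).
Proof.
move=> [mf hf] [mg hg].
apply: (@igr_le _ _ _ _ _ (fun x => 2^-1 * (f x ^+ 2 + g x ^+ 2))).
- exact: measurable_funM.
- by move=> x; rewrite [leRHS]mulrC; exact: prod_le_sqr.
- exact/igrZ/igrD.
Qed.

Lemma sqiZ a f : sqi f -> sqi (fun x => a * f x).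
Proof.
move=> [mf hf]; split; first exact: measurable_funM.
rewrite (_ : (fun x => _) = fun x => a ^+ 2 * f x ^+ 2); first exact: igrZ.
by apply/funext => x; rewrite exprMn.
Qed.

Lemma sqiD f g : sqi f -> sqi g -> sqi (fun x => f x + g x).
Proof.
move=> sf sg; have fg := sqi_mul sf sg; case: sf sg => [mf hf] [mg hg]; split.
  exact: measurable_funD.
rewrite (_ : (fun x => _) = fun x => f x ^+ 2 + 2 * (f x * g x) + g x ^+ 2).
  by apply: igrD => //; apply: igrD => //; exact: igrZ.
by apply/funext => x; rewrite sqrrD; ring.
Qed.

Lemma sqiB f g : sqi f -> sqi g -> sqi (fun x => f x - g x).
Proof.
move=> sf sg; have := sqiD sf (sqiZ (-1) sg).
by rewrite (_ : (fun x => f x + _) = fun x => f x - g x)//;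
  apply/funext => x; rewrite mulN1r.
Qed.

Lemma sqi0 : sqi (fun=> 0).
Proof.
split; first exact: measurable_cst.
by rewrite (_ : (fun=> _) = fun=> 0) ?expr0n//; exact: igr0.
Qed.

Lemma sqi_sum (I : Type) (s : seq I) (P : pred I) (f : I -> T -> R) :
  (forall i, P i -> sqi (f i)) -> sqi (fun x => \sum_(i <- s | P i) f i x).
Proof.
move=> h; elim: s => [|i s IH].
  by rewrite (_ : (fun x => _) = fun=> 0); [exact: sqi0|apply/funext => x; rewrite big_nil].
rewrite (_ : (fun x => _) = fun x => (if P i then f i x else 0) + \sum_(i <- s | P i) f i x).
  apply: sqiD => //; case Pi: (P i); first exact: h.
  exact: sqi0.
by apply/funext => x; rewrite big_cons; case: ifP => //; rewrite add0r.
Qed.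

Lemma sqi_indic A : measurable A -> (mu A < +oo)%E -> sqi \1_A.
Proof.
move=> mA Afin; split; first exact: measurable_indic.
rewrite (_ : (fun x => _) = \1_A); first exact: igr_indic.
by apply/funext => x; rewrite indicE; case: (x \in A); rewrite ?expr1n ?expr0n.
Qed.

Lemma quadratic_disc (a b c : R) : 0 <= a -> 0 <= c ->
  (forall t, 0 <= a - 2 * t * b + t ^+ 2 * c) -> b ^+ 2 <= a * c.
Proof.
move=> a0 c0 h; have [c00|cn0] := eqVneq c 0.
  have [->|bn0] := eqVneq b 0; first by rewrite expr0n/= mulr_ge0.
  (* With c = 0 the polynomial is affine, and it takes the value -1 at this point. *)
  have := h ((a + 1) / (2 * b)); rewrite c00 mulr0 addr0.
  have -> : a - 2 * ((a + 1) / (2 * b)) * b = -1 by field.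
  by rewrite ler0N1.
have cp : 0 < c by rewrite lt0r cn0.
have := h (b / c).
have -> : a - 2 * (b / c) * b + (b / c) ^+ 2 * c = (a * c - b ^+ 2) / c by field.
by rewrite pmulr_lge0 ?invr_gt0// subr_ge0.
Qed.

Lemma sqnB f g t : sqi f -> sqi g ->
  sqn (fun x => f x - t * g x) = sqn f - 2 * t * Int mu (fun x => f x * g x) + t ^+ 2 * sqn g.
Proof.
move=> sf sg; have fg := sqi_mul sf sg.
rewrite /sqn (_ : (fun x => (f x - t * g x) ^+ 2) =
  fun x => f x ^+ 2 - 2 * t * (f x * g x) + t ^+ 2 * g x ^+ 2).
  case: sf sg => [mf hf] [mg hg].
  rewrite IntD ?IntB ?IntZ//; [exact: igrZ| |exact: igrZ].
  by apply: igrB => //; exact: igrZ.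
by apply/funext => x; ring.
Qed.

Lemma cauchy_schwarz f g : sqi f -> sqi g ->
  Int mu (fun x => f x * g x) ^+ 2 <= sqn f * sqn g.
Proof.
move=> sf sg; apply: quadratic_disc; rewrite ?sqn_ge0// => t.
by rewrite -sqnB// sqn_ge0.
Qed.

End SquareIntegrable.

(** * Sums over generations and step functions *)

Section StepFunctions.
Context {R : realType} (n : nat).
Notation cubei := (cubei n).
Notation cube := (@cube R n).
Notation cmu := (@cmu R n).
Local Notation mu := (lebesgue_rV n : {measure set 'rV[R]_n -> \bar R}).
Implicit Types (J P K : cubei) (x : 'rV[R]_n) (phi psi c : cubei -> R).

Fixpoint gsum phi d J : R :=
  if d is e.+1 then \sum_i gsum phi e (child J i) else phi J.

Lemma eq_gsum phi psi d J : (forall K, below K J -> phi K = psi K) ->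
  gsum phi d J = gsum psi d J.
Proof.
elim: d J => [|d IH] J h /=; first by apply: h; exact: below_refl.
apply: eq_bigr => i _; apply: IH => K KJ; apply: h.
by apply: below_trans KJ _; apply: below_child; exact: below_refl.
Qed.

Lemma le_gsum phi psi d J : (forall K, below K J -> phi K <= psi K) ->
  gsum phi d J <= gsum psi d J.
Proof.
elim: d J => [|d IH] J h /=; first by apply: h; exact: below_refl.
apply: ler_sum => i _; apply: IH => K KJ; apply: h.
by apply: below_trans KJ _; apply: below_child; exact: below_refl.
Qed.

Lemma gsumD phi psi d J : gsum (fun K => phi K + psi K) d J = gsum phi d J + gsum psi d J.
Proof.
elim: d J => [|d IH] J //=; rewrite -big_split/=.
by apply: eq_bigr => i _; exact: IH.
Qed.

Lemma gsumZ a phi d J : gsum (fun K => a * phi K) d J = a * gsum phi d J.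
Proof.
elim: d J => [|d IH] J //=; rewrite mulr_sumr.
by apply: eq_bigr => i _; exact: IH.
Qed.

Lemma gsum_additive phi d J :
  (forall K, below K J -> phi K = \sum_i phi (child K i)) -> gsum phi d J = phi J.
Proof.
elim: d J => [|d IH] J h //=; rewrite [RHS]h; last exact: below_refl.
apply: eq_bigr => i _; apply: IH => K KJ; apply: h.
by apply: below_trans KJ _; apply: below_child; exact: below_refl.
Qed.

Lemma lebesgue_cube_lty J : (mu (cube J) < +oo)%E.
Proof. by have := @lebesgue_cube R n J => /= ->; rewrite ltry. Qed.

Lemma Int_cube J : Int mu \1_(cube J) = cmu J.
Proof.
rewrite Int_indic; last exact: measurable_cube.
by have := @lebesgue_cube R n J => /= ->.
Qed.

Lemma igr_cube J : igr mu \1_(cube J).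
Proof. by apply: igr_indic; [exact: measurable_cube|exact: lebesgue_cube_lty]. Qed.

Lemma sqi_cube J : sqi mu \1_(cube J).
Proof. by apply: sqi_indic; [exact: measurable_cube|exact: lebesgue_cube_lty]. Qed.

Definition step c d J x : R := gsum (fun K => c K * \1_(cube K) x) d J.

Lemma stepS c d J x : step c d.+1 J x = \sum_i step c d (child J i) x.
Proof. by []. Qed.

Lemma sqi_step c d J : sqi mu (step c d J).
Proof.
elim: d J => [|d IH] J; first by apply: sqiZ; exact: sqi_cube.
by apply: sqi_sum => i _; exact: IH.
Qed.

Lemma igr_step c d J : igr mu (step c d J).
Proof.
elim: d J => [|d IH] J; first by apply: igrZ; exact: igr_cube.
by apply: igr_sum => i _; exact: IH.
Qed.

Lemma step_mul c d J (g : 'rV[R]_n -> R) :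
  (forall K, below K J -> igr mu (fun x => \1_(cube K) x * g x)) ->
  igr mu (fun x => step c d J x * g x) /\
  Int mu (fun x => step c d J x * g x) =
  gsum (fun K => c K * Int mu (fun x => \1_(cube K) x * g x)) d J.
Proof.
elim: d J => [|d IH] J h.
  rewrite (_ : (fun x => _) = fun x => c J * (\1_(cube J) x * g x)).
    split; first by apply: igrZ; apply: h; exact: below_refl.
    by rewrite IntZ//; apply: h; exact: below_refl.
  by apply/funext => x; rewrite /step/= mulrA.
have hi i : forall K, below K (child J i) -> igr mu (fun x => \1_(cube K) x * g x).
  move=> K KJ; apply: h; apply: below_trans KJ _; apply: below_child.
  exact: below_refl.
rewrite (_ : (fun x => _) = fun x => \sum_i step c d (child J i) x * g x).
  split; first by apply: igr_sum => i _; have [] := IH _ (hi i).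
  rewrite Int_sum => [|i _]; last by have [] := IH _ (hi i).
  by apply: eq_bigr => i _; have [_ ->] := IH _ (hi i).
by apply/funext => x; rewrite stepS mulr_suml.
Qed.

Lemma indic_step_out A c d J x : A `&` cube J = set0 -> \1_A x * step c d J x = 0.
Proof.
elim: d J => [|d IH] J AJ.
  by rewrite /step/= mulrCA -[X in _ * (_ * X)]mulr1 indicMM AJ indic0 mul0r mulr0.
rewrite stepS mulr_sumr big1// => i _; apply: IH.
by rewrite -subset0 -AJ => y [? /cube_child_sub].
Qed.

Lemma child_disjoint J i j : i != j -> cube (child J i) `&` cube (child J j) = set0.
Proof.
move=> ij; rewrite -subset0 => x [xi xj]; have xJ := cube_child_sub xi.
move/eqP: ij; apply; have := xi => /(cube_childP _ xJ) ->.
by apply/esym/(cube_childP _ xJ).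
Qed.

Lemma indic_step_self c d J x : \1_(cube J) x * step c d J x = step c d J x.
Proof.
elim: d J => [|d IH] J.
  by rewrite /step/= mulrCA -[X in _ * (_ * X)]mulr1 indicMM setIid mulr1.
rewrite stepS mulr_sumr; apply: eq_bigr => i _.
by rewrite -[in LHS]IH indicMM (setIidr (@cube_child_sub _ _ _ _)) IH.
Qed.

Lemma indic_step_child c d J i x :
  \1_(cube (child J i)) x * step c d.+1 J x = step c d (child J i) x.
Proof.
rewrite stepS mulr_sumr (bigD1 i)//= big1 ?addr0; last first.
  by move=> j ji; apply: indic_step_out; rewrite child_disjoint// eq_sym.
exact: indic_step_self.
Qed.

Lemma below_level J P : below J P -> J.1 <= P.1.
Proof. by move=> h; elim: h => // {J P} J P e _ IH; rewrite /child/=; lia. Qed.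

Lemma indic_step_below c d j J P x : below J P -> P.1 = J.1 + j%:Z -> (j <= d)%N ->
  \1_(cube J) x * step c d P x = step c (d - j) J x.
Proof.
move=> h; elim: h j => {J P} [P|J P e JP IH] j.
  move=> e; have -> : j = 0%N by lia.
  by move=> _; rewrite subn0 indic_step_self.
have := below_level JP; case: j => [|j]; rewrite /child/=; first by lia.
move=> _ lv jd; have := IH j; have -> : (d - j = (d - j.+1).+1)%N by lia.
move=> H; rewrite -indic_step_child -H; [|lia|lia].
by rewrite indicMM (setIidl (@cube_child_sub _ _ _ _)).
Qed.

(** The cubes of side 2^N with a vertex at the origin, one for each orthant. One increasing chain of
    dyadic cubes would never leave its orthant. *)
Definition top (N : nat) (e : corner n) : cubei := (N%:Z, \row_i (- (e i)%:Z)).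

Lemma topS N e : child (top N.+1 e) e = top N e.
Proof.
rewrite /child /top /=; congr pair; first by lia.
by apply/rowP => i; rewrite !mxE; case: (e i) => /=; lia.
Qed.

Lemma below_top N M e : (N <= M)%N -> below (top N e) (top M e).
Proof.
elim: M => [|M IH]; first by rewrite leqn0 => /eqP ->; exact: below_refl.
rewrite leq_eqVlt => /orP[/eqP ->|]; first exact: below_refl.
rewrite ltnS => /IH h; apply: below_trans h _.
by rewrite -topS; apply: below_child; exact: below_refl.
Qed.

Lemma top_disjoint N e e' : e != e' -> cube (top N e) `&` cube (top N e') = set0.
Proof.
move=> ee'; apply: cube_pair_disjoint => /rowP h; move/eqP: ee'; apply.
apply/ffunP => i; have := h i; rewrite !mxE.
by case: (e i); case: (e' i).
Qed.

(** Passing to the parent halves every coordinate of the index with rounding down, which drives it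
    to 0 or -1. A cube whose index has only such coordinates lies below a top cube of its
    orthant. *)
Lemma below_some_top J : exists N e, below J (top N e).
Proof.
pose m0 (J : cubei) := \sum_i `|J.2 ord0 i|%N.
have [j] : exists j : nat, (m0 J < j)%N by exists (m0 J).+1.
elim: j J => // j IH J hJ.
have [h0|/forallPn[i0 hi0]] := boolP [forall i, (J.2 ord0 i == 0) || (J.2 ord0 i == -1)].
  pose e : corner n := [ffun i => J.2 ord0 i == -1].
  have JE : J = (J.1, \row_i (- (e i)%:Z)).
    case: J h0 @e {hJ} => k m /= /forallP h0; congr pair; apply/rowP => i.
    rewrite !mxE ffunE -[LHS]/(m ord0 i); have := h0 i.
    by case: eqP => [->|_] //=; case: eqP => [->|].
  have [k0|k0] := lerP 0 J.1.
    exists `|J.1|%N, e; rewrite [X in below X _]JE /top gez0_abs//; exact: below_refl.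
  have up (k : nat) : forall l : int, below (l - k%:Z, \row_i (- (e i)%:Z)) (l, \row_i (- (e i)%:Z)).
    elim: k => [|k IHk] l; first by rewrite subr0; exact: below_refl.
    apply: below_trans (IHk l).
    have -> : (l - k.+1%:Z, \row_i (- (e i)%:Z)) =
       child (l - k%:Z, \row_i (- (e i)%:Z)) e :> cubei.
      rewrite /child/=; congr pair; first by lia.
      by apply/rowP => i; rewrite !mxE; case: (e i) => /=; lia.
    by apply: below_child; exact: below_refl.
  exists 0%N, e; rewrite [X in below X _]JE /top.
  by have := up `|J.1|%N 0; rewrite (_ : 0 - `|J.1|%N%:Z = J.1); [|lia].
have hi i : (`|(J.2 ord0 i %/ 2)%Z| <= `|J.2 ord0 i|)%N by lia.
have lt0 : (`|(J.2 ord0 i0 %/ 2)%Z| < `|J.2 ord0 i0|)%N.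
  by move: hi0; rewrite negb_or => /andP[/eqP h1 /eqP h2]; lia.
have [|N [e h]] := IH (parent J).
  rewrite -ltnS; apply: leq_trans hJ; rewrite ltnS /m0.
  rewrite (bigD1 i0)//= [leqRHS](bigD1 i0)//= -addSn leq_add//.
    by rewrite mxE.
  by apply: leq_sum => i _; rewrite mxE.
by exists N, e; exact: below_parent.
Qed.

End StepFunctions.

(** * Sequences that are Cauchy in L1 at a geometric rate *)

Section FastCauchy.
Context {d : measure_display} {T : measurableType d} {R : realType}.
Variables (mu : {measure set T -> \bar R}) (g : nat -> T -> R).
Hypothesis mg : forall k, measurable_fun setT (g k).

(** An upper limit, so that measurability is unconditional; it is the limit wherever there is one
    ([fast_limE]). *)
Definition fast_lim x : R := fine (limn_esup (fun k => (g k x)%:E)).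

Lemma measurable_fast_lim : measurable_fun setT fast_lim.
Proof.
apply: measurableT_comp; first exact: fine_measurable.
by apply: measurable_fun_limn_esup => k; exact/measurable_EFinP.
Qed.

Lemma fast_limE x : cvgn (g ^~ x) -> g ^~ x @ \oo --> fast_lim x.
Proof.
move=> cg; suff -> : fast_lim x = limn (g ^~ x) by [].
rewrite /fast_lim; have h : (fun k => (g k x)%:E) @ \oo --> (limn (g ^~ x))%:E.
  by apply: cvg_EFin => //; apply: nearW.
by have [_ ->] := cvg_limn_einf_sup h.
Qed.

(** The sum of the absolute increments is integrable, hence finite almost everywhere. This gives
    convergence, and together with the first term it dominates the sequence. *)
Lemma fast_cauchy (A : set T) (c : R) : measurable A ->
  (forall k, igr mu (fun x => \1_A x * g k x)) ->
  (forall k, Int mu (fun x => \1_A x * `|g k.+1 x - g k x|) <= c / (2 ^ k.+1)%:R) ->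
  {ae mu, forall x, A x -> g ^~ x @ \oo --> fast_lim x} /\
  igr mu (fun x => \1_A x * fast_lim x) /\
  (fun k => Int mu (fun x => \1_A x * g k x)) @ \oo --> Int mu (fun x => \1_A x * fast_lim x).
Proof.
move=> mA ig hg.
pose D k x := `|g k.+1 x - g k x|.
have mD k : measurable_fun setT (D k).
  by apply: measurableT_comp => //; exact: measurable_funB.
have iD k : igr mu (fun x => \1_A x * D k x).
  apply: (igr_le _ _ (igrD (igr_norm (ig k.+1)) (igr_norm (ig k)))).
    exact: meas_indicM.
  move=> x; have /andP[a0 a1] := @indic01 d T R A x.
  rewrite !normrM /D normr_id (ger0_norm a0) -mulrDr ler_wpM2l//.
  exact: ler_normB.
pose S x := (\sum_(0 <= k <oo) (\1_A x * D k x)%:E)%E.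
have D0 k x : 0 <= \1_A x * D k x.
  by have /andP[a0 _] := @indic01 d T R A x; apply: mulr_ge0 => //; exact: normr_ge0.
have mS : measurable_fun setT S.
  apply: ge0_emeasurable_sum => [k x _ _|k _]; first by rewrite lee_fin.
  by apply/measurable_EFinP; exact: meas_indicM.
have S0 x : (0 <= S x)%E by apply: nneseries_ge0 => k _ _; rewrite lee_fin.
have c0 : 0 <= c.
  have := le_trans (Int_ge0 mu (D0 0%N)) (hg 0%N).
  by rewrite pmulr_lge0// invr_gt0 ltr0n.
have iS : mu.-integrable setT S.
  apply/integrableP; split=> //.
  rewrite (eq_integral S) => [|x _]; last by rewrite gee0_abs.
  rewrite integral_nneseries//; last 2 first.
  - by move=> k; apply/measurable_EFinP; exact: meas_indicM.
  - by move=> k x _; rewrite lee_fin.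
  apply: (@le_lt_trans _ _ (\sum_(0 <= k <oo) (0 + (c / (2 ^ k.+1)%:R)%:E))%E).
    apply: lee_nneseries => [k _ _|k _].
      by apply: integral_ge0 => x _; rewrite lee_fin.
    by rewrite add0e -EFin_Int// lee_fin hg.
  apply: (le_lt_trans (epsilon_trick _ _ c0)) => //.
  by rewrite eseries0// add0e ltry.
have cvS x : A x -> S x \is a fin_num -> cvgn (g ^~ x).
  move=> xA Sx.
  have h : cvgn (series (telescope (g ^~ x))).
    apply: normed_cvg; apply: nnseries_is_cvg => [k|]; first exact: normr_ge0.
    move: Sx; rewrite ge0_fin_numE//; congr (_ < _)%E; apply: eq_eseriesr => k _.
    by rewrite indicE mem_set// mul1r.
  rewrite (_ : g ^~ x = fun k => g 0%N x + series (telescope (g ^~ x)) k).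
    by apply: is_cvgD => //; exact: is_cvg_cst.
  by apply/funext => k; exact: eq_sum_telescope.
have aeS := integrable_ae measurableT iS.
have cv : {ae mu, forall x, A x -> g ^~ x @ \oo --> fast_lim x}.
  by apply: filterS aeS => x h xA; apply: fast_limE; apply: cvS => //; exact: h.
split => //.
pose G x := (`|\1_A x * g 0%N x|%:E + S x)%E.
have iG : mu.-integrable setT G.
  by apply: integrableD => //; exact: igr_norm (ig 0%N).
have gG k x : (`|(\1_A x * g k x)%:E| <= G x)%E.
  rewrite /G; apply: (@le_trans _ _
    (`|\1_A x * g 0%N x| + \sum_(0 <= i < k) \1_A x * D i x)%:E).
    rewrite /= lee_fin; elim: k => [|k IH]; first by rewrite big_nil addr0.
    rewrite big_nat_recr//= addrA; apply: le_trans (lerD IH (lexx _)).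
    have /andP[a0 a1] := @indic01 d T R A x.
    rewrite !normrM (ger0_norm a0) -mulrDr ler_wpM2l//.
    by rewrite -[X in `|X| <= _](subrK (g k x)) addrC ler_normD.
  rewrite EFinD leeD2l//; rewrite -sumEFin.
  by apply: nneseries_lim_ge => i _ _; rewrite lee_fin.
have mgk k : measurable_fun setT (fun x => (\1_A x * g k x)%:E).
  by apply/measurable_EFinP; exact: meas_indicM.
have mlim : measurable_fun setT (fun x => (\1_A x * fast_lim x)%:E).
  by apply/measurable_EFinP; apply: meas_indicM => //; exact: measurable_fast_lim.
have [| | | | |il _ cvI] := @dominated_convergence _ _ _ mu setT measurableT
  (fun k x => (\1_A x * g k x)%:E) (fun x => (\1_A x * fast_lim x)%:E) G.
- exact: mgk.
- exact: mlim.
- apply: filterS cv => x h _; apply: cvg_EFin; first exact: nearW.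
  have [xA|xA] := pselect (A x).
    by apply: cvgM; [exact: cvg_cst|exact: h].
  rewrite indicE memNset//= mul0r; rewrite (_ : _ \o _ = fun=> 0); first exact: cvg_cst.
  by apply/funext => k /=; rewrite mul0r.
- exact: iG.
- by apply: aeW => x k _; exact: gG.
split; first exact: il.
suff h : EFin \o (fun k => Int mu (fun x => \1_A x * g k x)) @ \oo -->
    (Int mu (fun x => \1_A x * fast_lim x))%:E by exact: (fine_cvg h).
rewrite EFin_Int//.
move: cvI; rewrite (_ : [sequence _]_n = EFin \o (fun k => Int mu (fun x => \1_A x * g k x)))//.
by apply/funext => k /=; rewrite EFin_Int.
Qed.

End FastCauchy.

(** * Square-integrable densities of dyadic set functions *)

Section DyadicRiesz.
Context {R : realType} (n : nat).
Notation cubei := (cubei n).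
Notation cube := (@cube R n).
Notation cmu := (@cmu R n).
Local Notation mu := (lebesgue_rV n : {measure set 'rV[R]_n -> \bar R}).
Implicit Types (J P K : cubei) (x : 'rV[R]_n).

Lemma ae_cubes (Q : 'rV[R]_n -> Prop) :
  (forall J, {ae mu, forall x, cube J x -> Q x}) -> {ae mu, forall x, Q x}.
Proof.
move=> H; pose N k : cubei := odflt (0, 0) (unpickle k).
have H0 : {ae mu, forall x, forall k, cube (N k) x -> Q x}.
  by apply/ae_foralln => k; exact: H.
apply: filterS H0 => x /(_ (pickle (cube_at 0 x))); apply.
by rewrite /N pickleK; exact: cube_atP.
Qed.

Lemma eq_gsum_level phi psi d J :
  (forall K, below K J -> J.1 = K.1 + d%:Z -> phi K = psi K) ->
  gsum phi d J = gsum psi d J :> R.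
Proof.
elim: d J => [|d IH] J h /=; first by apply: h; [exact: below_refl|rewrite addr0].
apply: eq_bigr => i _; apply: IH => K KJ lv; apply: h.
  by apply: below_trans KJ _; apply: below_child; exact: below_refl.
by move: lv; rewrite /child/=; lia.
Qed.

Variable nu : cubei -> R.
Hypothesis nu_add : forall J, nu J = \sum_i nu (child J i).

Let c K := nu K / cmu K.

(** The squared L2 norm of [approx N], see [sqn_approx]. The window has cubes of side 2^N and the
    resolution is 2^-N, which are 2 N generations apart. *)
Definition energy N : R := \sum_e gsum (fun K => nu K ^+ 2 / cmu K) (2 * N) (top N e).
Definition approx N x : R := \sum_e step c (2 * N) (top N e) x.

Let ccmu K : c K * cmu K = nu K.
Proof. by rewrite divfK// gt_eqF// cmu_gt0. Qed.

Let Int_step d J : Int mu (step c d J) = nu J.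
Proof.
have H K : below K J -> igr mu (fun x => \1_(cube K) x * 1).
  move=> _; rewrite (_ : (fun x => _) = \1_(cube K)); first exact: igr_cube.
  by apply/funext => x; rewrite mulr1.
have [_] := step_mul c d H.
rewrite (_ : (fun x => _ * _) = step c d J); last by apply/funext => x; rewrite mulr1.
move=> ->; rewrite -(@gsum_additive R n nu d J) => [|K _]; last exact: nu_add.
apply: eq_gsum => K _; rewrite (_ : (fun x => _) = \1_(cube K)) ?Int_cube//.
by apply/funext => x; rewrite mulr1.
Qed.

Lemma sqi_approx N : sqi mu (approx N).
Proof. by apply: sqi_sum => e _; exact: sqi_step. Qed.

Lemma indic_approx N J e : below J (top N e) -> - J.1 <= N%:Z ->
  (fun x => \1_(cube J) x * approx N x) = step c (absz (N%:Z + J.1)) J.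
Proof.
move=> bJ lv; apply/funext => x; rewrite /approx mulr_sumr (bigD1 e)//= big1 ?addr0.
  have lJ := below_level bJ; rewrite /= in lJ.
  rewrite (indic_step_below c (d := 2 * N) (j := absz (N%:Z - J.1)) _ bJ)//=; [|lia|lia].
  by congr (step _ _ _ _); lia.
move=> e' ee'; apply: indic_step_out; rewrite -subset0 => y [yJ ye'].
by rewrite -(top_disjoint N ee'); split => //; exact: below_sub bJ _ yJ.
Qed.

Lemma Int_approx N J e : below J (top N e) -> - J.1 <= N%:Z ->
  Int mu (fun x => \1_(cube J) x * approx N x) = nu J.
Proof. by move=> bJ lv; rewrite (indic_approx bJ lv) Int_step. Qed.

(** Martingale orthogonality: on the cubes where the coarser function is constant, the finer one has
    integral [nu]. *)
Lemma Int_approx2 N M : (N <= M)%N ->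
  Int mu (fun x => approx N x * approx M x) = energy N.
Proof.
move=> NM.
have h e : forall K, below K (top N e) -> igr mu (fun x => \1_(cube K) x * approx M x).
  by move=> K _; apply: sqi_mul; [exact: sqi_cube|exact: sqi_approx].
rewrite (_ : (fun x => _) = fun x => \sum_e step c (2 * N) (top N e) x * approx M x).
  rewrite Int_sum => [|e _]; last by have [] := step_mul c (2 * N) (h e).
  apply: eq_bigr => e _; have [_ ->] := step_mul c (2 * N) (h e).
  apply: eq_gsum_level => K KJ lv; rewrite (@Int_approx _ _ e).
  - by rewrite /c expr2 mulrAC.
  - by apply: below_trans KJ _; exact: below_top.
  - by move: lv; rewrite /top/=; lia.
by apply/funext => x; rewrite /approx mulr_suml.
Qed.

Lemma sqn_approx N : sqn mu (approx N) = energy N.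
Proof. by rewrite -(Int_approx2 (leqnn N)). Qed.

Lemma sqn_approxB N M : sqn mu (fun x => approx M x - approx N x) = `|energy M - energy N|.
Proof.
have H a b : (a <= b)%N -> sqn mu (fun x => approx b x - approx a x) = energy b - energy a.
  move=> ab; have := sqnB 1 (sqi_approx b) (sqi_approx a).
  rewrite (_ : (fun x => approx b x - 1 * approx a x) = (fun x => approx b x - approx a x));
    last by apply/funext => x; rewrite mul1r.
  rewrite (_ : (fun x => approx b x * approx a x) = (fun x => approx a x * approx b x));
    last by apply/funext => x; rewrite mulrC.
  rewrite Int_approx2// !sqn_approx => ->; ring.
have [NM|MN] := leqP N M; first by rewrite H// ger0_norm// -H// sqn_ge0.
rewrite distrC -[RHS]ger0_norm// normr_id -H ?(ltnW MN)// ger0_norm ?sqn_ge0//.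
rewrite /sqn; congr Int; apply/funext => x; ring.
Qed.

Lemma energy_mono : {homo energy : N M / (N <= M)%N >-> N <= M}.
Proof.
move=> N M NM; rewrite -subr_ge0.
have := cauchy_schwarz (sqi_approx N) (sqi_approx M).
rewrite Int_approx2// !sqn_approx subr_ge0.
have := sqn_ge0 mu (approx N); rewrite sqn_approx le_eqVlt => /orP[/eqP <- _|e0].
  by rewrite -sqn_approx sqn_ge0.
by rewrite expr2 ler_pM2l.
Qed.

Variable A0 : R.
Hypothesis energy_le : forall N, energy N <= A0.

(** The energies increase to their supremum, so a subsequence of the approximations is Cauchy in L2
    at a geometric rate; on each cube this gives [fast_cauchy]. Fatou's lemma bounds the norm of the
    limit, and the integrals over a fixed cube are eventually equal to [nu]. *)
Lemma dyadic_riesz : exists h : 'rV[R]_n -> R, sqi mu h /\ sqn mu h <= A0 /\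
  forall J, Int mu (fun x => \1_(cube J) x * h x) = nu J.
Proof.
pose s := sup (range energy).
have hs : has_sup (range energy).
  by split; [exists (energy 0), 0%N|exists A0 => _ [N _ <-]].
have ex k : exists N, (k <= N)%N /\ s - energy N <= (4 ^+ k)^-1.
  have p : 0 < (4 ^+ k : R)^-1 by rewrite invr_gt0 exprn_gt0.
  have [_ [N _ <-] h] := sup_adherent p hs; exists (maxn k N); split.
    exact: leq_maxl.
  by have := energy_mono (leq_maxr k N); rewrite -/s in h; lra.
have [N HN] := choice ex.
have les M : energy M <= s by apply: ub_le_sup; [case: hs|exists M].
pose g k := approx (N k).
have mg k : measurable_fun setT (g k) by have [] := sqi_approx (N k).
have diff k : sqn mu (fun x => g k.+1 x - g k x) <= (4 ^+ k)^-1.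
  rewrite sqn_approxB; have [_ h1] := HN k; have [_ h2] := HN k.+1.
  have h3 := les (N k); have h4 := les (N k.+1).
  have h5 : (4 ^+ k.+1 : R)^-1 <= (4 ^+ k)^-1.
    by rewrite lef_pV2 ?posrE ?exprn_gt0// ler_weXn2l// ler1n.
  by rewrite ler_norml; apply/andP; split; lra.
have igJ J k : igr mu (fun x => \1_(cube J) x * g k x).
  by apply: sqi_mul; [exact: sqi_cube|exact: sqi_approx].
have diffJ J k : Int mu (fun x => \1_(cube J) x * `|g k.+1 x - g k x|) <=
    (cmu J + 1) / (2 ^ k.+1)%:R.
  have sd : sqi mu (fun x => g k.+1 x - g k x) by apply: sqiB; exact: sqi_approx.
  have i2 : igr mu (fun x => (2 ^+ k) / 2 * (g k.+1 x - g k x) ^+ 2).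
    by apply: igrZ; case: sd.
  have i1 : igr mu (fun x => (2 ^+ k)^-1 / 2 * \1_(cube J) x) by apply: igrZ; exact: igr_cube.
  have p2 : 0 < (2 ^+ k : R) by rewrite exprn_gt0.
  (* Pointwise |d| <= 2^-k / 2 + 2^k d^2 / 2, balanced so that d^2 of integral 4^-k contributes as
     much as the constant. *)
  apply: (@le_trans _ _ (Int mu (fun x => (2 ^+ k)^-1 / 2 * \1_(cube J) x +
      (2 ^+ k) / 2 * (g k.+1 x - g k x) ^+ 2))).
    apply: le_Int; last first.
    - move=> x; rewrite indicE; case: (x \in _) => /=; last first.
        by rewrite mul0r mulr0 add0r mulr_ge0 ?sqr_ge0// divr_ge0// ltW.
      rewrite mul1r mulr1 -(real_normK (num_real (_ - _))).
      set a := `|_|; have a0 : 0 <= a by exact: normr_ge0.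
      have := sqr_ge0 (2 ^+ k * a - 1); rewrite sqrrB1 => h.
      rewrite -(ler_pM2l p2) mulrDr !mulrA divff ?gt_eqF// -!expr2; move: h.
      rewrite exprMn; move: (2 ^+ k) => t; lra.
    - exact: igrD.
    - apply: igr_indic_norm; have := igrB (igJ J k.+1) (igJ J k).
      by congr igr; apply/funext => x; rewrite mulrBr.
  rewrite IntD// !IntZ ?Int_cube//; [|by case: sd|exact: igr_cube].
  have := diff k; rewrite /sqn => h.
  have h2 : (2 ^+ k) / 2 * Int mu (fun x => (g k.+1 x - g k x) ^+ 2) <= (2 ^+ k)^-1 / 2.
    apply: (@le_trans _ _ (2 ^+ k / 2 * (4 ^+ k)^-1)).
      by rewrite ler_wpM2l// divr_ge0// ltW.
    rewrite (_ : 4 ^+ k = 2 ^+ k * 2 ^+ k :> R); last first.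
      by rewrite -exprMn -natrM.
    by rewrite le_eqVlt; apply/orP; left; apply/eqP; field; rewrite gt_eqF.
  rewrite natrX exprS invfM; move: h2; lra.
have FC J := fast_cauchy mg (@measurable_cube R n J) (igJ J) (diffJ J).
pose h := fast_lim g.
have mh : measurable_fun setT h by exact: measurable_fast_lim.
have cv : {ae mu, forall x, g ^~ x @ \oo --> h x}.
  by apply: ae_cubes => J; have [] := FC J.
have fat : (\int[mu]_x (h x ^+ 2)%:E <= A0%:E)%E.
  have mg2 k : measurable_fun setT (fun x => (g k x ^+ 2)%:E).
    by apply/measurable_EFinP; exact: measurable_funX.
  have mlim : measurable_fun setT (fun x => limn_einf (fun k => (g k x ^+ 2)%:E)).
    rewrite /limn_einf; apply: measurableT_comp; first exact: oppe_measurable.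
    apply: (@measurable_fun_limn_esup _ _ _ _ (fun k x => (- (g k x ^+ 2)%:E)%E)) => k.
    by apply: measurableT_comp; [exact: oppe_measurable|exact: mg2].
  rewrite (ae_eq_integral (fun x => limn_einf (fun k => (g k x ^+ 2)%:E)))//; last 2 first.
  - by apply/measurable_EFinP; exact: measurable_funX.
  - apply: filterS cv => x gx _; apply/esym.
    have h2 : (fun k => (g k x ^+ 2)%:E) @ \oo --> (h x ^+ 2)%:E.
      apply: cvg_EFin; first exact: nearW.
      by rewrite expr2; apply: cvg_trans (cvgM gx gx); apply: near_eq_cvg; apply: nearW.
    by have [-> _] := cvg_limn_einf_sup h2.
  apply: (le_trans (fatou _ measurableT mg2 _)).
    by move=> k x _; rewrite lee_fin sqr_ge0.
  rewrite limn_einf_lim; apply: lime_le; first exact: is_cvg_einfs.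
  apply: nearW => k; apply: (@le_trans _ _ (\int[mu]_x (g k x ^+ 2)%:E)%E).
    by apply: ereal_inf_lbound; exists k => /=.
  have [_ i2] := sqi_approx (N k).
  by rewrite -EFin_Int// lee_fin -[X in X <= _]/(sqn mu (approx (N k))) sqn_approx.
have ih2 : igr mu (fun x => h x ^+ 2).
  apply/integrableP; split.
    by apply/measurable_EFinP; exact: measurable_funX.
  rewrite (eq_integral (fun x => (h x ^+ 2)%:E)) => [|x _]; last first.
    by rewrite /= ger0_norm ?sqr_ge0.
  by apply: le_lt_trans fat _; rewrite ltry.
exists h; split; first by [].
split; first by rewrite -lee_fin EFin_Int.
move=> J; have [N0 [e bJ]] := below_some_top J.
have [_ [_ cvJ]] := FC J.
have : (fun k => Int mu (fun x => \1_(cube J) x * g k x)) @ \oo --> nu J.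
  apply: cvg_near_cst; near=> k; have [kN _] := HN k.
  apply: (@Int_approx _ _ e).
    by apply: below_trans bJ _; apply: below_top; apply: leq_trans kN; near: k; exact: nbhs_infty_ge.
  have : (absz J.1 <= N k)%N by apply: leq_trans kN; near: k; exact: nbhs_infty_ge.
  lia.
by move=> /(cvg_unique (@Rhausdorff R) cvJ).
Unshelve. all: by end_near.
Qed.

End DyadicRiesz.

Section Tail.
Context {d : measure_display} {T : measurableType d} {R : realType}.
Variable mu : {measure set T -> \bar R}.

Definition above (h : T -> R) (M : R) : set T := [set x | M < `|h x|].

Lemma measurable_above h M : measurable_fun setT h -> measurable (above h M).
Proof.
move=> mh; have mn : measurable_fun setT (fun x => `|h x|) by exact: measurableT_comp.
have := mn measurableT _ (measurable_itv `]M, +oo[).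
by rewrite setTI; congr measurable; apply/seteqP; split => x /=; rewrite in_itv/= andbT.
Qed.

Lemma tail_cvg (h g : T -> R) (e : R) : measurable_fun setT h -> igr mu g -> 0 < e ->
  exists M0 : nat, forall M : nat, (M0 <= M)%N ->
  Int mu (fun x => \1_(above h M%:R) x * `|g x|) <= e.
Proof.
move=> mh ig e0; have mg := igr_meas ig; have ign := igr_norm ig.
have ik M : igr mu (fun x => \1_(above h M%:R) x * `|g x|).
  by apply: igr_indicM => //; exact: measurable_above.
have [| | | | |_ _] := @dominated_convergence _ _ _ mu setT measurableT
  (fun M x => (\1_(above h M%:R) x * `|g x|)%:E) (fun x => 0%:E) (fun x => `|g x|%:E).
- by move=> M; apply/measurable_EFinP; exact: igr_meas.
- exact: measurable_cst.
- apply: aeW => x _; apply: cvg_near_cst; near=> M.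
  rewrite indicE memNset ?mul0r// /above/= => /ltW; apply/negP; rewrite -ltNge.
  have : (Num.bound `|h x| <= M)%N by near: M; exact: nbhs_infty_ge.
  rewrite -(ler_nat R); by apply: lt_le_trans; exact: archi_boundP.
- exact: ign.
- apply: aeW => x M _ /=; rewrite lee_fin.
  by have := norm_indicM (above h M%:R) (fun x => `|g x|) x; rewrite normr_id.
rewrite integral0 => /fine_cvgP[_] /cvgrPdist_le /(_ e e0) [M0 _ HM0].
exists M0 => M MM; have := HM0 M MM; rewrite /= sub0r normrN.
by move=> /(le_trans (ler_norm _)).
Unshelve. all: by end_near.
Qed.

End Tail.

(** * Oscillation on fine generations *)

Section Oscillation.
Context {R : realType} (n : nat).
Notation cubei := (cubei n).
Notation cube := (@cube R n).
Notation cmu := (@cmu R n).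
Local Notation mu := (lebesgue_rV n : {measure set 'rV[R]_n -> \bar R}).
Implicit Types (J P K Q : cubei) (x : 'rV[R]_n) (f : 'rV[R]_n -> R).

Definition avg f K : R := Int mu (fun x => \1_(cube K) x * f x) / cmu K.
Definition osc f K : R := Int mu (fun x => \1_(cube K) x * `|f x - avg f K|).

Lemma igr_indic_cst K (a : R) : igr mu (fun x => \1_(cube K) x * a).
Proof.
rewrite (_ : (fun x => _) = fun x => a * \1_(cube K) x).
  by apply: igrZ; exact: igr_cube.
by apply/funext => x; rewrite mulrC.
Qed.

Lemma Int_indic_cst K (a : R) : Int mu (fun x => \1_(cube K) x * a) = a * cmu K.
Proof.
rewrite -Int_cube -IntZ; last exact: igr_cube.
by congr Int; apply/funext => x; rewrite mulrC.
Qed.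

Lemma Int_children f J : (forall i, igr mu (fun x => \1_(cube (child J i)) x * f x)) ->
  Int mu (fun x => \1_(cube J) x * f x) = \sum_i Int mu (fun x => \1_(cube (child J i)) x * f x).
Proof.
move=> h; rewrite -Int_sum//; congr Int; apply/funext => x.
by rewrite indic_cube_sum mulr_suml.
Qed.

Lemma igr_sub f J K : below K J -> igr mu (fun x => \1_(cube J) x * f x) ->
  igr mu (fun x => \1_(cube K) x * f x).
Proof.
move=> KJ h; have := igr_indicM (@measurable_cube R n K) h.
by congr igr; apply/funext => x; rewrite indicMM (setIidl (below_sub KJ)).
Qed.

Lemma Int_gsum f d J : igr mu (fun x => \1_(cube J) x * f x) ->
  gsum (fun K => Int mu (fun x => \1_(cube K) x * f x)) d J =
  Int mu (fun x => \1_(cube J) x * f x).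
Proof.
move=> h; apply: (gsum_additive (phi := fun K => Int mu (fun x => \1_(cube K) x * f x))).
move=> K KJ; apply: Int_children => i; apply: igr_sub h.
exact: below_child.
Qed.

Lemma igr_osc f K a : igr mu (fun x => \1_(cube K) x * f x) ->
  igr mu (fun x => \1_(cube K) x * `|f x - a|).
Proof.
move=> h; apply: igr_indic_norm.
by have := igrB h (igr_indic_cst K a); congr igr; apply/funext => x; rewrite mulrBr.
Qed.

(** The dyadic averages converge to f in L2. By [dyadic_riesz] the integrals of f over cubes have a
    density of squared norm at most the supremum of the energies; it equals f almost everywhere, so
    the squared norm of f - h_N, which is that of f minus the energy, tends to 0. *)
Lemma osc_cvg_sqi f Q (e : R) : sqi mu f -> 0 < e ->
  exists d, gsum (osc f) d Q <= e.
Proof.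
move=> sf e0.
have ifJ J : igr mu (fun x => \1_(cube J) x * f x).
  by apply: sqi_mul => //; exact: sqi_cube.
pose nu J := Int mu (fun x => \1_(cube J) x * f x).
have nu_add J : nu J = \sum_i nu (child J i) by apply: Int_children.
pose h N := approx nu N.
have hf N : Int mu (fun x => f x * h N x) = energy (R := R) nu N.
  rewrite (_ : (fun x => _) = fun x => \sum_e step (fun K => nu K / cmu K) (2 * N) (top N e) x * f x).
    rewrite Int_sum => [|e' _]; last first.
      by have [] := step_mul (fun K => nu K / cmu K) (2 * N) (fun K (_ : below K (top N e')) => ifJ K).
    apply: eq_bigr => e' _.
    have [_ ->] := step_mul (fun K => nu K / cmu K) (2 * N) (fun K (_ : below K (top N e')) => ifJ K).
    by apply: eq_gsum => K _; rewrite -/(nu K) expr2 mulrAC.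
  by apply/funext => x; rewrite /h /approx mulrC mulr_suml.
have en N : energy (R := R) nu N <= sqn mu f.
  have := cauchy_schwarz sf (sqi_approx nu N); rewrite -/(h N) hf sqn_approx//.
  have := sqn_ge0 mu (h N); rewrite sqn_approx// le_eqVlt => /orP[/eqP <- _|p].
    exact: sqn_ge0.
  by rewrite expr2 ler_pM2r.
pose s := sup (range (energy (R := R) nu)).
have hs : has_sup (range (energy (R := R) nu)).
  by split; [exists (energy nu 0), 0%N|exists (sqn mu f) => _ [N _ <-]].
have les M : energy nu M <= s by apply: ub_le_sup; [case: hs|exists M].
have [g [sg [gs gnu]]] := dyadic_riesz nu_add les.
have fs : sqn mu f <= s.
  apply: le_trans gs; rewrite le_eqVlt; apply/orP; left; apply/eqP.
  have fg : ae_eq mu setT (fun x => f x - g x) (fun=> 0).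
    have igJ J : igr mu (fun x => \1_(cube J) x * g x).
      by apply: sqi_mul => //; exact: sqi_cube.
    have E J : (fun x => \1_(cube J) x * (f x - g x)) =
        fun x => \1_(cube J) x * f x - \1_(cube J) x * g x.
      by apply/funext => x; rewrite mulrBr.
    apply: dyadic_ae0.
    - by apply: measurable_funB; [case: sf|case: sg].
    - by move=> J; rewrite E; exact: igrB.
    - by move=> J; rewrite E IntB// gnu subrr.
  rewrite /sqn /Int /Rintegral; congr fine; apply: ae_eq_integral => //.
  - by apply/measurable_EFinP; apply: measurable_funX; case: sf.
  - by apply/measurable_EFinP; apply: measurable_funX; case: sg.
  - apply: filterS fg => x fg _; have /eqP := fg Logic.I.
    by rewrite subr_eq0 => /eqP ->.
pose dl := e / (cmu Q + 1).
have Q1 : 0 < cmu Q + 1 by rewrite ltr_wpDl// ltW// cmu_gt0.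
have dl0 : 0 < dl by rewrite divr_gt0.
have [N0 [e' bQ]] := @below_some_top n Q.
have [N [hN NQ bN]] : exists N, [/\ s - dl ^+ 2 <= energy nu N, - Q.1 <= N%:Z & below Q (top N e')].
  have [_ [N _ <-] hN] := sup_adherent (exprn_gt0 2 dl0) hs.
  exists (maxn N (maxn (absz Q.1) N0)); split.
  - by apply: le_trans (ltW hN) _; apply: energy_mono => //; exact: leq_maxl.
  - have : (absz Q.1 <= maxn N (maxn (absz Q.1) N0))%N by rewrite !leq_max leqnn orbT.
    by move: (maxn _ _) => N1; lia.
  - by apply: below_trans bQ _; apply: below_top; rewrite !leq_max leqnn !orbT.
exists (absz (N%:Z + Q.1)).
have oscE : gsum (osc f) (absz (N%:Z + Q.1)) Q = Int mu (fun x => \1_(cube Q) x * `|f x - h N x|).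
  rewrite -[RHS](@Int_gsum _ (absz (N%:Z + Q.1))); last first.
    apply: igr_indic_norm; apply: sqi_mul; first exact: sqi_cube.
    by apply: sqiB => //; exact: sqi_approx.
  apply: eq_gsum_level => K KQ lv; rewrite /osc; congr Int; apply/funext => x.
  rewrite (indicM_norm (cube K) (fun y => f y - avg f K)).
  rewrite (indicM_norm (cube K) (fun y => f y - h N y)) !mulrBr; congr `|_ - _|.
  have hk : - K.1 <= N%:Z by lia.
  have /(congr1 (fun F => F x)) -> := @indic_approx _ _ nu N K e' (below_trans KQ bN) hk.
  by rewrite (_ : absz _ = 0%N); [rewrite /step/= mulrC|lia].
rewrite oscE.
have sfh : sqi mu (fun x => f x - h N x) by apply: sqiB => //; exact: sqi_approx.
have sqfh : sqn mu (fun x => f x - h N x) <= dl ^+ 2.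
  have := sqnB 1 sf (sqi_approx nu N).
  rewrite (_ : (fun x => f x - 1 * _) = (fun x => f x - h N x)); last first.
    by apply/funext => x; rewrite mul1r.
  rewrite -/(h N) hf sqn_approx// => ->; lra.
apply: (@le_trans _ _ (Int mu (fun x => dl / 2 * \1_(cube Q) x + (2 * dl)^-1 * (f x - h N x) ^+ 2))).
  apply: le_Int.
  - by apply: igr_indic_norm; apply: sqi_mul => //; exact: sqi_cube.
  - by apply: igrD; apply: igrZ; [exact: igr_cube|case: sfh].
  - move=> x; rewrite indicE; case: (x \in _) => /=; last first.
      rewrite mul0r mulr0 add0r mulr_ge0 ?sqr_ge0// invr_ge0 mulr_ge0// ltW//.
    rewrite mul1r mulr1 -(real_normK (num_real (_ - _))); set a := `|_|.
    have := sqr_ge0 (a - dl); rewrite sqrrB => h1.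
    have dl2 : 0 < 2 * dl by rewrite mulr_gt0.
    rewrite -(ler_pM2l dl2) mulrDr mulVKf ?gt_eqF//; move: h1; lra.
rewrite IntD ?IntZ ?Int_cube//; [|by case: sfh|exact: igr_cube|by apply: igrZ; exact: igr_cube|by apply: igrZ; case: sfh].
apply: (@le_trans _ _ (dl / 2 * cmu Q + (2 * dl)^-1 * dl ^+ 2)).
  by rewrite lerD2l ler_wpM2l// invr_ge0 mulr_ge0// ltW.
have -> : (2 * dl)^-1 * dl ^+ 2 = dl / 2 by field; rewrite gt_eqF.
have : dl * (cmu Q + 1) = e by rewrite divfK// gt_eqF.
have := mulr_gt0 dl0 Q1; have := mulr_gt0 dl0 (@cmu_gt0 R n Q); lra.
Qed.

(** f is cut at a height where the rest has integral at most e/4. At every generation the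
    oscillation of the rest is at most twice that, and the bounded part is square integrable on
    Q. *)
Lemma osc_cvg f Q (e : R) : measurable_fun setT f ->
  igr mu (fun x => \1_(cube Q) x * f x) -> 0 < e ->
  exists d, gsum (osc f) d Q <= e.
Proof.
move=> mf ih e0.
have e4 : 0 < e / 4 by rewrite divr_gt0.
have [M0 HM] := tail_cvg mf ih e4; have {HM} := HM M0 (leqnn _); move: M0 => M hM.
pose A := above f M%:R; have mA : measurable A by exact: measurable_above.
pose g x := \1_(cube Q) x * (\1_(~` A) x * f x).
have gM x : `|g x| <= M%:R * \1_(cube Q) x.
  rewrite /g !indicE; case: (x \in cube Q) => /=; rewrite ?mul0r ?mulr0 ?normr0 ?mul1r ?mulr1//.
  case: (boolP (x \in ~` A)) => xA /=; rewrite ?mul1r ?mul0r ?normr0//.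
  by rewrite inE /A /above/= in xA; rewrite leNgt; apply/negP.
have mg : measurable_fun setT g.
  by apply: meas_indicM; [exact: measurable_cube|apply: meas_indicM => //; exact: measurableC].
have sg : sqi mu g.
  split => //; apply: (igr_le _ _ (igrZ (M%:R ^+ 2) (@igr_cube R n Q))).
    exact: measurable_funX.
  move=> x; rewrite ger0_norm ?sqr_ge0// -real_normK ?num_real//.
  have -> : M%:R ^+ 2 * \1_(cube Q) x = (M%:R * \1_(cube Q) x) ^+ 2 :> R.
    by rewrite exprMn indicE; case: (x \in _); rewrite ?expr1n ?expr0n.
  by rewrite ler_sqr ?nnegrE.
have [d hd] := osc_cvg_sqi Q sg (divr_gt0 e0 (ltr0n _ 2)).
exists d.
pose tl x := \1_A x * f x.
have it K : below K Q -> igr mu (fun x => \1_(cube K) x * tl x).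
  move=> KQ; have := igr_indicM mA (igr_sub KQ ih); congr igr; apply/funext => x.
  by rewrite /tl !indicMM setIC.
have fE K x : below K Q -> \1_(cube K) x * f x = \1_(cube K) x * g x + \1_(cube K) x * tl x.
  move=> KQ; rewrite /g /tl (indicMM (cube K) (cube Q) (fun y => \1_(~` A) y * f y)).
  rewrite (setIidl (below_sub KQ)) -mulrDr -mulrDl.
  congr (_ * _); rewrite !indicE in_setC; case: (x \in A); rewrite ?add0r ?addr0 ?mul1r//.
have ig K : igr mu (fun x => \1_(cube K) x * g x).
  by apply: sqi_mul => //; exact: sqi_cube.
have step1 K : below K Q -> osc f K <=
    osc g K + 2 * Int mu (fun x => \1_(cube K) x * `|tl x|).
  move=> KQ.
  have aE : avg f K = avg g K + avg tl K.
    rewrite /avg -mulrDl -IntD//; last exact: it.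
    by congr (Int _ _ / _); apply/funext => x; exact: fE.
  have K0 := @cmu_gt0 R n K.
  have atl : `|avg tl K| * cmu K <= Int mu (fun x => \1_(cube K) x * `|tl x|).
    rewrite /avg normrM normfV (gtr0_norm K0) divfK ?gt_eqF//.
    apply: (le_trans (le_norm_Int (it K KQ))).
    rewrite le_eqVlt; apply/orP; left; apply/eqP; congr Int; apply/funext => x.
    by rewrite indicM_norm.
  apply: (@le_trans _ _ (Int mu (fun x => \1_(cube K) x * `|g x - avg g K| +
     (\1_(cube K) x * `|tl x| + \1_(cube K) x * `|avg tl K|)))).
    apply: le_Int.
    - by apply: igr_osc; exact: igr_sub ih.
    - apply: igrD; first exact: igr_osc.
      by apply: igrD; [apply: igr_indic_norm; exact: it|exact: igr_indic_cst].
    - move=> x; rewrite -!mulrDr; have [xK|xK] := pselect (cube K x); last first.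
        by rewrite indicE memNset// !mul0r.
      apply: ler_wpM2l; first by rewrite indicE.
      have := fE K x KQ; rewrite !indicE !mem_set// !mul1r => ->; rewrite aE.
      have -> : g x + tl x - (avg g K + avg tl K) = (g x - avg g K) + (tl x - avg tl K) by ring.
      by apply: (le_trans (ler_normD _ _)); rewrite lerD2l ler_normB.
  rewrite IntD ?IntD ?Int_indic_cst//; last 4 first.
  - by apply: igr_indic_norm; exact: it.
  - exact: igr_indic_cst.
  - exact: igr_osc.
  - by apply: igrD; [apply: igr_indic_norm; exact: it|exact: igr_indic_cst].
  rewrite /osc; lra.
apply: (le_trans (le_gsum _ step1)).
rewrite gsumD gsumZ (@Int_gsum (fun x => `|tl x|)); last first.
  by apply: igr_indic_norm; apply: it; exact: below_refl.
have -> : (fun x => \1_(cube Q) x * `|tl x|) = fun x => \1_A x * `|\1_(cube Q) x * f x|.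
  apply/funext => x; rewrite (indicM_norm (cube Q) tl).
  by rewrite (indicM_norm A (fun y => \1_(cube Q) y * f y)) /tl !indicMM setIC.
rewrite -/A in hM.
lra.
Qed.

End Oscillation.

(** * Smooth bumps *)

Section SmoothRealFunctions.
Context {R : realType}.
Implicit Types f g : R -> R.

Fixpoint Ck (k : nat) f : Prop :=
  if k is k'.+1 then
    exists2 f' : R -> R, (forall x : R, is_derive x (1 : R) f (f' x)) & Ck k' f'
  else continuous f.

Definition smooth1 f := forall k, Ck k f.

Lemma is_derive_continuous f (x df : R) : is_derive x (1 : R) f df -> {for x, continuous f}.
Proof. by case=> h _; exact/differentiable_continuous/derivable1_diffP. Qed.

Lemma Ck_continuous k f : Ck k f -> continuous f.
Proof. by case: k => [//|k] [f' h _] x; exact: is_derive_continuous (h x). Qed.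

Lemma CkS k f : Ck k.+1 f -> Ck k f.
Proof.
elim: k f => [|k IH] f; first by move/Ck_continuous.
by case=> f' h /IH h'; exists f'.
Qed.

Lemma Ck_cst k (c : R) : Ck k (cst c).
Proof.
elim: k c => [|k IH] c; first by move=> x; exact: cvg_cst.
by exists (cst 0) => // x; exact: is_derive_cst.
Qed.

Lemma CkD k f g : Ck k f -> Ck k g -> Ck k (fun x => f x + g x).
Proof.
elim: k f g => [|k IH] f g; first by move=> cf cg x; exact: cvgD (cf x) (cg x).
move=> [f' df hf] [g' dg hg]; exists (fun x => f' x + g' x); last exact: IH.
by move=> x; exact: is_deriveD.
Qed.

Lemma CkM k f g : Ck k f -> Ck k g -> Ck k (fun x => f x * g x).
Proof.
elim: k f g => [|k IH] f g; first by move=> cf cg x; exact: cvgM (cf x) (cg x).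
move=> hf hg; have sf := CkS hf; have sg := CkS hg.
case: hf hg => [f' df hf] [g' dg hg]; exists (fun x => f x * g' x + g x * f' x).
  by move=> x; exact: is_deriveM.
by apply: CkD; exact: IH.
Qed.

Lemma CkV k f : (forall x, f x != 0) -> Ck k f -> Ck k (fun x => (f x)^-1).
Proof.
move=> f0; elim: k => [|k IH]; first by move=> cf x; exact: cvgV (f0 x) (cf x).
move=> hf; have sf := IH (CkS hf); case: hf => [f' df hf].
exists (fun x => -1 * ((f x)^-1 * (f x)^-1) * f' x).
  move=> x; have := is_deriveV (f0 x) (df x).
  by rewrite /GRing.scale/= mulN1r -invfM -expr2.
by apply: CkM => //; apply: CkM; [exact: Ck_cst|exact: CkM].
Qed.

Lemma Ck_affine k f (a b : R) : Ck k f -> Ck k (fun x => f (a * x + b)).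
Proof.
elim: k f => [|k IH] f.
  move=> cf x; apply: (@continuous_comp _ _ _ (fun x => a * x + b) f); last exact: cf.
  by apply: cvgD; [apply: cvgM; [exact: cvg_cst|exact: cvg_id]|exact: cvg_cst].
move=> [f' df hf]; exists (fun x => f' (a * x + b) * a).
  move=> x; apply: (@is_derive1_comp _ f (fun x => a * x + b)).
  have h1 : is_derive x (1 : R) (fun x => a * x) a.
    have := is_deriveM (is_derive_cst a x 1) (is_derive_id x (1 : R)).
    by rewrite scaler0 addr0 /GRing.scale/= mulr1.
  have := is_deriveD h1 (is_derive_cst b x (1 : R)).
  by rewrite addr0.
by apply: CkM; [exact: IH|exact: Ck_cst].
Qed.

Lemma smooth1_derive f : smooth1 f ->
  smooth1 (fun x => 'D_1 f x) /\ forall x : R, is_derive x (1 : R) f ('D_1 f x).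
Proof.
move=> sf; have [f' df _] := sf 1%N; split; last first.
  by move=> x; have [h1 h2] := df x; exact: DeriveDef.
move=> k; have [g dg hg] := sf k.+1.
rewrite (_ : (fun x => _) = g)//; apply/funext => x.
by have [_ ->] := dg x.
Qed.

(** The functions p(1/x) exp(-1/x) form a class closed under differentiation: the derivative
    replaces p by X^2 (p - p'). *)
Definition flat (p : {poly R}) x : R :=
  if 0 < x then p.[x^-1] * expR (- x^-1) else 0.

(** The power of y absorbs the factor X when the induction passes from p to p X + c. *)
Lemma poly_expR_bounded (p : {poly R}) (m : nat) :
  exists2 C, 0 <= C & forall y, 0 < y -> `|p.[y]| * y ^+ m * expR (- y) <= C.
Proof.
elim/poly_ind: p m => [|p c IH] m.
  by exists 0 => // y _; rewrite horner0 normr0 !mul0r.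
have [C C0 hC] := IH m.+1; exists (C + `|c| * m`!%:R) => [|y y0].
  by rewrite addr_ge0// mulr_ge0.
have ey := expR_gt0 (- y); have ym : 0 <= y ^+ m by rewrite exprn_ge0// ltW.
have h1 : y ^+ m * expR (- y) <= m`!%:R.
  rewrite expRN ler_pdivrMr ?expR_gt0// mulrC -ler_pdivrMr ?ltr0n ?fact_gt0//.
  case: m {hC ym} => [|m]; first by rewrite expr0 fact0 divr1 (le_trans _ (expR_ge1Dx y))// lerDl ltW.
  by have := expR_ge1Dxn m (ltW y0); lra.
rewrite hornerMXaddC -mulrA.
apply: (@le_trans _ _ ((`|p.[y]| * y + `|c|) * (y ^+ m * expR (- y)))).
  apply: ler_wpM2r; first by rewrite mulr_ge0// ltW.
  by rewrite (le_trans (ler_normD _ _))// normrM (gtr0_norm y0).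
rewrite mulrDl lerD//; last by rewrite ler_wpM2l.
by have := hC _ y0; rewrite exprS !mulrA.
Qed.

(** The quadratic bound gives derivative 0 at the origin, the only point where [is_derive_flat] is
    not a computation. *)
Lemma flat_le (p : {poly R}) : exists2 C, 0 <= C & forall x, `|flat p x| <= C * x ^+ 2.
Proof.
have [C C0 h] := poly_expR_bounded p 2; exists C => // x; rewrite /flat.
case: ifPn => [x0|_]; last by rewrite normr0 mulr_ge0// sqr_ge0.
have := h x^-1; rewrite invr_gt0 => /(_ x0).
rewrite normrM (gtr0_norm (expR_gt0 _)) mulrAC exprVn ler_pdivrMr ?exprn_gt0//.
Qed.

Lemma is_derive_flat (p : {poly R}) (x : R) :
  is_derive x (1 : R) (flat p) (flat ('X^2 * (p - deriv p)) x).
Proof.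
have [x0|x0|->] := ltrgtP x 0.
- rewrite {2}/flat ltNge (ltW x0)/=.
  apply: (@near_eq_is_derive _ _ _ (cst 0)) => //.
  have : \forall y \near x, y < 0 by exact: lt_nbhsl.
  by apply: filterS => y y0; rewrite /flat ltNge (ltW y0).
- rewrite {2}/flat x0.
  apply: (@near_eq_is_derive R R R (fun y : R => p.[y^-1] * expR (- y^-1))) => //.
    have : \forall y \near x, 0 < y by exact: lt_nbhsr.
    by apply: filterS => y y0; rewrite /flat y0.
  have xn0 : x != 0 by rewrite gt_eqF.
  have dV : is_derive x (1 : R) (fun y : R => y^-1) (- x ^- 2).
    by have := is_deriveV (f := id) xn0 (is_derive_id x (1 : R)); rewrite /GRing.scale/= mulr1.
  have dp : is_derive x (1 : R) (fun y => p.[y^-1]) ((deriv p).[x^-1] * - x ^- 2).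
    apply: (@is_derive1_comp _ (horner p) (fun y => y^-1)).
  have de : is_derive x (1 : R) (fun y => expR (- y^-1)) (expR (- x^-1) * x ^- 2).
    apply: (@is_derive1_comp _ expR (fun y => - y^-1)).
    by have := is_deriveN dV; rewrite opprK.
  have := is_deriveM dp de; congr is_derive.
  rewrite !hornerE exprVn.
  have E (a b c e : R) : a * (e * c) + e * (b * - c) = c * (a - b) * e by ring.
  exact: E.
- rewrite {2}/flat ltxx.
  have [C C0 hC] := flat_le p.
  have lim0 : (fun h : R => h^-1 *: ((flat p \o shift 0) (h *: 1) - flat p 0)) @ 0^' --> (0 : R).
    apply/cvgrPdist_le => e e0; near=> h.
    rewrite sub0r normrN /= {2}/flat ltxx subr0 addr0 /GRing.scale/= mulr1.
    have hn0 : h != 0 by near: h; exact: nbhs_dnbhs_neq.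
    rewrite normrM normfV ler_pdivrMl ?normr_gt0//.
    apply: (le_trans (hC h)); rewrite -real_normK ?num_real// expr2 mulrCA ler_wpM2l//.
    have : `|h| <= e / (C + 1).
      near: h; apply: dnbhs0_le; rewrite divr_gt0//; lra.
    have C1 : 0 < C + 1 by lra.
    rewrite ler_pdivlMr// => h1; apply: le_trans h1; rewrite mulrC ler_wpM2l//; lra.
  apply: DeriveDef; first by apply/cvg_ex; exists 0.
  by apply: cvg_lim.
Unshelve. all: by end_near.
Qed.

Lemma smooth1_flat p : smooth1 (flat p).
Proof.
move=> k; elim: k p => [|k IH] p.
  by move=> x; exact: is_derive_continuous (is_derive_flat p x).
by exists (flat ('X^2 * (p - deriv p))) => // x; exact: is_derive_flat.
Qed.

Lemma smooth1_bump (a' a b b' : R) : a' < a -> a <= b -> b < b' ->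
  exists f, [/\ smooth1 f, forall x, 0 <= f x,
    forall x, a <= x <= b -> f x = 1 & forall x, f x != 0 -> a' <= x <= b'].
Proof.
move=> aa ab bb; pose h := flat 1.
have h_gt0 x : 0 < x -> 0 < h x.
  by move=> x0; rewrite /h /flat x0 hornerE mul1r expR_gt0.
have h_eq0 x : x <= 0 -> h x = 0 by move=> x0; rewrite /h /flat ltNge x0.
have h_ge0 x : 0 <= h x by case: (ltP 0 x) => [/h_gt0/ltW|/h_eq0 ->].
pose u x := h (1 * x + - a') * h (-1 * x + b').
pose v x := h (-1 * x + a) + h (1 * x + - b).
have u0 x : 0 <= u x by rewrite mulr_ge0.
have v0 x : 0 <= v x by rewrite addr_ge0.
have uv x : 0 < u x + v x.
  have [xa|xa] := ltP x a.
    by apply: ltr_wpDl => //; apply: ltr_pwDl => //; apply: h_gt0; lra.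
  have [xb|xb] := ltP b x.
    by apply: ltr_wpDl => //; apply: ltr_wpDl => //; apply: h_gt0; lra.
  by apply: ltr_pwDl => //; apply: mulr_gt0; apply: h_gt0; lra.
exists (fun x => u x * (u x + v x)^-1); split.
- move=> k; have hk := smooth1_flat 1 k.
  have Cu : Ck k u by apply: CkM; apply: Ck_affine.
  have Cv : Ck k v by apply: CkD; apply: Ck_affine.
  by apply: CkM => //; apply: CkV; [move=> x; rewrite gt_eqF|exact: CkD].
- by move=> x; rewrite mulr_ge0// invr_ge0 ltW.
- move=> x /andP[xa xb]; have -> : v x = 0 by rewrite /v !h_eq0 ?addr0//; lra.
  have := uv x; rewrite (_ : v x = 0); last by rewrite /v !h_eq0 ?addr0//; lra.
  by rewrite addr0 => up; rewrite divff// gt_eqF.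
- move=> x; apply: contraNT => nx; rewrite mulf_eq0; apply/orP; left.
  rewrite mulf_eq0; move: nx; rewrite negb_and -!ltNge => /orP[h1|h1].
    by rewrite h_eq0 ?eqxx//; lra.
  by rewrite [h (-1 * _ + _)]h_eq0 ?eqxx ?orbT//; lra.
Qed.

End SmoothRealFunctions.

(** * Smooth bumps adapted to boxes *)

Section BoxBumps.
Context {R : realType} (n : nat).
Implicit Types (f : 'I_n -> R -> R) (x : 'rV[R]_n).

Definition tensor f x : R := \prod_i f i (x ord0 i).

Definition derive_at (j : 'I_n) f : 'I_n -> R -> R :=
  fun i => if i == j then (fun y => 'D_1 (f i) y) else f i.

Lemma continuous_tensor f : (forall i, continuous (f i)) -> continuous (tensor f).
Proof.
move=> cf.
have c1 i : continuous (fun y : 'rV[R]_n => f i (y ord0 i)).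
  move=> y; apply: (@continuous_comp _ _ _ (fun y : 'rV[R]_n => y ord0 i) (f i)).
    exact: coord_continuous.
  exact: cf.
have H (s : seq 'I_n) : continuous (fun y : 'rV[R]_n => \prod_(i <- s) f i (y ord0 i)).
  elim: s => [|i s IH] x.
    have -> : (fun y : 'rV[R]_n => \prod_(i <- [::]) f i (y ord0 i)) = cst 1.
      by apply/funext => y; rewrite big_nil.
    exact: cst_continuous.
  have -> : (fun y : 'rV[R]_n => \prod_(i <- i :: s) f i (y ord0 i)) =
      (fun y => f i (y ord0 i) * \prod_(i <- s) f i (y ord0 i)).
    by apply/funext => y; rewrite big_cons.
  exact: (cvgM (c1 i x) (IH x)).
exact: (H (index_enum _)).
Qed.

Lemma is_derive_tensor f j x : (forall i, smooth1 (f i)) ->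
  is_derive x (delta_mx ord0 j : 'rV[R]_n) (tensor f) (tensor (derive_at j f) x).
Proof.
move=> sf.
pose c := \prod_(i | i != j) f i (x ord0 i).
have [_ /(_ (x ord0 j)) [dj ej]] := smooth1_derive (sf j).
have E : (fun h : R => h^-1 *: ((tensor f \o shift x) (h *: delta_mx ord0 j) - tensor f x)) =
    fun h : R => c * (h^-1 *: ((f j \o shift (x ord0 j)) (h *: 1) - f j (x ord0 j))).
  apply/funext => h; rewrite /tensor /= (bigD1 j)//= [X in _ - X](bigD1 j)//=.
  rewrite !mxE !eqxx mulr1 (eq_bigr (fun i => f i (x ord0 i))); last first.
    by move=> i ij; rewrite !mxE (negbTE ij) andbF mulr0 add0r.
  by rewrite -/c /GRing.scale/= mulr1; ring.
have cv : (fun h : R => h^-1 *: ((tensor f \o shift x) (h *: delta_mx ord0 j) - tensor f x)) @ 0^'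
    --> tensor (derive_at j f) x.
  rewrite E (_ : tensor _ _ = c * 'D_1 (f j) (x ord0 j)).
    by apply: cvgM; [exact: cvg_cst|exact: dj].
  rewrite /tensor (bigD1 j)//= /derive_at eqxx mulrC; congr (_ * _).
  by apply: eq_bigr => i ij; rewrite (negbTE ij).
apply: DeriveDef; first by apply/cvg_ex; exists (tensor (derive_at j f) x).
exact: cvg_lim cv.
Qed.

Lemma smooth_tensor f : (forall i, smooth1 (f i)) -> smooth (tensor f).
Proof.
move=> sf s h.
have [g [sg hg]] : exists g, (forall i, smooth1 (g i)) /\ h = tensor g.
  rewrite /h; elim: s {h} => [|j s [g [sg hg]]] /=; first by exists f.
  exists (derive_at j g); split.
    by move=> i; rewrite /derive_at; case: ifP => // _; have [] := smooth1_derive (sg i).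
  rewrite hg; apply/funext => x; rewrite /partial.
  by have [_ ->] := is_derive_tensor j x sg.
rewrite hg; split; first by apply: continuous_tensor => i; exact: (Ck_continuous (sg i 0%N)).
by move=> i x; have [] := is_derive_tensor i x sg.
Qed.

Definition box (a b : 'I_n -> R) : set 'rV[R]_n := [set x | forall i, a i <= x ord0 i <= b i].

Lemma compact_box a b : compact (box a b).
Proof.
have := @rV_compact R n (fun i => `[a i, b i]%classic) (fun i => @segment_compact R (a i) (b i)).
by congr compact; apply/seteqP; split => x /= h i; have := h i; rewrite in_itv.
Qed.

Lemma closed_box a b : closed (box a b).
Proof. by apply: compact_closed; [exact: norm_hausdorff|exact: compact_box]. Qed.

Lemma box_bump (a' a b b' : 'I_n -> R) : (forall i, a' i < a i) ->
  (forall i, a i <= b i) -> (forall i, b i < b' i) ->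
  exists f : 'rV[R]_n -> R, [/\ test_function f, forall x, 0 <= f x,
    forall x, box a b x -> f x = 1 & closed_support f `<=` box a' b'].
Proof.
move=> aa ab bb.
have [g Hg] := choice (fun i => smooth1_bump (aa i) (ab i) (bb i)).
have sup : closed_support (tensor g) `<=` box a' b'.
  rewrite ((closure_id _).1 (@closed_box a' b')); apply: closure_subset => x /= gx.
  move=> i; have [_ _ _] := Hg i; apply; apply: contraNneq gx => e.
  by rewrite /tensor (bigD1 i)//= e mul0r.
exists (tensor g); split => //.
- split; first by apply: smooth_tensor => i; have [] := Hg i.
  apply: subclosed_compact sup; [exact: closed_closure|exact: compact_box].
- by move=> x; apply: prodr_ge0 => i _; have [_ + _ _] := Hg i; exact.
- by move=> x xab; rewrite /tensor big1// => i _; have [_ _ + _] := Hg i; apply; exact: xab.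
Qed.

End BoxBumps.

(** * Perfect dyadic forms and their testing families *)

Section DyadicForm.
Context {R : realType} (n : nat).
Notation cubei := (cubei n).
Notation cube := (@cube R n).
Notation cmu := (@cmu R n).
Local Notation mu := (lebesgue_rV n : {measure set 'rV[R]_n -> \bar R}).
Implicit Types (J P Q : cubei) (x : 'rV[R]_n) (f g h : 'rV[R]_n -> R)
  (D : set ('rV[R]_n -> R)) (Bil : ('rV[R]_n -> R) -> ('rV[R]_n -> R) -> R).

Record step_domain D : Prop := {
  sd_lin : forall a f g, D f -> D g -> D (fun x => a * f x + g x) ;
  sd_cube : forall J f, D f -> D (fun x => \1_(cube J) x * f x) ;
  sd_one : forall J, D \1_(cube J) ;
  sd_meas : forall f, D f -> measurable_fun setT f ;
  sd_loc : forall J f, D f -> igr mu (fun x => \1_(cube J) x * f x) }.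

Section StepDomain.
Variable D : set ('rV[R]_n -> R).
Hypothesis SD : step_domain D.

Lemma sd_zero : D (fun=> 0).
Proof.
have D1 := sd_one SD (0, 0); have := sd_lin SD (-1) D1 D1.
by congr D; apply/funext => x /=; ring.
Qed.

Lemma sd_scale a f : D f -> D (fun x => a * f x).
Proof.
move=> Df; have := sd_lin SD a Df sd_zero.
by congr D; apply/funext => x; rewrite addr0.
Qed.

Lemma sd_add f g : D f -> D g -> D (fun x => f x + g x).
Proof. by move=> Df Dg; have := sd_lin SD 1 Df Dg; congr D; apply/funext => x; rewrite mul1r. Qed.

Lemma sd_sum (I : Type) (s : seq I) (p : pred I) (F : I -> 'rV[R]_n -> R) :
  (forall i, p i -> D (F i)) -> D (fun x => \sum_(i <- s | p i) F i x).
Proof.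
move=> DF; elim: s => [|i s IH].
  by have := sd_zero; congr D; apply/funext => x; rewrite big_nil.
case pi : (p i).
  by have := sd_add (DF _ pi) IH; congr D; apply/funext => x; rewrite big_cons pi.
by have := IH; congr D; apply/funext => x; rewrite big_cons pi.
Qed.

Lemma sd_step c d J : D (step c d J).
Proof.
elim: d J => [|d IH] J; first exact: sd_scale (sd_one SD J).
have := @sd_sum _ (index_enum (corner n)) xpredT _ (fun i _ => IH (child J i)).
by congr D; apply/funext => x; rewrite stepS.
Qed.

End StepDomain.

Lemma supportedE f J : supported f (cube J) -> (fun x => \1_(cube J) x * f x) = f.
Proof.
move=> fJ; apply/funext => x; have [xJ|xJ] := pselect (cube J x).
  by rewrite indicE mem_set// mul1r.
by rewrite fJ// mulr0.
Qed.

Lemma supported_indicM J f : supported (fun x => \1_(cube J) x * f x) (cube J).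
Proof. by move=> x xJ; rewrite indicE memNset// mul0r. Qed.

Lemma supported_indic J : supported (\1_(cube J) : 'rV[R]_n -> R) (cube J).
Proof. by move=> x xJ; rewrite indicE memNset. Qed.

Lemma supported_sub f A B : A `<=` B -> supported f A -> supported f B.
Proof. by move=> AB fA x xB; apply: fA => /AB. Qed.

(** Kept apart from the size bound in [dyadic_form], because for an operator that bound is itself
    derived from perfectness. *)
Record perfect_form (D1 D2 : set ('rV[R]_n -> R)) Bil : Prop := {
  df_lin1 : forall a f g h, D1 f -> D1 g -> D2 h ->
    Bil (fun x => a * f x + g x) h = a * Bil f h + Bil g h ;
  df_lin2 : forall a f g h, D2 f -> D2 g -> D1 h ->
    Bil h (fun x => a * f x + g x) = a * Bil h f + Bil h g ;
  df_dom1 : step_domain D1 ;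
  df_dom2 : step_domain D2 ;
  df_perfect : forall P Q f g, cube P `&` cube Q = set0 -> D1 f -> D2 g ->
    supported f (cube P) -> supported g (cube Q) ->
    Int mu f = 0 \/ Int mu g = 0 -> Bil f g = 0 }.

Record dyadic_form (D1 D2 : set ('rV[R]_n -> R)) Bil : Prop := {
  df_form :> perfect_form D1 D2 Bil ;
  df_size : forall P Q, P.1 = Q.1 -> cube P `&` cube Q = set0 ->
    `|Bil \1_(cube P) \1_(cube Q)| <= cmu P }.

Lemma perfect_form_swap D1 D2 Bil : perfect_form D1 D2 Bil ->
  perfect_form D2 D1 (fun g f => Bil f g).
Proof.
case=> l1 l2 d1 d2 pf; split => //.
by move=> P Q f g PQ ? ? ? ? h; apply: (pf Q P); rewrite 1?setIC//; case: h; tauto.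
Qed.

Lemma dyadic_form_swap D1 D2 Bil : dyadic_form D1 D2 Bil ->
  dyadic_form D2 D1 (fun g f => Bil f g).
Proof.
case=> /perfect_form_swap pf sz; split => // P Q PQ d.
by rewrite (le_trans (sz _ _ _ _)) ?(setIC (cube Q))// /cmu /side PQ.
Qed.

Section Form.
Variables (D1 D2 : set ('rV[R]_n -> R)) (Bil : ('rV[R]_n -> R) -> ('rV[R]_n -> R) -> R).
Hypothesis F : perfect_form D1 D2 Bil.
Let SD1 := df_dom1 F.
Let SD2 := df_dom2 F.

Lemma form0l h : D2 h -> Bil (fun=> 0) h = 0.
Proof.
move=> Dh; have := df_lin1 F (-1) (sd_zero SD1) (sd_zero SD1) Dh.
rewrite (_ : (fun x => _) = fun=> 0); first by move=> ->; ring.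
by apply/funext => x /=; ring.
Qed.

Lemma formZl a f h : D1 f -> D2 h -> Bil (fun x => a * f x) h = a * Bil f h.
Proof.
move=> Df Dh; have := df_lin1 F a Df (sd_zero SD1) Dh.
rewrite form0l// addr0 => <-; congr Bil.
by apply/funext => x /=; rewrite addr0.
Qed.

Lemma formDl f g h : D1 f -> D1 g -> D2 h -> Bil (fun x => f x + g x) h = Bil f h + Bil g h.
Proof.
move=> Df Dg Dh; have := df_lin1 F 1 Df Dg Dh; rewrite mul1r => <-; congr Bil.
by apply/funext => x /=; rewrite mul1r.
Qed.

Lemma form_suml (I : Type) (s : seq I) (p : pred I) (f : I -> 'rV[R]_n -> R) h :
  (forall i, p i -> D1 (f i)) -> D2 h ->
  Bil (fun x => \sum_(i <- s | p i) f i x) h = \sum_(i <- s | p i) Bil (f i) h.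
Proof.
move=> Df Dh; elim: s => [|i s IH].
  rewrite big_nil -[RHS](form0l Dh); congr Bil.
  by apply/funext => x; rewrite big_nil.
rewrite big_cons; case: ifP => pi; last first.
  by rewrite -IH; congr Bil; apply/funext => x; rewrite big_cons pi.
rewrite -IH -formDl; [|exact: Df|exact: (sd_sum SD1)|exact: Dh].
by congr Bil; apply/funext => x; rewrite big_cons pi.
Qed.

(** For disjoint cubes this is the constant that acts as the kernel on P x Q, see
    [form_disjoint]. *)
Definition pair_kernel P Q := Bil \1_(cube P) \1_(cube Q) / (cmu P * cmu Q).
Definition sib_kernel J i j := pair_kernel (child J i) (child J j).

Lemma centerE f P : D1 f -> supported f (cube P) ->
  let f' x := - (Int mu f / cmu P) * \1_(cube P) x + f x in
  [/\ D1 f', supported f' (cube P) & Int mu f' = 0].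
Proof.
move=> Df fP f'; have igf : igr mu f by rewrite -(supportedE fP); exact: (sd_loc SD1 P Df).
split.
- by apply: (sd_lin SD1) => //; exact: (sd_one SD1).
- by move=> x xP; rewrite /f' fP// indicE memNset// mulr0 addr0.
- rewrite IntD ?IntZ ?Int_cube//; [|exact: igr_cube|exact/igrZ/igr_cube].
  by rewrite mulNr divfK ?gt_eqF ?cmu_gt0// addNr.
Qed.

Lemma form_disjoint_l f g P Q : cube P `&` cube Q = set0 -> D1 f -> D2 g ->
  supported f (cube P) -> supported g (cube Q) ->
  Bil f g = Int mu f / cmu P * Bil \1_(cube P) g.
Proof.
move=> PQ Df Dg fP gQ; have [Df' fP' f0] := centerE Df fP.
have := df_perfect F PQ Df' Dg fP' gQ (or_introl f0).
rewrite (df_lin1 F) ?mulNr//; last exact: (sd_one SD1).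
by move/eqP; rewrite addrC subr_eq0 => /eqP.
Qed.

End Form.

Lemma sib_kernel_le D1 D2 Bil J i j : dyadic_form D1 D2 Bil -> i != j ->
  `|sib_kernel Bil J i j| * cmu J <= 2 ^+ n.
Proof.
move=> F ij; rewrite /sib_kernel /pair_kernel (cmu_child J i).
have -> : cmu (child J j) = cmu (child J i) by [].
have m0 : 0 < cmu (child J i) by exact: cmu_gt0.
rewrite normrM normrV ?unitfE ?mulf_neq0 ?gt_eqF// (gtr0_norm (mulr_gt0 m0 m0)).
have sz := df_size F (erefl : (child J i).1 = (child J j).1) (@child_disjoint R n J i j ij).
rewrite mulrCA ler_piMr ?exprn_ge0// -mulrA invfM -mulrA mulVf ?gt_eqF// mulr1.
by rewrite ler_pdivrMr// mul1r.
Qed.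


Lemma pair_kernel_swap Bil P Q :
  pair_kernel (fun g f => Bil f g) P Q = pair_kernel Bil Q P.
Proof. by rewrite /pair_kernel [cmu P * _]mulrC. Qed.

Section Truncation.
Variables (D1 D2 : set ('rV[R]_n -> R)) (Bil : ('rV[R]_n -> R) -> ('rV[R]_n -> R) -> R).
Hypothesis F : perfect_form D1 D2 Bil.
Let SD1 := df_dom1 F.
Let SD2 := df_dom2 F.
Let F' := perfect_form_swap F.

Lemma form_disjoint f g P Q : cube P `&` cube Q = set0 -> D1 f -> D2 g ->
  supported f (cube P) -> supported g (cube Q) ->
  Bil f g = pair_kernel Bil P Q * Int mu f * Int mu g.
Proof.
move=> PQ Df Dg fP gQ; rewrite (form_disjoint_l F PQ Df Dg fP gQ).
have QP : cube Q `&` cube P = set0 by rewrite setIC.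
rewrite (form_disjoint_l F' QP Dg (sd_one SD1 P) gQ (@supported_indic P)).
by rewrite /pair_kernel invfM; ring.
Qed.

Lemma indicM_sum J f : (fun x => \1_(cube J) x * f x) =
  fun x => \sum_i \1_(cube (child J i)) x * f x.
Proof. by apply/funext => x; rewrite indic_cube_sum mulr_suml. Qed.

Lemma form_split f g J : D1 f -> D2 g ->
  let r h i x := \1_(cube (child J i)) x * h x in
  Bil (fun x => \1_(cube J) x * f x) (fun x => \1_(cube J) x * g x) =
  \sum_i Bil (r f i) (r g i) +
  \sum_i \sum_(j | j != i) sib_kernel Bil J i j * Int mu (r f i) * Int mu (r g j).
Proof.
move=> Df Dg r; rewrite !indicM_sum.
have Drf i : D1 (r f i) by exact: (sd_cube SD1).
have Drg i : D2 (r g i) by exact: (sd_cube SD2).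
rewrite (form_suml F) => [|i _|]; [|exact: Drf|by apply: (sd_sum SD2) => i _; exact: Drg].
rewrite -big_split/=; apply: eq_bigr => i _.
rewrite (form_suml F') => [|j _|]; [|exact: Drg|exact: Drf].
rewrite (bigD1 i)//=; congr (_ + _); apply: eq_bigr => j ji.
have d := @child_disjoint R n J i j; rewrite eq_sym in ji; have {}d := d ji.
by rewrite (form_disjoint d (Drf i) (Drg j) (@supported_indicM _ _) (@supported_indicM _ _)).
Qed.

(** For f supported in a cube above [J], the value on [J] of the operator applied to f off [J], read
    off by pairing with 1_J. *)
Definition trunc f J : R :=
  (Bil f \1_(cube J) - Bil (fun x => \1_(cube J) x * f x) \1_(cube J)) / cmu J.

Let trunc_unique f J c :
  (forall g, D2 g -> supported g (cube J) ->
    Bil f g - Bil (fun x => \1_(cube J) x * f x) g = c * Int mu g) ->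
  c = trunc f J.
Proof.
move=> /(_ _ (sd_one SD2 J) (@supported_indic J)); rewrite Int_cube /trunc => ->.
by rewrite mulfK ?gt_eqF ?cmu_gt0.
Qed.

Let trunc_step f J i c : D1 f ->
  (forall g, D2 g -> supported g (cube J) ->
    Bil f g - Bil (fun x => \1_(cube J) x * f x) g = c * Int mu g) ->
  forall g, D2 g -> supported g (cube (child J i)) ->
    Bil f g - Bil (fun x => \1_(cube (child J i)) x * f x) g =
    (c + \sum_(j | j != i) sib_kernel Bil J j i *
       Int mu (fun x => \1_(cube (child J j)) x * f x)) * Int mu g.
Proof.
move=> Df H g Dg gi; have gJ := supported_sub (@cube_child_sub R n J i) gi.
have Dr j : D1 (fun x => \1_(cube (child J j)) x * f x) by exact: (sd_cube SD1).
have := H g Dg gJ; rewrite indicM_sum (form_suml F)// (bigD1 i)//= => e.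
have eS : \sum_(j | j != i) Bil (fun x => \1_(cube (child J j)) x * f x) g =
    (\sum_(j | j != i) sib_kernel Bil J j i *
       Int mu (fun x => \1_(cube (child J j)) x * f x)) * Int mu g.
  rewrite mulr_suml; apply: eq_bigr => j ji.
  have d := @child_disjoint R n J j i ji.
  by rewrite (form_disjoint d (Dr j) Dg (@supported_indicM _ _) gi).
by move: e; rewrite eS mulrDl => <-; ring.
Qed.

(** Each generation between P and J adds the siblings of one cube. They are disjoint from J, so by
    [form_disjoint] each contributes a constant on J. *)
Lemma truncE f P J g : D1 f -> supported f (cube P) -> below J P ->
  D2 g -> supported g (cube J) ->
  Bil f g - Bil (fun x => \1_(cube J) x * f x) g = trunc f J * Int mu g.
Proof.
move=> Df fP JP.
suff [c Hc] : exists c, forall g, D2 g -> supported g (cube J) ->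
    Bil f g - Bil (fun x => \1_(cube J) x * f x) g = c * Int mu g.
  by rewrite -(trunc_unique Hc); exact: Hc.
elim: JP fP => {J P} [P|J P i JP IH] fP.
  by exists 0 => h Dh hP; rewrite supportedE// subrr mul0r.
by have [c Hc] := IH fP; eexists; exact: trunc_step Hc.
Qed.

Lemma trunc_child f P J i : D1 f -> supported f (cube P) -> below J P ->
  trunc f (child J i) = trunc f J + \sum_(j | j != i) sib_kernel Bil J j i *
       Int mu (fun x => \1_(cube (child J j)) x * f x).
Proof.
move=> Df fP JP; apply/esym/trunc_unique/trunc_step => // g Dg gJ.
exact: (truncE Df fP).
Qed.

Lemma trunc_root f P : supported f (cube P) -> trunc f P = 0.
Proof. by move=> fP; rewrite /trunc supportedE// subrr mul0r. Qed.

End Truncation.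

End DyadicForm.

(** * Accretive families as tree systems *)

Section Testing.
Context {R : realType} (n : nat).
Notation cubei := (cubei n).
Notation cube := (@cube R n).
Notation cmu := (@cmu R n).
Local Notation mu := (lebesgue_rV n : {measure set 'rV[R]_n -> \bar R}).
Implicit Types (J P Q : cubei) (x : 'rV[R]_n) (f g h : 'rV[R]_n -> R)
  (D : set ('rV[R]_n -> R)) (Bil : ('rV[R]_n -> R) -> ('rV[R]_n -> R) -> R).

Record represented (D1 D2 : set ('rV[R]_n -> R)) Bil
    (T : ('rV[R]_n -> R) -> 'rV[R]_n -> R) : Prop := {
  rep_meas : forall f, D1 f -> measurable_fun setT (T f) ;
  rep_igr : forall f g, D1 f -> D2 g -> igr mu (fun x => T f x * g x) ;
  rep_int : forall f g, D1 f -> D2 g -> Bil f g = Int mu (fun x => T f x * g x) }.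

(* The operator is normalised so that the testing constant is 1. *)
Record tested_family (D : set ('rV[R]_n -> R)) (T : ('rV[R]_n -> R) -> 'rV[R]_n -> R)
    (p q c : R) (b : cubei -> 'rV[R]_n -> R) : Prop := {
  tf_dom : forall P, D (b P) ;
  tf_supp : forall P, supported (b P) (cube P) ;
  tf_mean : forall P, Int mu (b P) = cmu P ;
  tf_igr : forall P, igr mu (fun x => \1_(cube P) x * `|b P x| `^ p) ;
  tf_le : forall P, Int mu (fun x => \1_(cube P) x * `|b P x| `^ p) <= c * cmu P ;
  tf_img_igr : forall P, igr mu (fun x => \1_(cube P) x * `|T (b P) x| `^ q) ;
  tf_img_le : forall P, Int mu (fun x => \1_(cube P) x * `|T (b P) x| `^ q) <= cmu P }.
Arguments tf_supp {D T p q c b} _ P x _.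

Lemma le_Int_cube (f g : 'rV[R]_n -> R) J :
  igr mu (fun x => \1_(cube J) x * f x) -> igr mu (fun x => \1_(cube J) x * g x) ->
  (forall x, `|f x| <= g x) ->
  `|Int mu (fun x => \1_(cube J) x * f x)| <= Int mu (fun x => \1_(cube J) x * g x).
Proof.
move=> If Ig fg; apply: Int_norm_le => //; first exact: igr_meas If.
move=> x; have /andP[i0 _] := @indic01 _ _ R (cube J) x.
by rewrite normrM (ger0_norm i0) ler_wpM2l.
Qed.

Lemma Int_indicMD (f g : 'rV[R]_n -> R) J :
  igr mu (fun x => \1_(cube J) x * f x) -> igr mu (fun x => \1_(cube J) x * g x) ->
  igr mu (fun x => \1_(cube J) x * (f x + g x)) /\
  Int mu (fun x => \1_(cube J) x * (f x + g x)) =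
  Int mu (fun x => \1_(cube J) x * f x) + Int mu (fun x => \1_(cube J) x * g x).
Proof.
move=> If Ig; rewrite -IntD//.
have E : (fun x => \1_(cube J) x * (f x + g x)) =
    (fun x => \1_(cube J) x * f x + \1_(cube J) x * g x).
  by apply/funext => x; rewrite mulrDr.
by rewrite E; split => //; exact: igrD.
Qed.

Definition mean_on (b : cubei -> 'rV[R]_n -> R) P J := Int mu (fun x => \1_(cube J) x * b P x).
Definition energy_on (p q : R) (T : ('rV[R]_n -> R) -> 'rV[R]_n -> R)
    (b : cubei -> 'rV[R]_n -> R) P J :=
  Int mu (fun x => \1_(cube J) x * (`|b P x| `^ p + `|T (b P) x| `^ q)).

Lemma regroup_le (a b c d e m : R) : b <= e * m -> c <= m ->
  (a + b) + (c + d) <= d + a + (e + 1) * m.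
Proof. by lra. Qed.

Section System.
Variables (D1 D2 : set ('rV[R]_n -> R)) (Bil : ('rV[R]_n -> R) -> ('rV[R]_n -> R) -> R).
Variables (T V : ('rV[R]_n -> R) -> 'rV[R]_n -> R).
Variables (p1 q1 p2 q2 c1 c2 : R) (b1 b2 : cubei -> 'rV[R]_n -> R).
Variables (B D M E0 C : R).
Hypothesis F : dyadic_form D1 D2 Bil.
Hypothesis RT : represented D1 D2 Bil T.
Hypothesis RV : represented D2 D1 (fun g f => Bil f g) V.
Hypothesis fam1 : tested_family D1 T p1 q1 c1 b1.
Hypothesis fam2 : tested_family D2 V p2 q2 c2 b2.
Hypothesis young1 : forall x y : R, `|x * y| <= `|x| `^ q1 + `|y| `^ p2.
Hypothesis young2 : forall x y : R, `|x * y| <= `|x| `^ q2 + `|y| `^ p1.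
Hypothesis E0_gt0 : 0 < E0.
Hypothesis E0_ge : c1 + 1 <= E0.
Hypothesis C_ge : forall x : R, `|x| <= `|x| `^ p1 / (8 * E0) + C.
Hypothesis B_ge : D * M + c2 + 1 <= B.
Let SD1 := df_dom1 F.
Let SD2 := df_dom2 F.

Let igr1 P J : below J P -> igr mu (fun x => \1_(cube J) x * `|b1 P x| `^ p1).
Proof. by move=> JP; exact: igr_sub JP (tf_igr fam1 P). Qed.

Let igrT P J : below J P -> igr mu (fun x => \1_(cube J) x * `|T (b1 P) x| `^ q1).
Proof. by move=> JP; exact: igr_sub JP (tf_img_igr fam1 P). Qed.

Let igrE P J : below J P ->
  igr mu (fun x => \1_(cube J) x * (`|b1 P x| `^ p1 + `|T (b1 P) x| `^ q1)).
Proof. by move=> JP; have [] := Int_indicMD (igr1 JP) (igrT JP). Qed.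

Let energyE P J : below J P -> energy_on p1 q1 T b1 P J =
  Int mu (fun x => \1_(cube J) x * `|b1 P x| `^ p1) +
  Int mu (fun x => \1_(cube J) x * `|T (b1 P) x| `^ q1).
Proof. by move=> JP; have [] := Int_indicMD (igr1 JP) (igrT JP). Qed.

Let Int0_le (f : 'rV[R]_n -> R) J : (forall x, 0 <= f x) ->
  0 <= Int mu (fun x => \1_(cube J) x * f x).
Proof. by move=> f0; apply: Int_ge0 => x; rewrite mulr_ge0. Qed.

Lemma mean_on_le P J : below J P ->
  `|mean_on b1 P J| <= energy_on p1 q1 T b1 P J / (8 * E0) + C * cmu J.
Proof.
move=> JP; pose g x := (8 * E0)^-1 * (`|b1 P x| `^ p1 + `|T (b1 P) x| `^ q1).
have Ig : igr mu (fun x => \1_(cube J) x * g x).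
  by have := igrZ (8 * E0)^-1 (igrE JP); congr igr; apply/funext => x; rewrite mulrCA.
have [ig eg] := Int_indicMD Ig (igr_indic_cst J C).
have -> : energy_on p1 q1 T b1 P J / (8 * E0) = Int mu (fun x => \1_(cube J) x * g x).
  rewrite mulrC /energy_on -IntZ; last exact: igrE.
  by congr Int; apply/funext => x; rewrite mulrCA.
rewrite -Int_indic_cst -eg; apply: le_Int_cube => //.
  exact: (sd_loc SD1 _ (tf_dom fam1 P)).
move=> x; apply: le_trans (C_ge _) _; rewrite lerD2r /g mulrC.
by rewrite ler_wpM2l ?invr_ge0 ?mulr_ge0 ?(ltW E0_gt0)// lerDl powR_ge0.
Qed.

Lemma tail_img_le P J : below J P ->
  `|Bil (b1 P) \1_(cube J)| <= energy_on p1 q1 T b1 P J + cmu J.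
Proof.
move=> JP; rewrite (rep_int RT (tf_dom fam1 P) (sd_one SD2 J)).
have [ig eg] := Int_indicMD (igrE JP) (igr_indic_cst J 1).
rewrite -[cmu J]mul1r -Int_indic_cst -eg (_ : (fun x => T _ x * _) =
  fun x => \1_(cube J) x * T (b1 P) x); last by apply/funext => x; rewrite mulrC.
apply: le_Int_cube => //.
  by have := rep_igr RT (tf_dom fam1 P) (sd_one SD2 J); congr igr; apply/funext => x; rewrite mulrC.
move=> x; have := young1 (T (b1 P) x) 1; rewrite mulr1 normr1 powR1 => /le_trans; apply.
by rewrite lerD2r lerDr powR_ge0.
Qed.

(** The two families meet here. Since b^2_J has integral |J|, pairing it with the truncation of T
    b^1_P gives |J| times the truncated value; the pairing is the integral over J of T b^1_P b^2_J
    minus that of b^1_P and the adjoint image of b^2_J. Young's inequality with the exponents of the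
    testing conditions bounds both. *)
Lemma trunc_cmu_le P J : below J P ->
  `|trunc Bil (b1 P) J| * cmu J <= energy_on p1 q1 T b1 P J + (c2 + 1) * cmu J.
Proof.
move=> JP; have Db := tf_dom fam1 P; have Db2 := tf_dom fam2 J.
have := truncE F Db (tf_supp fam1 P) JP Db2 (tf_supp fam2 J).
rewrite (tf_mean fam2) => e.
have -> : `|trunc Bil (b1 P) J| * cmu J = `|trunc Bil (b1 P) J * cmu J|.
  by rewrite [RHS]normrM (gtr0_norm (cmu_gt0 (R := R) J)).
rewrite -e {e}.
have DbJ := sd_cube SD1 J Db.
rewrite (rep_int RT Db Db2) (rep_int RV Db2 DbJ).
have supp2 : (fun x => T (b1 P) x * b2 J x) = fun x => \1_(cube J) x * (T (b1 P) x * b2 J x).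
  by apply/funext => x; rewrite mulrCA -[in LHS](supportedE (tf_supp fam2 J)).
have supp1 : (fun x => V (b2 J) x * (\1_(cube J) x * b1 P x)) =
    fun x => \1_(cube J) x * (V (b2 J) x * b1 P x).
  by apply/funext => x; rewrite mulrCA.
have I1 := rep_igr RT Db Db2; have I2 := rep_igr RV Db2 DbJ.
rewrite supp2 in I1 *; rewrite supp1 in I2 *.
have J2 := tf_igr fam2 J; have JV := tf_img_igr fam2 J.
have [ig1 e1] := Int_indicMD (igrT JP) J2.
have [ig2 e2] := Int_indicMD JV (igr1 JP).
apply: le_trans (ler_normB _ _) _.
have h1 := le_Int_cube I1 ig1 (fun x => young1 _ _).
have h2 := le_Int_cube I2 ig2 (fun x => young2 _ _).
apply: le_trans (lerD h1 h2) _; rewrite e1 e2 (energyE JP).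
by apply: regroup_le; [exact: (tf_le fam2 J)|exact: (tf_img_le fam2 J)].
Qed.

Lemma tested_tb_system : tb_system (@child n) cmu (sib_kernel Bil) B D M E0 C (@below n)
  (mean_on b1) (energy_on p1 q1 T b1) (fun P J => trunc Bil (b1 P) J).
Proof.
have Db P := tf_dom fam1 P; have sb P := tf_supp fam1 P.
split.
- by move=> P J JP; apply: Int_children => i; exact: (sd_loc SD1 _ (Db P)).
- move=> P J JP; apply: Int_children => i.
  by apply: igrE; exact: below_child.
- by move=> P J JP; apply: Int0_le => x; rewrite addr_ge0 ?powR_ge0.
- by move=> P; rewrite /mean_on supportedE// (tf_mean fam1).
- move=> P; rewrite energyE; last exact: below_refl.
  have := tf_le fam1 P; have := tf_img_le fam1 P => h1 h2.
  have := ler_wpM2r (ltW (cmu_gt0 P)) E0_ge; rewrite mulrDl mul1r => h3.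
  by apply: le_trans _ h3; rewrite addrC [X in _ <= X]addrC; exact: lerD.
- by move=> P J JP; exact: mean_on_le.
- by move=> P J i JP; exact: (trunc_child F i (Db P) (sb P) JP).
- move=> P J JP EJ; rewrite -(ler_pM2r (cmu_gt0 (R := R) J)).
  apply: le_trans (trunc_cmu_le JP) _.
  apply: le_trans (_ : _ <= (D * M + c2 + 1) * cmu J) _.
    by rewrite -addrA [leRHS]mulrDl lerD2r.
  by rewrite ler_pM2r ?cmu_gt0.
Qed.

End System.
End Testing.

(** * The bound on step functions *)

Section StepForm.
Context {R : realType} (n : nat).
Notation cubei := (cubei n).
Notation cube := (@cube R n).
Notation cmu := (@cmu R n).
Local Notation mu := (lebesgue_rV n : {measure set 'rV[R]_n -> \bar R}).
Notation ch := (@child n).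
Implicit Types (J P Q : cubei) (x : 'rV[R]_n) (f g h : 'rV[R]_n -> R).

Lemma first_stops_le_gsum (M : R) (beta E : cubei -> cubei -> R) (phi psi : cubei -> R) P :
  (forall J, below J P -> ~~ stop cmu M beta E P J -> psi J <= phi J) ->
  (forall J, below J P -> 0 <= phi J) ->
  forall d J, below J P -> ~~ stop cmu M beta E P J ->
  first_stops ch cmu M beta E psi (fun=> 0) d J P <= gsum phi d J.
Proof.
move=> le phi0; elim=> [|d IH] J JP uJ /=; first exact: le.
apply: ler_sum => i _; have JiP : below (child J i) P by exact: below_child.
case: ifPn => [_|u]; last exact: IH.
have g0 : gsum (fun=> 0) d (child J i) = 0 :> R by rewrite gsum_additive // => K _; rewrite big1.
by rewrite -g0; apply: le_gsum => K KJ; apply: phi0; exact: below_trans KJ JiP.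
Qed.

Lemma step_mulE c e d J x :
  step c d J x * step e d J x = step (fun K => c K * e K) d J x :> R.
Proof.
elim: d J => [|d IH] J.
  rewrite /step /= mulrACA; congr (_ * _).
  have [xi|xi] := pselect (cube J x); first by rewrite indicE mem_set// mulr1.
  by rewrite indicE memNset// mulr0.
rewrite !stepS mulr_suml; apply: eq_bigr => i _; rewrite -IH mulr_sumr (bigD1 i)//=.
rewrite big1 ?addr0// => j ji.
have [xi|xi] := pselect (cube (child J i) x); last first.
  by rewrite -(indic_step_self c) indicE memNset ?mul0r.
have xj : ~ cube (child J j) x.
  move=> xj; have := @child_disjoint R n J j i ji.
  by apply/eqP/set0P; exists x.
by rewrite -(indic_step_self e) [X in X * step e _ _ _]indicE memNset ?mul0r ?mulr0.
Qed.

Lemma Int_step_gsum c d J : Int mu (step c d J) = gsum (fun K => c K * cmu K) d J.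
Proof.
elim: d J => [|d IH] J.
  by rewrite /= -Int_cube -IntZ; [|exact: igr_cube].
have -> : step c d.+1 J = fun x => \sum_i step c d (child J i) x.
  by apply/funext => x; rewrite stepS.
by rewrite Int_sum => [|i _]; [apply: eq_bigr|exact: igr_step].
Qed.

Lemma mass_tgen (c : cubei -> R) d J :
  mass ch cmu J (tgen ch c d J) = gsum (fun K => c K * cmu K) d J.
Proof. by elim: d J => [//|d IH] J; apply: eq_bigr => i _; exact: IH. Qed.

Lemma norm2_tgen (c : cubei -> R) d J :
  norm2 ch cmu J (tgen ch c d J) = gsum (fun K => c K ^+ 2 * cmu K) d J.
Proof. by elim: d J => [//|d IH] J; apply: eq_bigr => i _; exact: IH. Qed.

Lemma sqn_step c d J : sqn mu (step c d J) = gsum (fun K => c K ^+ 2 * cmu K) d J.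
Proof.
rewrite -(Int_step_gsum (fun K => c K ^+ 2)); congr Int.
by apply/funext => x; rewrite expr2 step_mulE.
Qed.

Variables (D1 D2 : set ('rV[R]_n -> R)) (Bil : ('rV[R]_n -> R) -> ('rV[R]_n -> R) -> R).
Variables (T V : ('rV[R]_n -> R) -> 'rV[R]_n -> R).
Variables (p1 q1 p2 q2 c1 c2 : R) (b1 b2 : cubei -> 'rV[R]_n -> R).
Variables (B M E0 C : R).
Notation D := (2 ^+ n).
Hypothesis F : dyadic_form D1 D2 Bil.
Hypothesis RT : represented D1 D2 Bil T.
Hypothesis RV : represented D2 D1 (fun g f => Bil f g) V.
Hypothesis fam1 : tested_family D1 T p1 q1 c1 b1.
Hypothesis fam2 : tested_family D2 V p2 q2 c2 b2.
Hypothesis young1 : forall x y : R, `|x * y| <= `|x| `^ q1 + `|y| `^ p2.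
Hypothesis young2 : forall x y : R, `|x * y| <= `|x| `^ q2 + `|y| `^ p1.
Hypothesis E0_gt0 : 0 < E0.
Hypothesis E0_ge1 : c1 + 1 <= E0.
Hypothesis E0_ge2 : c2 + 1 <= E0.
Hypothesis C_ge1 : 1 <= C.
Hypothesis C_young1 : forall x : R, `|x| <= `|x| `^ p1 / (8 * E0) + C.
Hypothesis C_young2 : forall x : R, `|x| <= `|x| `^ p2 / (8 * E0) + C.
Hypothesis M_ge : 8 * C * E0 <= M.
Hypothesis B_ge : D * M / (8 * E0) + C <= B.
Hypothesis D_le : D <= B.
Hypothesis B_ge1 : D * M + c1 + 1 <= B.
Hypothesis B_ge2 : D * M + c2 + 1 <= B.
Let SD1 := df_dom1 F.
Let SD2 := df_dom2 F.
Let F' := dyadic_form_swap F.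
Notation k := (sib_kernel Bil).
Notation beta := (mean_on b1).
Notation E := (energy_on p1 q1 T b1).
Let w J := Bil \1_(cube J) \1_(cube J).
Let v Q := V \1_(cube Q).

Let D_ge1 : 1 <= D :> R.
Proof. by rewrite exprn_ege1// ler1n. Qed.

Let mu_D J i : cmu J <= D * cmu (ch J i).
Proof. by rewrite (cmu_child J i). Qed.

Let hk J i j : i != j -> `|k J i j| * cmu J <= B.
Proof. by move=> ij; rewrite (le_trans (sib_kernel_le J F ij)). Qed.

Let sys1 : tb_system ch cmu k B D M E0 C (@below n) beta E (fun P J => trunc Bil (b1 P) J).
Proof. exact: (tested_tb_system F RT RV fam1 fam2). Qed.

Let sys2 : tb_system ch cmu (fun J i j => k J j i) B D M E0 C (@below n)
  (mean_on b2) (energy_on p2 q2 V b2) (fun P J => trunc (fun g f => Bil f g) (b2 P) J).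
Proof.
have -> : (fun J i j => k J j i) = sib_kernel (fun g f => Bil f g).
  by apply/funext => J; apply/funext => i; apply/funext => j; rewrite /sib_kernel pair_kernel_swap.
exact: (tested_tb_system F' RV RT fam2 fam1).
Qed.

Let K0 := tb_const B C.

Let offdiag_le d J (s t : dtree R (corner n) d) : tbnd 1 s -> tbnd 1 t ->
  `|form ch cmu k (fun=> 0) J s t| <= K0 * cmu J.
Proof.
apply: (local_tb _ _ _ _ E0_gt0 C_ge1 M_ge D_ge1 mu_D B_ge D_le hk sys1 sys2).
- by move=> *; exact: cmu_gt0.
- by move=> *; exact: cmu_sum.
- exact: below_refl.
- exact: below_child.
Qed.

Let K0_ge0 : 0 <= K0.
Proof.
have t1 : tbnd 1 (tconst 0 (1 : R) : dtree R (corner n) 0) by rewrite /tbnd /= normr1.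
by have := offdiag_le (0, 0) t1 t1; rewrite /= mulr0 normr0 pmulr_lge0// cmu_gt0.
Qed.

Let K2 := 128 * K0 * D ^+ 2 + 1.

Let offdiag_L2 d J (s t : dtree R (corner n) d) :
  `|form ch cmu k (fun=> 0) J s t| <= K2 * (norm2 ch cmu J s + norm2 ch cmu J t).
Proof.
have m0 J' : 0 < cmu J' by exact: cmu_gt0.
have n0 (z : dtree R (corner n) d) : 0 <= norm2 ch cmu J z by exact: norm2_ge0.
apply: le_trans (form_L2_le m0 (@cmu_sum R n) D_ge1 mu_D offdiag_le J s t) _.
by rewrite ler_wpM2r ?addr_ge0// lerDl.
Qed.

Let w_split J : w J = \sum_i w (ch J i) +
  \sum_i \sum_(j | j != i) k J i j * cmu (ch J i) * cmu (ch J j).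
Proof.
have := form_split F J (sd_one SD1 J) (sd_one SD2 J) => /=.
have E1 : (fun x => \1_(cube J) x * \1_(cube J) x) = (\1_(cube J) : _ -> R).
  by apply: supportedE; exact: supported_indic.
have Ei i : (fun x => \1_(cube (child J i)) x * \1_(cube J) x) = (\1_(cube (child J i)) : _ -> R).
  apply/funext => x; have [xi|xi] := pselect (cube (child J i) x).
    by rewrite !indicE !mem_set ?mulr1//; exact: cube_child_sub xi.
  by rewrite indicE memNset// mul0r.
rewrite E1 /w => ->; congr (_ + _); first by apply: eq_bigr => i _; rewrite Ei.
by apply: eq_bigr => i _; apply: eq_bigr => j _; rewrite !Ei !Int_cube.
Qed.

Let v_meas Q : measurable_fun setT (v Q).
Proof. exact: (rep_meas RV (sd_one SD2 Q)). Qed.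

Let v_igr Q f : D1 f -> igr mu (fun x => f x * v Q x).
Proof.
move=> Df; have := rep_igr RV (sd_one SD2 Q) Df.
by congr igr; apply/funext => x; rewrite mulrC.
Qed.

Let v_int Q f : D1 f -> Bil f \1_(cube Q) = Int mu (fun x => f x * v Q x).
Proof.
move=> Df; rewrite (rep_int RV (sd_one SD2 Q) Df).
by congr Int; apply/funext => x; rewrite mulrC.
Qed.

(** The adjoint image of 1_Q cut off on J is constant on J, so a function of mean zero does not see
    it. *)
Let mean_zero_top f J Q : below J Q -> D1 f -> supported f (cube J) -> Int mu f = 0 ->
  Bil f \1_(cube J) = Int mu (fun x => f x * v Q x).
Proof.
move=> JQ Df fJ f0; rewrite -v_int//.
have := truncE F' (sd_one SD2 Q) (@supported_indic _ _ Q) JQ Df fJ.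
rewrite f0 mulr0 => /eqP; rewrite subr_eq0 => /eqP ->; congr Bil.
apply/funext => x; have [xi|xi] := pselect (cube J x).
  by rewrite !indicE !mem_set ?mulr1//; exact: (below_sub JQ).
by rewrite !indicE memNset// mul0r.
Qed.

Let c2_ge0 : 0 <= c2.
Proof.
have := tf_le fam2 (0, 0); rewrite -(pmulr_lge0 c2 (cmu_gt0 (R := R) ((0, 0) : cubei))).
by apply: le_trans; apply: Int_ge0 => x; rewrite mulr_ge0 ?powR_ge0.
Qed.

Let M_ge0 : 0 <= M.
Proof. by apply: le_trans _ M_ge; rewrite !mulr_ge0 ?(ltW E0_gt0)// (le_trans _ C_ge1). Qed.

Let indic_sub J Q : below J Q -> (fun x => \1_(cube J) x * \1_(cube Q) x) = (\1_(cube J) : _ -> R).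
Proof.
move=> JQ; apply/funext => x; have [xi|xi] := pselect (cube J x).
  by rewrite !indicE !mem_set ?mulr1//; exact: (below_sub JQ).
by rewrite !indicE memNset// mul0r.
Qed.

Let igr_tail (g : 'rV[R]_n -> R) J A : measurable A ->
  igr mu (fun x => \1_(cube J) x * g x) ->
  igr mu (fun x => \1_(cube J) x * (\1_A x * `|g x|)).
Proof.
move=> mA /igr_indic_norm /(igr_indicM mA).
by congr igr; apply/funext => x; rewrite mulrCA.
Qed.

Let v_cube Q J : igr mu (fun x => \1_(cube J) x * v Q x).
Proof. by apply: v_igr; exact: (sd_one SD1). Qed.

(* On a cube J where b_Q has not stopped, 1_J is replaced by the multiple of
   1_J b_Q with the same average; the error is paired with T* 1_Q, since for
   functions of mean zero on J the pairings with 1_J and 1_Q agree. *)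
Let corona_local Q J (L : R) : below J Q -> 0 <= L -> ~~ stop cmu M beta E Q J ->
  let G x := B * `|v Q x| + `|b1 Q x * v Q x| in
  `|w J| <= 2 * ((2 * M + c2 + 2) * cmu J + L * osc (b1 Q) J +
     Int mu (fun x => \1_(cube J) x * (\1_(above (v Q) L) x * `|G x|))).
Proof.
move=> JQ L0 uJ /=; set G := fun x => B * `|v Q x| + `|b1 Q x * v Q x|.
have m0 : 0 < cmu J by exact: cmu_gt0.
have mA := measurable_above L (v_meas Q).
have Db := tf_dom fam1 Q; have D1J := sd_one SD1 J.
have ge := good_ge uJ; have EM : E Q J <= M * cmu J.
  by move: uJ; rewrite /stop negb_or => /andP[_]; rewrite -leNgt.
have bB : `|beta Q J| <= B * cmu J.
  apply: (beta_le _ E0_gt0 B_ge sys1 JQ) => [K|]; first exact: cmu_gt0.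
  by apply: le_trans EM _; rewrite ler_pM2r// ler_peMl.
pose a := avg (b1 Q) J; have aE : a * cmu J = beta Q J by rewrite divfK ?gt_eqF.
have a_ge : 1 / 2 <= a by rewrite ler_pdivlMr// mul1r mulrC.
have aB : `|a| <= B.
  by rewrite -(ler_pM2r m0) -{1}(gtr0_norm m0) -normrM aE.
pose f x := - a * \1_(cube J) x + \1_(cube J) x * b1 Q x.
have Df : D1 f by apply: (sd_lin SD1) => //; exact: (sd_cube SD1).
have fE x : f x = \1_(cube J) x * (b1 Q x - a) by rewrite /f; ring.
have fJ : supported f (cube J) by move=> x xJ; rewrite fE indicE memNset// mul0r.
have f0 : Int mu f = 0.
  rewrite IntD; [|by apply/igrZ/igr_cube|exact: (sd_loc SD1 _ Db)].
  by rewrite IntZ ?Int_cube; [rewrite mulNr aE addNr|exact: igr_cube].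
have e1 := mean_zero_top JQ Df fJ f0.
rewrite (df_lin1 F) in e1; [|by []|exact: (sd_cube SD1)|exact: (sd_one SD2)].
have e2 : Bil (fun x => \1_(cube J) x * b1 Q x) \1_(cube J) =
    Bil (b1 Q) \1_(cube J) - trunc Bil (b1 Q) J * cmu J.
  by rewrite /trunc divfK ?gt_eqF// opprB addrC subrK.
have l1 := tail_img_le F RT fam1 young1 JQ.
have l2 := trunc_cmu_le F RT RV fam1 fam2 young1 young2 JQ.
have IG : igr mu (fun x => \1_(cube J) x * G x).
  have I1 := igrZ B (igr_indic_norm (v_cube Q J)).
  have I2 := igr_indicM (@measurable_cube R n J) (igr_norm (v_igr Q Db)).
  by have := igrD I1 I2; congr igr; apply/funext => x; rewrite /G mulrDr; congr (_ + _); ring.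
(* Where [v Q] is at most L the integrand is at most L times |b_Q - a|; elsewhere |b_Q - a| <= |b_Q|
   + B produces [G]. *)
have l3 : `|Int mu (fun x => f x * v Q x)| <= L * osc (b1 Q) J +
    Int mu (fun x => \1_(cube J) x * (\1_(above (v Q) L) x * `|G x|)).
  have io := igr_osc a (sd_loc SD1 J Db).
  have it := igr_tail mA IG.
  rewrite /osc -IntZ// -IntD//; last exact: igrZ.
  apply: Int_norm_le; first exact: igr_meas (v_igr Q Df).
    by apply: igrD => //; exact: igrZ.
  move=> x; rewrite fE -/a; have /andP[i0 _] := @indic01 _ _ R (cube J) x.
  rewrite -mulrA normrM (ger0_norm i0) mulrCA -mulrDr ler_wpM2l// normrM.
  have G0 : 0 <= G x by rewrite addr_ge0 ?mulr_ge0// (le_trans _ aB).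
  have [h|h] := leP `|v Q x| L.
    rewrite mulrC -[leLHS]addr0; apply: lerD; first by rewrite ler_wpM2r.
    by rewrite mulr_ge0.
  rewrite [\1_(above _ _) x]indicE mem_set// mul1r (ger0_norm G0) -[leLHS]add0r.
  apply: lerD; first by rewrite mulr_ge0.
  rewrite /G [`|b1 Q x * _|]normrM -mulrDl ler_wpM2r//.
  by apply: le_trans (ler_normB _ _) _; rewrite addrC lerD2r.
have wa : `|w J| <= 2 * `|a * w J|.
  have a0 : 0 <= a by lra.
  rewrite normrM (ger0_norm a0) mulrA; apply: ler_peMl => //; lra.
apply: le_trans wa _; rewrite ler_pM2l//.
have -> : a * w J = (Bil (b1 Q) \1_(cube J) - trunc Bil (b1 Q) J * cmu J) -
    Int mu (fun x => f x * v Q x) by rewrite -e1 -e2 -/(w J); ring.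
apply: le_trans (ler_normB _ _) _; rewrite -addrA; apply: lerD => //.
apply: le_trans (ler_normB _ _) _; rewrite [X in _ + X <= _]normrM (gtr0_norm m0).
by apply: le_trans (lerD l1 l2) _; lra.
Qed.

Let C1 := 2 * (2 * M + c2 + 4).

(** First the level L is taken so large that the tail costs at most |Q|, then the generation so fine
    that L times the total oscillation does too. These two units turn the 2 M + c2 + 2 of
    [corona_local] into the 2 M + c2 + 4 of [C1]. *)
Let corona Q : exists d,
  first_stops ch cmu M beta E (fun J => `|w J|) (fun=> 0) d Q Q <= C1 * cmu Q.
Proof.
have m0 : 0 < cmu Q by exact: cmu_gt0.
pose G x := B * `|v Q x| + `|b1 Q x * v Q x|.
have IG : igr mu (fun x => \1_(cube Q) x * G x).
  have I1 := igrZ B (igr_indic_norm (v_cube Q Q)).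
  have I2 := igr_indicM (@measurable_cube R n Q) (igr_norm (v_igr Q (tf_dom fam1 Q))).
  by have := igrD I1 I2; congr igr; apply/funext => x; rewrite /G mulrDr; congr (_ + _); ring.
have [L HL] := tail_cvg (v_meas Q) IG m0.
have mA := measurable_above L%:R (v_meas Q).
have l0 : 0 < cmu Q / (L%:R + 1) by rewrite divr_gt0// ltr_wpDl.
have mb := sd_meas SD1 (tf_dom fam1 Q).
have [d Hd] := osc_cvg mb (sd_loc SD1 Q (tf_dom fam1 Q)) l0.
exists d; pose ta J := Int mu (fun x => \1_(cube J) x * (\1_(above (v Q) L%:R) x * `|G x|)).
have ta0 J : 0 <= ta J.
  by apply: Int_ge0 => x; rewrite !mulr_ge0.
pose phi J := 2 * ((2 * M + c2 + 2) * cmu J + L%:R * osc (b1 Q) J + ta J).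
have phi0 J : below J Q -> 0 <= phi J.
  move=> _; rewrite mulr_ge0// !addr_ge0 ?mulr_ge0// ?addr_ge0 ?mulr_ge0// ?(ltW (cmu_gt0 _))//.
  by apply: Int_ge0 => x; rewrite mulr_ge0.
have le J (JQ : below J Q) (uJ : ~~ stop cmu M beta E Q J) : `|w J| <= phi J.
  exact: corona_local.
have u : ~~ stop cmu M beta E Q Q.
  apply: (good_root _ E0_gt0 C_ge1 M_ge sys1) => K; exact: cmu_gt0.
apply: le_trans (first_stops_le_gsum le phi0 d (below_refl Q) u) _.
rewrite /phi gsumZ gsumD gsumD !gsumZ (gsum_additive (phi := cmu)) => [|K _]; last exact: cmu_sum.
have -> : gsum ta d Q = ta Q by apply: (Int_gsum _ (igr_tail mA IG)).
have taQ : ta Q <= cmu Q.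
  apply: le_trans (HL L (leqnn L)); rewrite /ta le_eqVlt; apply/orP; left; apply/eqP.
  by congr Int; apply/funext => x; rewrite -indicM_norm mulrCA.
have oQ : L%:R * gsum (osc (b1 Q)) d Q <= cmu Q.
  apply: le_trans (ler_wpM2l _ Hd) _ => //.
  by rewrite mulrCA ler_piMr ?(ltW m0)// ler_pdivrMr ?mul1r ?lerDl// ltr_wpDl.
by rewrite /C1 -mulrA ler_pM2l//; lra.
Qed.

Let C3 := 4 * C * (C1 + 2 * K0) + 3.

Let eta01 : 0 <= 1 - (4 * C)^-1 < 1.
Proof.
have C4 : 1 <= 4 * C by have := C_ge1; lra.
rewrite subr_ge0 invf_le1 ?(lt_le_trans _ C4)// C4 /=.
by rewrite ltrBlDr ltrDl invr_gt0 (lt_le_trans _ C4).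
Qed.

(** [diagonal_le] with [kappa] the truncations of the adjoint image of 1_Q. The level L is chosen
    first, depending on Q and on the form, and then the number j of iterations. Three terms become
    at most |Q| each, which is the 3 in [C3]. *)
Lemma testing_diagonal Q : `|Bil \1_(cube Q) \1_(cube Q)| <= C3 * cmu Q.
Proof.
have m0 : 0 < cmu Q by exact: cmu_gt0.
have [L1 HL] := tail_cvg (v_meas Q) (v_cube Q Q) m0.
have K2_gt0 : 0 < K2 by rewrite ltr_wpDl// !mulr_ge0// ?exprn_ge0.
pose L := maxn L1 (Num.trunc (4 * K2 ^+ 2)).+1.
have L_gt0 : 0 < L%:R :> R by rewrite ltr0n leq_max orbT.
have L_ge : 4 * K2 ^+ 2 / L%:R <= 1.
  rewrite ler_pdivrMr// mul1r; apply: le_trans (ltW (truncnS_gt _)) _.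
  by rewrite ler_nat leq_max leqnn orbT.
have mA := measurable_above L%:R (v_meas Q).
pose th J := Int mu (fun x => \1_(cube J) x * (\1_(above (v Q) L%:R) x * `|v Q x|)).
have th_igr J := igr_tail mA (v_cube Q J).
pose kappa J := trunc (fun g f => Bil f g) \1_(cube Q) J.
have [j Hj] : exists j, (1 - (4 * C)^-1) ^+ j * (2 * L%:R + K0) <= 1.
  have /andP[e0 e1] := eta01.
  have := @cvg_geometric _ (2 * L%:R + K0) (1 - (4 * C)^-1).
  rewrite ger0_norm// => /(_ e1) /cvgrPdist_le /(_ _ ltr01) [N _ /(_ N (leqnn N))].
  rewrite /= sub0r normrN => /ler_normlP[_ h]; exists N.
  by rewrite mulrC.
have := @diagonal_le _ _ _ ch cmu k w C C1 K0 K2 L%:R (@below n) Q kappa th M beta E.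
move=> /(_ _ _ _ C_ge1 _ K0_ge0 K2_gt0 L_gt0 _ _ offdiag_L2 w_split corona _ _ _ _ _ (below_refl Q) j).
have -> : 4 * K2 ^+ 2 * cmu Q / L%:R = (4 * K2 ^+ 2 / L%:R) * cmu Q by rewrite mulrAC.
have tQ : th Q <= cmu Q.
  apply: le_trans (HL L (leq_maxl _ _)); rewrite le_eqVlt; apply/orP; left; apply/eqP.
  by congr Int; apply/funext => x; rewrite -indicM_norm mulrCA.
move=> H; apply: le_trans (H _ _ _ _ _ _ _ _ _ _ _) _ => {H}.
- by move=> *; exact: cmu_gt0.
- by move=> *; exact: cmu_sum.
- by move=> *; exact: below_child.
- by rewrite mulr_ge0// !addr_ge0// mulr_ge0.
- move=> d P; apply: (first_stops_packing _ _ (@below_refl n) (@below_child n) E0_gt0 C_ge1 M_ge sys1) => *; [exact: cmu_gt0|exact: cmu_sum].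
- move=> d J; apply: offdiag_le; apply: tall_tconst; by rewrite normr1.
- exact: (trunc_root _ (@supported_indic _ _ Q)).
- move=> J i JQ; rewrite /kappa (trunc_child F' i (sd_one SD2 Q) (@supported_indic _ _ Q) JQ).
  congr (_ + _); apply: eq_bigr => l _; rewrite /sib_kernel pair_kernel_swap.
  by rewrite (indic_sub (below_child _ JQ)) Int_cube.
- by move=> J _; apply: Int_ge0 => x; rewrite !mulr_ge0.
- by move=> J _; apply: Int_children.
- move=> J JQ; rewrite /kappa /trunc divfK ?gt_eqF ?cmu_gt0// (indic_sub JQ) -/(w J).
  rewrite addrC subrK (v_int Q (sd_one SD1 J)).
  have [ig <-] : igr mu (fun x => \1_(cube J) x * (L%:R + \1_(above (v Q) L%:R) x * `|v Q x|)) /\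
     Int mu (fun x => \1_(cube J) x * (L%:R + \1_(above (v Q) L%:R) x * `|v Q x|)) = L%:R * cmu J + th J.
    by rewrite -Int_indic_cst; apply: Int_indicMD => //; exact: igr_indic_cst.
  apply: le_Int_cube => // x.
  have [h|h] := leP `|v Q x| L%:R; first by rewrite (le_trans h)// lerDl mulr_ge0.
  by rewrite indicE mem_set// mul1r lerDr.
- have := ler_wpM2r (ltW m0) Hj; have := ler_wpM2r (ltW m0) L_ge; rewrite !mul1r => h1 h2.
  rewrite /C3 [X in X + _ + _ <= _]mulrDl [X in _ <= X]mulrDl.
  move: h1 h2 tQ; lra.
Qed.

Let form_step c e d J : form ch cmu k w J (tgen ch c d J) (tgen ch e d J) =
  Bil (step c d J) (step e d J).
Proof.
elim: d J => [|d IH] J.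
  rewrite /= /step /= (formZl F) ?(formZl F') -?mulrA//; try exact: (sd_one SD2); try exact: (sd_one SD1).
  exact: (sd_scale SD2 _ (sd_one SD2 J)).
have Ds := sd_step SD1 c d.+1 J; have De := sd_step SD2 e d.+1 J.
have self c' : (fun x => \1_(cube J) x * step c' d.+1 J x) = step c' d.+1 J :> (_ -> R).
  by apply/funext => x; rewrite indic_step_self.
have := form_split F J Ds De; rewrite !self => -> /=.
have ci c' i : (fun x => \1_(cube (child J i)) x * step c' d.+1 J x) = step c' d (child J i) :> (_ -> R).
  by apply/funext => x; rewrite indic_step_child.
congr (_ + _); first by apply: eq_bigr => i _; rewrite IH !ci.
by apply: eq_bigr => i _; apply: eq_bigr => j _; rewrite !ci !Int_step_gsum !mass_tgen.
Qed.

Let form_diag d J (s t : dtree R (corner n) d) : tbnd 1 s -> tbnd 1 t ->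
  `|form ch cmu k w J s t - form ch cmu k (fun=> 0) J s t| <= C3 * cmu J.
Proof.
elim: d J s t => [|d IH] J s t /=.
  rewrite /tbnd /= mulr0 subr0 => s1 t1; apply: le_trans _ (testing_diagonal J).
  by rewrite normrM ler_piMl// normrM mulr_ile1.
move=> s1 t1; rewrite opprD addrACA subrr addr0 -sumrB (cmu_sum J) mulr_sumr.
by apply: le_trans (ler_norm_sum _ _ _) _; apply: ler_sum => i _; exact: IH.
Qed.

(** The passage to L2 is made a second time: it served the off-diagonal form alone in order to
    control [kappa], and now it is applied to the full form, whose testing constant is K0 + C3. *)
Lemma step_form_le c e d J : `|Bil (step c d J) (step e d J)| <=
  128 * (K0 + C3) * D ^+ 2 * (sqn mu (step c d J) + sqn mu (step e d J)).
Proof.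
rewrite -form_step !sqn_step -!norm2_tgen; apply: (form_L2_le _ _ D_ge1 mu_D).
- by move=> *; exact: cmu_gt0.
- by move=> *; exact: cmu_sum.
move=> d' J' s t s1 t1; have h1 := form_diag J' s1 t1; have h2 := offdiag_le J' s1 t1.
by rewrite -[form _ _ _ w _ _ _](subrK (form ch cmu k (fun=> 0) J' s t)) mulrDl
  (le_trans (ler_normD _ _))// addrC lerD.
Qed.

End StepForm.

(** * Extension to L2 *)

Section AlmostEverywhere.
Context {d : measure_display} {T : measurableType d} {R : realType}.
Variable mu : {measure set T -> \bar R}.
Implicit Types f g : T -> R.

Lemma ae_Int f g : measurable_fun setT f -> measurable_fun setT g ->
  ae_eq mu setT f g -> Int mu f = Int mu g.
Proof.
move=> mf mg fg; rewrite /Int /Rintegral; congr fine.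
apply: ae_eq_integral => //; [exact/measurable_EFinP|exact/measurable_EFinP|].
by apply: filterS fg => x h xT; rewrite /= h.
Qed.

Lemma ae_igr f g : measurable_fun setT g -> ae_eq mu setT f g -> igr mu f -> igr mu g.
Proof.
move=> mg fg If; have mf := igr_meas If; move: If => /integrableP[_ fin].
apply/integrableP; split; first exact/measurable_EFinP.
rewrite (_ : (\int[mu]_x _)%E = (\int[mu]_x `|(EFin \o f) x|)%E)//.
apply: ge0_ae_eq_integral => //.
- by do 2 apply: measurableT_comp => //.
- by do 2 apply: measurableT_comp => //.
- by apply: filterS fg => x h xT; rewrite /= h.
Qed.

Lemma ae_sqi f g : measurable_fun setT g -> ae_eq mu setT f g -> sqi mu f ->
  sqi mu g /\ sqn mu g = sqn mu f.
Proof.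
move=> mg fg [mf If].
have fg2 : ae_eq mu setT (fun x => f x ^+ 2) (fun x => g x ^+ 2).
  by apply: filterS fg => x h xT; rewrite /= h.
have mg2 : measurable_fun setT (fun x => g x ^+ 2) by exact: measurable_funX.
split; first by split => //; exact: ae_igr fg2 If.
by apply/esym; apply: ae_Int => //; exact: measurable_funX.
Qed.

End AlmostEverywhere.

(** * Finite combinations of cubes and the extension *)

Section Simple.
Context {R : realType} (n : nat).
Notation cubei := (cubei n).
Notation cube := (@cube R n).
Notation cmu := (@cmu R n).
Local Notation mu := (lebesgue_rV n : {measure set 'rV[R]_n -> \bar R}).
Implicit Types (J P Q K : cubei) (x : 'rV[R]_n) (f g h : 'rV[R]_n -> R) (s : seq (R * cubei)).

Lemma approx_indic N P e : below P (top N e) -> - P.1 <= N%:Z ->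
  approx (fun K => Int mu (fun x => \1_(cube K) x * \1_(cube P) x)) N = \1_(cube P).
Proof.
move=> Pe PN; apply/funext => x; rewrite /approx /step.
transitivity (\sum_e' gsum (fun K => \1_(cube P) x * \1_(cube K) x) (2 * N) (top N e') : R).
  apply: eq_bigr => e' _; apply: eq_gsum_level => K Ke lev.
  have KP : K.1 <= P.1 by move: lev PN; rewrite /= mul2n -addnn PoszD; lia.
  have [xK|xK] := pselect (cube K x); last by rewrite [\1_(cube K) x]indicE memNset// !mulr0.
  congr (_ * _); have [xP|xP] := pselect (cube P x).
    have bKP := cube_nested xK xP KP.
    rewrite [RHS]indicE mem_set// (_ : (fun y => _) = (\1_(cube K) : _ -> R)) ?Int_cube ?divff ?gt_eqF ?cmu_gt0//.
    apply/funext => y; have [yK|yK] := pselect (cube K y).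
      by rewrite !indicE !mem_set ?mulr1//; exact: (below_sub bKP).
    by rewrite !indicE memNset// mul0r.
  rewrite [RHS]indicE memNset// (_ : (fun y => _) = fun=> 0) ?Int0 ?mul0r//.
  apply/funext => y; have [yK|yK] := pselect (cube K y); last by rewrite indicE memNset// mul0r.
  rewrite [X in _ * X]indicE memNset ?mulr0// => yP; apply: xP.
  exact: (below_sub (cube_nested yK yP KP)).
transitivity (\1_(cube P) x * \sum_e' (\1_(cube (top N e')) x : R)).
  rewrite mulr_sumr; apply: eq_bigr => e' _; rewrite gsumZ; congr (_ * _).
  by apply: (gsum_additive (phi := fun K => \1_(cube K) x)) => K _; exact: indic_cube_sum.
have [xP|xP] := pselect (cube P x); last by rewrite indicE memNset// mul0r.
rewrite (bigD1 e)//= big1 ?addr0; first by rewrite !indicE !mem_set ?mulr1//; exact: (below_sub Pe).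
move=> e' ne; rewrite indicE memNset// => xe'.
have := @top_disjoint R n N e' e ne; apply/eqP/set0P; exists x; split => //.
exact: (below_sub Pe).
Qed.

Lemma approxD (a : R) (nu nu' : cubei -> R) N x :
  approx (fun K => a * nu K + nu' K) N x = a * approx nu N x + approx nu' N x :> R.
Proof.
rewrite /approx mulr_sumr -big_split/=; apply: eq_bigr => e _.
rewrite /step -gsumZ -gsumD; apply: eq_gsum => K _; ring.
Qed.

Definition simple s x : R := \sum_(a <- s) a.1 * \1_(cube a.2) x.

Lemma simple_cons a s x : simple (a :: s) x = a.1 * \1_(cube a.2) x + simple s x.
Proof. by rewrite /simple big_cons. Qed.

Lemma sqi_simple s : sqi mu (simple s).
Proof. by apply: sqi_sum => i _; apply: sqiZ; exact: sqi_cube. Qed.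

Lemma igr_cubeM_simple K s : igr mu (fun x => \1_(cube K) x * simple s x).
Proof. exact: sqi_mul (sqi_cube K) (sqi_simple s). Qed.

Lemma approx_simple s : exists N0, forall N, (N0 <= N)%N ->
  approx (fun K => Int mu (fun x => \1_(cube K) x * simple s x)) N = simple s.
Proof.
elim: s => [|[a P] s [N0 H0]].
  have E x : simple [::] x = 0 by rewrite /simple big_nil.
  exists 0%N => N _; apply/funext => x; rewrite E /approx big1// => e _; rewrite /step.
  transitivity (gsum (fun=> 0) (2 * N) (top N e) : R); last first.
    by rewrite gsum_additive// => K _; rewrite big1.
  apply: eq_gsum => K _; rewrite (_ : (fun y => _) = fun=> 0) ?Int0 ?mul0r//.
  by apply/funext => y; rewrite E mulr0.
have [N1 [e Pe]] := below_some_top P.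
exists (maxn N0 (maxn N1 (absz (- P.1)))) => N; rewrite !geq_max => /andP[N0N /andP[N1N PN]].
have PeN : below P (top N e) by exact: below_trans Pe (below_top e N1N).
have PN' : - P.1 <= N%:Z by lia.
apply/funext => x; rewrite simple_cons /= -(approx_indic PeN PN') -(H0 _ N0N) -approxD.
congr (approx _ N x); apply/funext => K.
have h := igr_cubeM_simple K [:: (1, P)].
rewrite -IntZ; last by have := h; congr igr; apply/funext => y; rewrite /simple big_seq1/= mul1r.
rewrite -IntD; last exact: igr_cubeM_simple.
  by congr Int; apply/funext => y; rewrite simple_cons/=; ring.
by apply: igrZ; have := h; congr igr; apply/funext => y; rewrite /simple big_seq1/= mul1r.
Qed.

(** Step functions as lists of weighted cubes, so that the linearity of [V] almost everywhere can be
    used one term at a time. *)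
Fixpoint cells (c : cubei -> R) d J : seq (R * cubei) :=
  if d is e.+1 then flatten [seq cells c e (child J i) | i <- index_enum _] else [:: (c J, J)].

Lemma big_cells c d J (phi : cubei -> R) :
  \sum_(a <- cells c d J) a.1 * phi a.2 = gsum (fun K => c K * phi K) d J.
Proof.
elim: d J => [|d IH] J; first by rewrite big_seq1.
by rewrite /= big_flatten big_map; apply: eq_bigr.
Qed.

Definition approx_cells (nu : cubei -> R) N :=
  flatten [seq cells (fun K => nu K / cmu K) (2 * N) (top N e) | e <- index_enum _].

Lemma big_approx_cells nu N (phi : cubei -> R) : \sum_(a <- approx_cells nu N) a.1 * phi a.2 =
  \sum_e gsum (fun K => nu K / cmu K * phi K) (2 * N) (top N e).
Proof. by rewrite big_flatten big_map; apply: eq_bigr => e _; rewrite big_cells. Qed.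

Lemma approx_cellsE nu N : approx nu N = simple (approx_cells nu N).
Proof.
by apply/funext => x; rewrite /simple (big_approx_cells nu N (fun K => \1_(cube K) x)).
Qed.

Lemma ae_eq_cubes g h : measurable_fun setT g -> measurable_fun setT h ->
  (forall J, igr mu (fun x => \1_(cube J) x * g x)) ->
  (forall J, igr mu (fun x => \1_(cube J) x * h x)) ->
  (forall J, Int mu (fun x => \1_(cube J) x * g x) = Int mu (fun x => \1_(cube J) x * h x)) ->
  ae_eq mu setT g h.
Proof.
move=> mg mh ig ih e; have : ae_eq mu setT (fun x => g x - h x) (fun=> 0).
  have E J : (fun x => \1_(cube J) x * (g x - h x)) =
      (fun x => \1_(cube J) x * g x - \1_(cube J) x * h x).
    by apply/funext => x; rewrite mulrBr.
  apply: dyadic_ae0 => [|J|J]; first exact: measurable_funB.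
    by rewrite E; exact: igrB.
  by rewrite E IntB// e subrr.
by apply: filterS => x e0 _; have := e0 Logic.I; move/eqP; rewrite subr_eq0 => /eqP.
Qed.

Lemma sqn_cube J : sqn mu \1_(cube J) = cmu J.
Proof.
rewrite -Int_cube; congr Int; apply/funext => x.
have [xJ|xJ] := pselect (cube J x); first by rewrite indicE mem_set// expr1n.
by rewrite indicE memNset// expr0n.
Qed.

Section SimpleForm.
Variables (D1 D2 : set ('rV[R]_n -> R)) (Bil : ('rV[R]_n -> R) -> ('rV[R]_n -> R) -> R).
Variables (T V : ('rV[R]_n -> R) -> 'rV[R]_n -> R) (K0 : R).
Hypothesis F : dyadic_form D1 D2 Bil.
Hypothesis RT : represented D1 D2 Bil T.
Hypothesis RV : represented D2 D1 (fun g f => Bil f g) V.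
Hypothesis K0_gt0 : 0 < K0.
Hypothesis step_le : forall c e d J, `|Bil (step c d J) (step e d J)| <=
  K0 * (sqn mu (step c d J) + sqn mu (step e d J)).
Let SD1 := df_dom1 F.
Let SD2 := df_dom2 F.
Let F' := dyadic_form_swap F.

Let sd_simple D s : step_domain D -> D (simple s).
Proof. by move=> SD; apply: (sd_sum SD) => a _; apply: (sd_scale SD); exact: (sd_one SD). Qed.

Let Kb := (K0 + 1) * #|{: corner n}|%:R.

(** Top cubes in different orthants have no common ancestor, so the estimate on trees does not
    relate them. They are disjoint and of equal size, and the kernel bound with Cauchy-Schwarz
    suffices. *)
Let cross_le c c' d N e e' : e != e' ->
  `|Bil (step c d (top N e)) (step c' d (top N e'))| <=
  sqn mu (step c d (top N e)) + sqn mu (step c' d (top N e')).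
Proof.
move=> ee; have supp c0 J : supported (step c0 d J) (cube J).
  by move=> x xJ; rewrite -indic_step_self indicE memNset// mul0r.
rewrite (form_disjoint F (@top_disjoint R n N e e' ee) (sd_step SD1 _ _ _) (sd_step SD2 _ _ _) (supp _ _) (supp _ _)).
set J := top N e; set J' := top N e'.
have mE : cmu J' = cmu J by [].
have m0 : 0 < cmu J by exact: cmu_gt0.
have CS c0 J0 : Int mu (step c0 d J0) ^+ 2 <= cmu J0 * sqn mu (step c0 d J0).
  have := cauchy_schwarz (sqi_cube J0) (sqi_step c0 d J0).
  rewrite sqn_cube; congr (_ ^+ 2 <= _); congr Int.
  by apply/funext => x; rewrite indic_step_self.
have k1 : `|pair_kernel Bil J J'| * cmu J <= 1.
  have sz := df_size F (erefl : J.1 = J'.1) (@top_disjoint R n N e e' ee).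
  rewrite /pair_kernel mE normrM normrV ?unitfE ?mulf_neq0 ?gt_eqF// (gtr0_norm (mulr_gt0 m0 m0)).
  by rewrite invfM -!mulrA mulVf ?gt_eqF// mulr1 ler_pdivrMr// mul1r.
rewrite -mulrA normrM; apply: le_trans (ler_wpM2l _ (prod_le_sqr _ _)) _ => //.
have h1 := CS c J; have h2 := CS c' J'; rewrite mE in h2.
have s1 := sqn_ge0 mu (step c d J); have s2 := sqn_ge0 mu (step c' d J').
have : Int mu (step c d J) ^+ 2 + Int mu (step c' d J') ^+ 2 <=
  cmu J * (sqn mu (step c d J) + sqn mu (step c' d J')) by rewrite mulrDr lerD.
move=> /(ler_wpM2l (normr_ge0 (pair_kernel Bil J J'))) h.
rewrite mulrA; have := ler_wpM2r (addr_ge0 s1 s2) k1; rewrite mul1r -mulrA.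
lra.
Qed.

Let Kb_gt0 : 0 < Kb.
Proof.
rewrite mulr_gt0 ?addr_gt0// ltr0n; apply/card_gt0P; by exists [ffun=> false].
Qed.

Let approx_form_le (nu nu' : cubei -> R) N :
  (forall J, nu J = \sum_i nu (child J i)) -> (forall J, nu' J = \sum_i nu' (child J i)) ->
  `|Bil (approx nu N) (approx nu' N)| <=
  Kb * (sqn mu (approx nu N) + sqn mu (approx nu' N)).
Proof.
move=> add add'; pose c K := nu K / cmu K; pose c' K := nu' K / cmu K.
have Ds e : D1 (step c (2 * N) (top N e)) by exact: sd_step.
have Ds' e : D2 (step c' (2 * N) (top N e)) by exact: sd_step.
pose A e := sqn mu (step c (2 * N) (top N e)); pose A' e := sqn mu (step c' (2 * N) (top N e)).
have sqnE (nu0 : cubei -> R) : (forall J, nu0 J = \sum_i nu0 (child J i)) ->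
    sqn mu (approx nu0 N) = \sum_e sqn mu (step (fun K => nu0 K / cmu K) (2 * N) (top N e)).
  move=> a; rewrite (sqn_approx a); apply: eq_bigr => e _; rewrite sqn_step.
  by apply: eq_gsum => K _; field; rewrite gt_eqF// cmu_gt0.
have -> : Bil (approx nu N) (approx nu' N) =
    \sum_e \sum_e' Bil (step c (2 * N) (top N e)) (step c' (2 * N) (top N e')).
  rewrite /approx (form_suml F) => [|e _|]; [|exact: Ds|by apply: (sd_sum SD2)].
  by apply: eq_bigr => e _; rewrite (form_suml F') => [|e' _|]; [|exact: Ds'|exact: Ds].
rewrite (sqnE _ add) (sqnE _ add') -/c -/c'.
have le e e' : `|Bil (step c (2 * N) (top N e)) (step c' (2 * N) (top N e'))| <=
    (K0 + 1) * (A e + A' e').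
  have s0 : 0 <= A e + A' e' by rewrite addr_ge0 ?sqn_ge0.
  have [->|ne] := eqVneq e e'.
    by apply: le_trans (step_le _ _ _ _) _; rewrite ler_wpM2r ?addr_ge0 ?sqn_ge0// lerDl.
  by apply: le_trans (cross_le _ _ _ _ ne) _; rewrite -[leLHS]mul1r ler_wpM2r// lerDr ltW.
apply: le_trans (ler_norm_sum _ _ _) _.
apply: le_trans (_ : _ <= \sum_e \sum_e' (K0 + 1) * (A e + A' e')) _.
  by apply: ler_sum => e _; apply: le_trans (ler_norm_sum _ _ _) _; apply: ler_sum.
have cst (z : R) : \sum_(e : corner n) z = #|{: corner n}|%:R * z by rewrite sumr_const mulr_natl.
rewrite (eq_bigr (fun e => (K0 + 1) * (#|{: corner n}|%:R * A e + \sum_e' A' e'))).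
  by rewrite -mulr_sumr big_split/= -mulr_sumr cst -mulrDr mulrA.
by move=> e _; rewrite -mulr_sumr big_split/= cst.
Qed.

Let Int_cube_simple_add s J : Int mu (fun x => \1_(cube J) x * simple s x) =
  \sum_i Int mu (fun x => \1_(cube (child J i)) x * simple s x).
Proof. by apply: Int_children => i; exact: igr_cubeM_simple. Qed.

Let simple_form_le s t : `|Bil (simple s) (simple t)| <=
  Kb * (sqn mu (simple s) + sqn mu (simple t)).
Proof.
have [N1 H1] := approx_simple s; have [N2 H2] := approx_simple t.
have := approx_form_le (maxn N1 N2) (Int_cube_simple_add s) (Int_cube_simple_add t).
by rewrite H1 ?leq_maxl// H2 ?leq_maxr.
Qed.

Let simpleZ a t x : simple [seq (a * i.1, i.2) | i <- t] x = a * simple t x.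
Proof. by rewrite /simple big_map mulr_sumr; apply: eq_bigr => i _; rewrite mulrA. Qed.

Let simple_form_scale s t a : 0 < a -> `|Bil (simple s) (simple t)| <=
  Kb * (a * sqn mu (simple s) + sqn mu (simple t) / a).
Proof.
move=> a0; have Ds := sd_simple s SD1; have Dt := sd_simple t SD2.
have := simple_form_le s [seq (a^-1 * i.1, i.2) | i <- t].
have -> : simple [seq (a^-1 * i.1, i.2) | i <- t] = fun x => a^-1 * simple t x.
  by apply/funext => x; exact: simpleZ.
rewrite (formZl F' _ Dt Ds) normrM (gtr0_norm (_ : 0 < a^-1)) ?invr_gt0//.
have -> : sqn mu (fun x => a^-1 * simple t x) = a^-1 ^+ 2 * sqn mu (simple t).
  rewrite /sqn -IntZ; last exact: (sqi_simple t).2.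
  by congr Int; apply/funext => x; rewrite exprMn.
rewrite ler_pdivrMl// => /le_trans; apply; rewrite le_eqVlt; apply/orP; left; apply/eqP.
by rewrite expr2; field; rewrite gt_eqF.
Qed.

Let Bil_child J g : D2 g -> Bil \1_(cube J) g = \sum_i Bil \1_(cube (child J i)) g.
Proof.
move=> Dg; rewrite -(form_suml F) => [|i _|]; [|exact: (sd_one SD1)|by []].
by congr Bil; apply/funext => x; exact: indic_cube_sum.
Qed.

Let Bil_gsum c d J g : D2 g -> Bil (step c d J) g = gsum (fun K => c K * Bil \1_(cube K) g) d J.
Proof.
move=> Dg; elim: d J => [|d IH] J; first by rewrite /step/= (formZl F)//; exact: (sd_one SD1).
have -> : step c d.+1 J = fun x => \sum_i step c d (child J i) x.
  by apply/funext => x; rewrite stepS.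
rewrite (form_suml F) => [|i _|]; [|exact: sd_step|by []].
by apply: eq_bigr.
Qed.

Let A0 := 4 * Kb ^+ 2.

Let V_meas g : D2 g -> measurable_fun setT (V g). Proof. exact: (rep_meas RV). Qed.
Let V_igr J g : D2 g -> igr mu (fun x => \1_(cube J) x * V g x).
Proof.
move=> Dg; have := rep_igr RV Dg (sd_one SD1 J).
by congr igr; apply/funext => x; rewrite mulrC.
Qed.
Let V_int J g : D2 g -> Int mu (fun x => \1_(cube J) x * V g x) = Bil \1_(cube J) g.
Proof.
move=> Dg; rewrite (rep_int RV Dg (sd_one SD1 J)).
by congr Int; apply/funext => x; rewrite mulrC.
Qed.

(** The energy of [nu] is the form at [approx nu N] and [simple s]. Scaling by 1/(2 Kb) lets half of
    it be absorbed, whence A0 = 4 Kb^2. The density given by [dyadic_riesz] has the same integrals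
    over cubes as [V (simple s)]. *)
Let adjoint_simple s : sqi mu (V (simple s)) /\ sqn mu (V (simple s)) <= A0 * sqn mu (simple s).
Proof.
have Ds := sd_simple s SD2; pose nu J := Bil \1_(cube J) (simple s).
have add J : nu J = \sum_i nu (child J i) by exact: Bil_child.
have en N : energy nu N <= A0 * sqn mu (simple s).
  have approxE := approx_cellsE nu N; set t := approx_cells nu N in approxE.
  have e1 : sqn mu (simple t) = energy nu N by rewrite -approxE (sqn_approx add).
  have e2 : Bil (simple t) (simple s) = energy nu N.
    rewrite -approxE /approx (form_suml F) => [|e _|]; [|exact: sd_step|by []].
    apply: eq_bigr => e _; rewrite Bil_gsum//; apply: eq_gsum => K _.
    by rewrite /nu; ring.
  have K20 : 0 < (2 * Kb)^-1 by rewrite invr_gt0 mulr_gt0.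
  have := simple_form_scale t s K20; rewrite e1 e2 invrK => /(le_trans (ler_norm _)).
  have -> : Kb * ((2 * Kb)^-1 * energy nu N + sqn mu (simple s) * (2 * Kb)) =
    energy nu N / 2 + Kb * (sqn mu (simple s) * (2 * Kb)) by field; rewrite gt_eqF.
  rewrite /A0 => h.
  have -> : 4 * Kb ^+ 2 * sqn mu (simple s) = 2 * (Kb * (sqn mu (simple s) * (2 * Kb))) by ring.
  lra.
have [h [sh [nh hh]]] := dyadic_riesz add en.
have ae' : ae_eq mu setT h (V (simple s)).
  apply: ae_eq_cubes => [||J|J|J].
  - exact: sh.1.
  - exact: V_meas.
  - by apply: sqi_mul => //; exact: sqi_cube.
  - exact: V_igr.
  - by rewrite hh V_int.
have [sV ->] := ae_sqi (V_meas Ds) ae' sh.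
by [].
Qed.

(** [represented] says nothing on linearity; it is recovered almost everywhere from that of the
    form, by comparing integrals over cubes. *)
Let V_cons a s : ae_eq mu setT (V (simple (a :: s)))
  (fun x => a.1 * V \1_(cube a.2) x + V (simple s) x).
Proof.
have Ds := sd_simple s SD2; have Da := sd_simple (a :: s) SD2; have D1a := sd_one SD2 a.2.
have E J : (fun x => \1_(cube J) x * (a.1 * V \1_(cube a.2) x + V (simple s) x)) =
    (fun x => a.1 * (\1_(cube J) x * V \1_(cube a.2) x) + \1_(cube J) x * V (simple s) x).
  by apply/funext => x; ring.
have ig J := V_igr J D1a; have igs J := V_igr J Ds.
apply: ae_eq_cubes => [||J|J|J].
- exact: V_meas.
- by apply: measurable_funD; [apply: measurable_funM => //|]; exact: V_meas.
- exact: V_igr.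
- by rewrite E; apply: igrD => //; exact: igrZ.
- rewrite E IntD ?IntZ//; last exact: igrZ.
  rewrite !V_int// -(df_lin2 F)//; last exact: (sd_one SD1).
  by congr Bil; apply/funext => x; rewrite simple_cons.
Qed.

Let cube_simple J : \1_(cube J) = simple [:: (1, J)] :> (_ -> R).
Proof. by apply/funext => x; rewrite /simple big_seq1 mul1r. Qed.

Let sqi_V1 J : sqi mu (V \1_(cube J)).
Proof. by rewrite cube_simple; exact: (adjoint_simple _).1. Qed.

(* S f is the density of this set function. *)
Definition weak_image f J : R := Int mu (fun x => f x * V \1_(cube J) x).

Let weak_simple f s : sqi mu f ->
  Int mu (fun x => f x * V (simple s) x) = \sum_(a <- s) a.1 * weak_image f a.2.
Proof.
move=> sf; elim: s => [|a s IH].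
  rewrite big_nil; have V0 : ae_eq mu setT (V (simple [::])) (fun=> 0).
    have D0 := sd_simple [::] SD2.
    have i0 : igr mu (fun x : 'rV[R]_n => 0 : R) by exact: igr0.
    have E J : (fun x => \1_(cube J) x * (0 : R)) = fun=> 0 by apply/funext => x; rewrite mulr0.
    apply: ae_eq_cubes => [||J|J|J]; [exact: V_meas|exact: measurable_cst|exact: V_igr|by rewrite E|].
    rewrite V_int// E Int0 -(form0l F' (sd_one SD1 J)); congr Bil.
    by apply/funext => x; rewrite /simple big_nil.
  rewrite -(Int0 mu); apply: ae_Int; [|exact: measurable_cst|].
    apply: measurable_funM; [exact: sf.1|exact: (adjoint_simple _).1.1].
  by apply: filterS V0 => x h xT; rewrite h ?mulr0.
have S1 := sqi_mul sf (sqi_V1 a.2); have S2 := sqi_mul sf (adjoint_simple s).1.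
rewrite big_cons -IH -IntZ// -IntD//; last exact: igrZ.
apply: ae_Int.
- by apply: measurable_funM; [exact: sf.1|exact: (adjoint_simple _).1.1].
- by apply: (@igr_meas _ _ _ mu); apply: igrD => //; exact: igrZ.
- by apply: filterS (V_cons a s) => x h xT; rewrite h//; ring.
Qed.

Let weak_add f J : sqi mu f -> weak_image f J = \sum_i weak_image f (child J i).
Proof.
move=> sf; pose s := [seq ((1 : R), child J i) | i <- index_enum (corner n)].
have E : \1_(cube J) = simple s.
  by apply/funext => x; rewrite /simple big_map indic_cube_sum; apply: eq_bigr => i _; rewrite mul1r.
by rewrite [LHS]/weak_image E weak_simple// big_map; apply: eq_bigr => i _; rewrite mul1r.
Qed.

(** The energy e is the integral of f against [V g], where g is the approximation itself, of squared
    norm e. Cauchy-Schwarz and [adjoint_simple] give e^2 <= A0 |f|^2 e. *)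
Let weak_energy f N : sqi mu f -> energy (weak_image f) N <= A0 * sqn mu f.
Proof.
move=> sf; have add J := weak_add J sf; set e := energy _ _.
have e1 : sqn mu (simple (approx_cells (weak_image f) N)) = e by rewrite -approx_cellsE sqn_approx.
have e2 : Int mu (fun x => f x * V (simple (approx_cells (weak_image f) N)) x) = e.
  rewrite weak_simple// big_approx_cells; apply: eq_bigr => i _; apply: eq_gsum => K _.
  by rewrite expr2 mulrAC.
have [sV nV] := adjoint_simple (approx_cells (weak_image f) N).
have := cauchy_schwarz sf sV; rewrite e2; rewrite e1 in nV.
have f0 := sqn_ge0 mu f; have e0 : 0 <= e by rewrite -e1 sqn_ge0.
have A00 : 0 <= A0 by rewrite mulr_ge0// sqr_ge0.
have [->|en] := eqVneq e 0; first by rewrite mulr_ge0.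
have ep : 0 < e by rewrite lt_def en.
move=> /le_trans /(_ (ler_wpM2l f0 nV)); rewrite expr2 mulrA (mulrC (sqn mu f)).
by rewrite ler_pM2r.
Qed.

(** A square-integrable f need not lie in the domain of [T], so [S f] is defined by duality through
    the images [V 1_J], which are in L2. Linearity and agreement with [T] are then equalities of
    integrals over cubes. *)
Lemma L2_extension : exists S : ('rV[R]_n -> R) -> 'rV[R]_n -> R,
  [/\ forall f, sqi mu f -> sqi mu (S f) /\ sqn mu (S f) <= A0 * sqn mu f,
      forall a f g, sqi mu f -> sqi mu g ->
        ae_eq mu setT (S (fun x => a * f x + g x)) (fun x => a * S f x + S g x) &
      forall f, D1 f -> sqi mu f -> ae_eq mu setT (S f) (T f)].
Proof.
have ex f : exists h, sqi mu f -> sqi mu h /\ sqn mu h <= A0 * sqn mu f /\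
    forall J, Int mu (fun x => \1_(cube J) x * h x) = weak_image f J.
  have [sf|nf] := pselect (sqi mu f); last by exists (fun=> 0) => /nf.
  have [h hh] := dyadic_riesz (fun J => weak_add J sf) (fun N => weak_energy N sf).
  by exists h.
have [S HS] := choice ex; exists S.
have ig f J : sqi mu f -> igr mu (fun x => \1_(cube J) x * S f x).
  by move=> sf; apply: sqi_mul; [exact: sqi_cube|have [] := HS f sf].
split.
- by move=> f sf; have [? [? _]] := HS f sf.
- move=> a f g sf sg; have sfg := sqiD (sqiZ a sf) sg.
  have [[mS _] [_ H]] := HS _ sfg; have [[mf _] [_ Hf]] := HS f sf; have [[mg _] [_ Hg]] := HS g sg.
  have E J : (fun x => \1_(cube J) x * (a * S f x + S g x)) =
      (fun x => a * (\1_(cube J) x * S f x) + \1_(cube J) x * S g x).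
    by apply/funext => x; ring.
  apply: ae_eq_cubes => [||J|J|J].
  + exact: mS.
  + by apply: measurable_funD => //; exact: measurable_funM.
  + exact: ig.
  + by rewrite E; apply: igrD; [apply: igrZ|]; exact: ig.
  + have If := ig f J sf; have Ig := ig g J sg.
    rewrite E IntD//; last exact: igrZ.
    rewrite IntZ// Hf Hg H /weak_image.
    have Wf := sqi_mul sf (sqi_V1 J); have Wg := sqi_mul sg (sqi_V1 J).
    rewrite -IntZ// -IntD//; last exact: igrZ.
    by congr Int; apply/funext => x; ring.
- move=> f Df sf; have [[mS _] [_ H]] := HS f sf.
  have igT J : igr mu (fun x => \1_(cube J) x * T f x).
    have := rep_igr RT Df (sd_one SD2 J).
    by congr igr; apply/funext => x; rewrite mulrC.
  apply: ae_eq_cubes => [||J|J|J]; [exact: mS|exact: (rep_meas RT)|exact: ig|exact: igT|].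
  rewrite H /weak_image.
  transitivity (Bil f \1_(cube J)).
    rewrite (rep_int RV (sd_one SD2 J) Df).
    by congr Int; apply/funext => x; rewrite mulrC.
  rewrite (rep_int RT Df (sd_one SD2 J)).
  by congr Int; apply/funext => x; rewrite mulrC.
Qed.

End SimpleForm.
End Simple.

(** * Norms as real integrals *)

Section Norms.
Context {d : measure_display} {T : measurableType d} {R : realType}.
Variable mu : {measure set T -> \bar R}.
Implicit Types (f g : T -> R) (A : set T).

Lemma igr_le_on A g (r : R) : measurable A -> measurable_fun setT g -> (forall x, 0 <= g x) ->
  (\int[mu]_(x in A) (g x)%:E <= r%:E)%E ->
  igr mu (fun x => \1_A x * g x) /\ Int mu (fun x => \1_A x * g x) <= r.
Proof.
move=> mA mg g0 le.
have i0 : (0 <= \int[mu]_(x in A) (g x)%:E)%E.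
  by apply: integral_ge0 => x _; rewrite lee_fin.
split.
  apply/igr_indicP => //; apply/integrableP; split.
    by apply/measurable_EFinP; exact: measurable_funTS.
  apply: le_lt_trans (ltry r); apply: le_trans le; rewrite le_eqVlt; apply/orP; left; apply/eqP.
  by apply: eq_integral => x _ /=; rewrite ger0_norm.
rewrite Int_indicM /Rintegral -lee_fin fineK//.
by rewrite ge0_fin_numE// (le_lt_trans le)// ltry.
Qed.

Lemma Lnorm_le_on A f (p c : R) : measurable A -> measurable_fun setT f ->
  (forall x, ~ A x -> f x = 0) -> 0 < p -> 0 <= c ->
  ('N[mu]_(p%:E)[EFin \o f] <= c%:E)%E ->
  igr mu (fun x => \1_A x * `|f x| `^ p) /\
  Int mu (fun x => \1_A x * `|f x| `^ p) <= c `^ p.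
Proof.
move=> mA mf fA p0 c0; rewrite unlock /= => le.
have mp : measurable_fun setT (fun x => `|f x| `^ p).
  apply: (measurableT_comp (measurable_powR p)).
  by apply: measurableT_comp => //; exact: normr_measurable.
apply: igr_le_on => //.
apply: le_trans (_ : _ <= \int[mu]_x (`|f x| `^ p)%:E)%E _.
  apply: ge0_subset_integral => //; exact/measurable_EFinP.
have I0 : (0 <= \int[mu]_x (`|f x| `^ p)%:E)%E.
  by apply: integral_ge0 => x _; rewrite lee_fin powR_ge0.
have pi0 : 0 < p^-1 by rewrite invr_gt0.
move: I0 le.
rewrite (_ : (\int[mu]_x (`|(f x)%:E| `^ p))%E = (\int[mu]_x (`|f x| `^ p)%:E)%E); last first.
  by apply: eq_integral => x _; rewrite abse_EFin poweR_EFin.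
case: (\int[mu]_x _)%E => [r||] //; last by rewrite poweRyr ?gt_eqF.
rewrite !lee_fin => r0 le.
have -> : r = (r `^ p^-1) `^ p by rewrite -powRrM mulVf ?gt_eqF// powRr1.
by apply: ge0_ler_powR => //; rewrite ?nnegrE ?powR_ge0// ltW.
Qed.

Lemma Lfun2_sqi f : f \in Lfun mu 2%:E <-> sqi mu f.
Proof.
split.
  move=> fL; have mf := sub_Lfun_mfun fL; rewrite inE in mf.
  split => //; have := Lfun2_integrable_sqr fL.
  by rewrite /igr; congr integrable.
move=> [mf If]; rewrite inE; apply/andP; split; first by rewrite inE.
rewrite inE /= /finite_norm unlock /=.
rewrite (_ : (\int[mu]_x (`|(f x)%:E| `^ 2))%E = (\int[mu]_x (f x ^+ 2)%:E)%E); last first.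
  apply: eq_integral => x _; rewrite abse_EFin poweR_EFin.
  by rewrite powR_mulrn// real_normK// num_real.
by rewrite -EFin_Int// poweR_EFin ltry.
Qed.

Lemma Lnorm2E f : sqi mu f -> 'N[mu]_(2%:E)[EFin \o f]%E = (Num.sqrt (sqn mu f))%:E.
Proof.
move=> [mf If]; rewrite unlock /=.
rewrite (_ : (\int[mu]_x (`|(f x)%:E| `^ 2))%E = (\int[mu]_x (f x ^+ 2)%:E)%E); last first.
  apply: eq_integral => x _; rewrite abse_EFin poweR_EFin.
  by rewrite powR_mulrn// real_normK// num_real.
by rewrite -EFin_Int// poweR_EFin powR12_sqrt// sqn_ge0.
Qed.

End Norms.

(** * Young's inequality *)

Section Exponents.
Context {R : realType}.

Lemma young_powR (p q x y : R) : 1 < p -> 1 < q -> p^-1 + q^-1 = 1 ->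
  `|x * y| <= `|x| `^ p + `|y| `^ q.
Proof.
move=> p1 q1 pq; have p0 : 0 < p by lra. have q0 : 0 < q by lra.
rewrite normrM; apply: le_trans (conjugate_powR _ _ p0 q0 pq) _ => //.
by apply: lerD; rewrite ler_piMr ?powR_ge0// invf_le1// ltW.
Qed.

Lemma conjugate_gt1 (p q : R) : 1 < p -> p^-1 + q^-1 = 1 -> 1 < q.
Proof.
move=> p1 pq; have p0 : 0 < p by lra.
have pi : p^-1 < 1 by rewrite invf_lt1.
have pi0 : 0 < p^-1 by rewrite invr_gt0.
have qi : 0 < q^-1 < 1 by apply/andP; split; lra.
have q0 : 0 < q by rewrite -invr_gt0; case/andP: qi.
by rewrite -invf_lt1//; case/andP: qi.
Qed.

(** Either |x| is at most a^(1/(p-1)), or |x|^(p-1) >= a and then |x| <= |x|^p / a. *)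
Lemma norm_le_powR (p a : R) : 1 < p -> 0 < a -> exists2 C, 1 <= C &
  forall x : R, `|x| <= `|x| `^ p / a + C.
Proof.
move=> p1 a0; have p10 : 0 < p - 1 by lra.
exists (1 + a `^ (p - 1)^-1) => [|x]; first by rewrite lerDl powR_ge0.
have q0 : 0 <= `|x| `^ p / a by rewrite divr_ge0 ?powR_ge0// ltW.
have [h|h] := leP `|x| (a `^ (p - 1)^-1).
  by apply: le_trans h _; rewrite addrA lerDr addr_ge0.
rewrite -[leLHS]addr0; apply: lerD; last by rewrite addr_ge0 ?powR_ge0.
have x0 : 0 < `|x| by apply: le_lt_trans h; exact: powR_ge0.
have -> : `|x| `^ p = `|x| * `|x| `^ (p - 1).
  by rewrite -[X in X * _]powRr1// -powRD ?(gt_eqF x0) ?implybT// addrC subrK.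
rewrite -mulrA ler_peMr// ler_pdivlMr// mul1r.
have -> : a = (a `^ (p - 1)^-1) `^ (p - 1).
  by rewrite -powRrM mulVf ?gt_eqF// powRr1// ltW.
by apply: ge0_ler_powR; rewrite ?nnegrE ?powR_ge0// ltW.
Qed.

End Exponents.

(** * Perfect Calderon-Zygmund operators *)

Section Domain.
Context {R : realType} (n : nat).
Notation cubei := (cubei n).
Notation cube := (@cube R n).
Notation cmu := (@cmu R n).
Local Notation mu := (lebesgue_rV n : {measure set 'rV[R]_n -> \bar R}).
Implicit Types (J P Q : cubei) (x y : 'rV[R]_n) (f g : 'rV[R]_n -> R) (D : set ('rV[R]_n -> R)).

Lemma measurable_box (a b : 'I_n -> R) : measurable (box a b).
Proof.
rewrite (_ : box a b = \big[setI/setT]_(i < n) (rV_coord i @^-1` `[a i, b i])).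
  apply: bigsetI_measurable => i _; rewrite -[X in measurable X]setTI.
  exact: measurable_rV_coord.
rewrite -bigcap_seq; apply/seteqP; split => x /= h i.
  by move=> _; rewrite /= /rV_coord in_itv/=; exact: h.
by have := h i; rewrite /= /rV_coord in_itv/= mem_index_enum => ->.
Qed.

(* The dilation by t of the cube J about its centre. *)
Definition lower J (t : R) (i : 'I_n) : R := ((J.2 ord0 i)%:~R + (1 - t) / 2) * side J.
Definition upper J (t : R) (i : 'I_n) : R := ((J.2 ord0 i)%:~R + (1 + t) / 2) * side J.

Lemma cube_bump J (t u : R) : 0 < t -> t < u -> exists f : 'rV[R]_n -> R,
  [/\ test_function f, forall x, 0 <= f x, forall x, box (lower J t) (upper J t) x -> f x = 1 &
      closed_support f `<=` box (lower J u) (upper J u)].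
Proof.
move=> t0 tu; have s0 := side_gt0 (R := R) J.
by apply: box_bump => i; rewrite /lower /upper ?ltr_pM2r ?ler_pM2r//; lra.
Qed.

Lemma cube_sub_box J : cube J `<=` box (lower J 1) (upper J 1).
Proof.
move=> x /cubeP h i; have := h i; rewrite rmorphD/= => /andP[h1 h2].
rewrite /lower /upper subrr mul0r addr0 h1/= ltW// (lt_le_trans h2)//.
by rewrite ler_pM2r ?side_gt0//; lra.
Qed.

Lemma box_sub_cube J (t : R) : t < 1 -> box (lower J t) (upper J t) `<=` cube J.
Proof.
have s0 := side_gt0 (R := R) J.
move=> t1 x h; apply/cubeP => i; have /andP[h1 h2] := h i; apply/andP; split.
  by apply: le_trans h1; rewrite ler_pM2r//; lra.
by apply: le_lt_trans h2 _; rewrite ltr_pM2r// rmorphD/=; lra.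
Qed.

Lemma operator_step_domain D : operator_domain D -> step_domain D.
Proof.
move=> OD; split.
- by move=> a f g; exact: (domain_linear OD).
- by move=> J f; apply: (domain_cube OD); exact: dyadic_cubei.
(* Indicators of cubes belong to the domain because they are restrictions of a bump that is 1 on the
   closed cube. *)
- move=> J; have [f [tf _ f1 _]] := cube_bump J ltr01 (ltr_nat R 1 2 : 1 < 2 :> R).
  have := domain_cube OD (dyadic_cubei J) (domain_smooth OD tf).
  congr D; apply/funext => x; have [xJ|xJ] := pselect (cube J x).
    by rewrite f1 ?mulr1//; exact: cube_sub_box.
  by rewrite indicE memNset// mul0r.
- by move=> f /(domain_loc_integrable OD)[].
- move=> J f /(domain_loc_integrable OD)[mf loc].
  have fin := loc _ (@compact_box R n (lower J 1) (upper J 1)).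
  have mB := measurable_box (lower J 1) (upper J 1).
  have : igr mu (fun x => \1_(box (lower J 1) (upper J 1)) x * f x).
    apply/igr_indicP => //; apply/integrableP; split => //.
    by apply/measurable_EFinP; exact: measurable_funTS.
  move=> /(igr_indicM (@measurable_cube R n J)); congr igr; apply/funext => x.
  by rewrite indicMM (setIidl (@cube_sub_box J)).
Qed.

Section Operator.
Variables (D1 D2 : set ('rV[R]_n -> R)) (T Tadj : ('rV[R]_n -> R) -> 'rV[R]_n -> R).
Variables (K : 'rV[R]_n -> 'rV[R]_n -> R) (lam : R).
Hypothesis OD1 : operator_domain D1.
Hypothesis OD2 : operator_domain D2.
Hypothesis AO : adjoint_operators D1 D2 T Tadj.
Hypothesis PK : perfect_kernel D1 D2 T K.
Hypothesis lam_ge1 : 1 <= lam.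
Let SD1 := operator_step_domain OD1.
Let SD2 := operator_step_domain OD2.

Let pairE f g : pairing f g = Int mu (fun x => f x * g x).
Proof. by []. Qed.

Let op_igr f g : D1 f -> D2 g -> igr mu (fun x => T f x * g x).
Proof. by move=> Df Dg; exact: (op_integrable AO Df Dg). Qed.

Let pairing_perfect : perfect_form D1 D2 (fun f g => pairing (T f) g).
Proof.
split => //.
- move=> a f g h Df Dg Dh; rewrite !pairE.
  have If := op_igr Df Dh; have Ig := op_igr Dg Dh.
  have Dl : D1 (fun x => a * f x + g x) by exact: (sd_lin SD1).
  rewrite -IntZ// -IntD//; last exact: igrZ.
  apply: ae_Int.
  + exact: igr_meas (op_igr Dl Dh).
  + by apply: (@igr_meas _ _ _ mu); apply: igrD => //; exact: igrZ.
  + by apply: filterS (op_linear AO a Df Dg) => x e xT; rewrite e//; ring.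
- move=> a f g h Df Dg Dh; rewrite !pairE.
  have If := op_igr Dh Df; have Ig := op_igr Dh Dg.
  rewrite -IntZ// -IntD//; last exact: igrZ.
  by congr Int; apply/funext => x; ring.
- move=> P Q f g PQ Df Dg fP gQ h.
  exact: (kernel_perfect PK (dyadic_cubei P) (dyadic_cubei Q) PQ).
Qed.

Let supp_sub f A : closed_support f `<=` A -> supported f A.
Proof.
move=> fA x xA; apply/eqP; apply: contra_notT xA => fx; apply: fA.
by apply: subset_closure.
Qed.

Let Int_bump_gt0 J f : D1 f \/ D2 f -> (forall x, 0 <= f x) ->
  (forall x, box (lower J 4^-1) (upper J 4^-1) x -> f x = 1) ->
  supported f (cube J) -> 0 < Int mu f.
Proof.
move=> Df f0 f1 fJ.
have If : igr mu f.
  by rewrite -(supportedE fJ); case: Df => Df; [exact: (sd_loc SD1)|exact: (sd_loc SD2)].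
have s0 := side_gt0 (R := R) J.
pose A := [set x : 'rV[R]_n | forall i, lower J 4^-1 i <= x ord0 i < upper J 4^-1 i].
have lu i : lower J 4^-1 i < upper J 4^-1 i.
  by rewrite /lower /upper ltr_pM2r//; lra.
have muA : mu A = (\prod_i (upper J 4^-1 i - lower J 4^-1 i))%:E.
  by apply: lebesgue_rV_box => i; exact: ltW.
have mA : measurable A by exact: measurable_rV_box.
have iA : igr mu \1_A by apply: igr_indic => //; rewrite muA ltry.
apply: lt_le_trans (_ : Int mu \1_A <= _).
  rewrite Int_indic// muA /= prodr_gt0// => i _; by rewrite subr_gt0.
apply: le_Int => // x; have [xA|xA] := pselect (A x).
  by rewrite indicE mem_set// f1// => i; have /andP[-> /ltW ->] := xA i.
by rewrite indicE memNset.
Qed.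

(** Adjacent cubes contain points arbitrarily close to each other, where the size condition says
    little. As the kernel is constant on the product it may be evaluated at the lower corners, which
    differ by at least one side in some coordinate. *)
Let center_dist P Q : P.1 = Q.1 -> cube P `&` cube Q = set0 ->
  exists x y, [/\ cube Q x, cube P y, x != y & side P <= euclidean_norm (x - y)].
Proof.
move=> lev PQ; have s0 := side_gt0 (R := R) P.
pose pt J : 'rV[R]_n := \row_i ((J.2 ord0 i)%:~R * side J).
have ptJ J : cube J (pt J).
  apply/cubeP => i; rewrite mxE lexx/= ltr_pM2r ?side_gt0// ltr_int; lia.
have sE : side Q = side P :> R by rewrite /side lev.
have [i ne] : exists i, Q.2 ord0 i != P.2 ord0 i.
  apply: contrapT => /forallNP h; have e : P.2 = Q.2.
    by apply/rowP => i; apply/esym/eqP; have := h i => /negP; rewrite negbK.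
  have : (cube P `&` cube Q) (pt P).
    by split => //; have := ptJ P; rewrite /cube lev e.
  by rewrite PQ.
have dist : side P <= `|(pt Q - pt P) ord0 i|.
  rewrite !mxE sE -mulrBl normrM (gtr0_norm s0) ler_peMl ?(ltW s0)//.
  by rewrite -rmorphB -intr_norm ler1z; lia.
have le : side P <= euclidean_norm (pt Q - pt P).
  apply: le_trans dist _; rewrite -sqrtr_sqr ler_sqrt; last by apply: sumr_ge0 => j _; exact: sqr_ge0.
  by rewrite (bigD1 i)//= lerDl sumr_ge0// => j _; exact: sqr_ge0.
exists (pt Q), (pt P); split => //; apply/eqP => e.
move: le; rewrite e subrr /euclidean_norm big1 ?sqrtr0 => [|j _]; last by rewrite mxE expr0n.
by rewrite leNgt s0.
Qed.

(** The kernel formula holds only for test functions with disjoint closed supports, not for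
    indicators. Bumps well inside P and Q express their pairing by the kernel and, through
    [form_disjoint], by [pair_kernel]; dividing by their positive integrals identifies the two
    constants. *)
Let pairing_size P Q : P.1 = Q.1 -> cube P `&` cube Q = set0 ->
  `|pairing (T \1_(cube P)) \1_(cube Q)| <= cmu P.
Proof.
move=> lev PQ; have m0 : 0 < cmu P by exact: cmu_gt0.
have mE : cmu Q = cmu P by rewrite /cmu /side lev.
have t0 : 0 < 4^-1 :> R by rewrite invr_gt0.
have tu : 4^-1 < 2^-1 :> R by lra.
have u1 : 2^-1 < 1 :> R by lra.
have [f [tf f0 f1 fs]] := cube_bump P t0 tu.
have [g [tg g0 g1 gs]] := cube_bump Q t0 tu.
have fP' := subset_trans fs (box_sub_cube u1).
have gQ' := subset_trans gs (box_sub_cube u1).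
have fP := supp_sub fP'; have gQ := supp_sub gQ'.
have Df := domain_smooth OD1 tf; have Dg := domain_smooth OD2 tg.
have disj : closed_support f `&` closed_support g = set0.
  by apply/seteqP; split => // x [/fP' xP /gQ' xQ]; rewrite -PQ.
have [x0 [y0 [xQ yP ne dist]]] := center_dist lev PQ.
have QP : cube Q `&` cube P = set0 by rewrite setIC.
have KE x y : cube Q x -> cube P y -> K x y = K x0 y0.
  by move=> ? ?; apply: (kernel_const PK (dyadic_cubei Q) (dyadic_cubei P) QP).
have If : igr mu f by rewrite -(supportedE fP); exact: (sd_loc SD1).
have Ig : igr mu g by rewrite -(supportedE gQ); exact: (sd_loc SD2).
have e1 : pairing (T f) g = K x0 y0 * Int mu f * Int mu g.
  rewrite (kernel_repr PK tf tg disj) -[RHS]mulrA -IntZ//.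
  rewrite -IntZ; last exact: igrZ.
  congr Int; apply/funext => x.
  have [xx|xx] := pselect (cube Q x); last first.
    rewrite (gQ _ xx) !mulr0 -[RHS](Int0 mu); congr Int; apply/funext => y.
    by rewrite mulr0.
  have -> : K x0 y0 * (Int mu f * g x) = K x0 y0 * g x * Int mu f by ring.
  rewrite -IntZ//; congr Int; apply/funext => y; have [yy|yy] := pselect (cube P y).
    by rewrite KE//; ring.
  by rewrite (fP _ yy) !mulr0 mul0r.
have If0 : 0 < Int mu f by apply: (@Int_bump_gt0 P); [left| | |].
have Ig0 : 0 < Int mu g by apply: (@Int_bump_gt0 Q); [right| | |].
have := form_disjoint pairing_perfect PQ Df Dg fP gQ; rewrite e1.
move=> /(mulIf (lt0r_neq0 Ig0)) /(mulIf (lt0r_neq0 If0)); rewrite /pair_kernel mE => e2.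
have -> : pairing (T \1_(cube P)) \1_(cube Q) = K x0 y0 * (cmu P * cmu P).
  by rewrite e2 divfK// mulf_neq0 ?gt_eqF.
rewrite normrM (gtr0_norm (mulr_gt0 m0 m0)) mulrA ler_piMl ?(ltW m0)//.
apply: le_trans (ler_wpM2r (ltW m0) (kernel_size PK ne)) _.
have s0 := side_gt0 (R := R) P.
rewrite -ler_pdivlMr// mul1r -exprVn /cmu -exprVn.
by rewrite lerXn2r ?nnegrE ?invr_ge0 ?(le_trans _ dist) ?(ltW s0)// lef_pV2 ?posrE// (lt_le_trans s0).
Qed.

(** In the end [lam] is 1 + Tloc: the testing constants become at most 1, and the size bound
    survives because [lam] is at least 1. This makes the dependence on Tloc linear. *)
Definition scaled_form f g : R := pairing (T f) g / lam.

Lemma operator_form : dyadic_form D1 D2 scaled_form.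
Proof.
have l0 : 0 < lam by exact: lt_le_trans lam_ge1.
split; last first.
  move=> P Q lev PQ; rewrite normrM normfV (gtr0_norm l0) ler_pdivrMr//.
  apply: le_trans (pairing_size lev PQ) _.
  by rewrite ler_peMr// ltW// cmu_gt0.
have [l1 l2 d1 d2 pf] := pairing_perfect; split => //.
- by move=> a f g h Df Dg Dh; rewrite /scaled_form l1// mulrDl mulrA.
- by move=> a f g h Df Dg Dh; rewrite /scaled_form l2// mulrDl mulrA.
- by move=> P Q f g PQ Df Dg fP gQ h; rewrite /scaled_form (pf P Q)// mul0r.
Qed.

Lemma operator_represented : represented D1 D2 scaled_form (fun f x => T f x / lam).
Proof.
have E f g : (fun x => T f x / lam * g x) = (fun x => lam^-1 * (T f x * g x)).
  by apply/funext => x; ring.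
split.
- by move=> f Df; apply: measurable_funM => //; exact: (op_measurable AO).
- by move=> f g Df Dg; rewrite E; apply: igrZ; exact: op_igr.
- by move=> f g Df Dg; rewrite E IntZ ?[_^-1 * _]mulrC//; exact: op_igr.
Qed.

Lemma adjoint_represented :
  represented D2 D1 (fun g f => scaled_form f g) (fun g x => Tadj g x / lam).
Proof.
have E g f : (fun x => Tadj g x / lam * f x) = (fun x => lam^-1 * (f x * Tadj g x)).
  by apply/funext => x; ring.
split.
- by move=> f Df; apply: measurable_funM => //; exact: (adj_measurable AO).
- by move=> g f Dg Df; rewrite E; apply: igrZ; exact: (adj_integrable AO Df Dg).
- move=> g f Dg Df; rewrite E IntZ ?[_^-1 * _]mulrC//; last exact: (adj_integrable AO Df Dg).
  by rewrite /scaled_form (op_adj AO Df Dg).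
Qed.

End Operator.
End Domain.

(** * Accretive systems and the choice of the constants *)

Section AccretiveSystems.
Context {R : realType} (n : nat).
Notation cubei := (cubei n).
Notation cube := (@cube R n).
Notation cmu := (@cmu R n).
Local Notation mu := (lebesgue_rV n : {measure set 'rV[R]_n -> \bar R}).
Implicit Types (J P : cubei) (x y : 'rV[R]_n) (f g : 'rV[R]_n -> R) (D : set ('rV[R]_n -> R)).

Lemma accretive_tested D (T : ('rV[R]_n -> R) -> 'rV[R]_n -> R) (b : set 'rV[R]_n -> 'rV[R]_n -> R)
    (p q A Tloc : R) : 0 < p -> 0 < q -> 0 <= A -> 0 <= Tloc ->
  (forall f, D f -> measurable_fun setT (T f)) ->
  accretive_system p A b -> (forall Q, dyadic Q -> D (b Q)) ->
  (forall Q, dyadic Q -> (\int[lebesgue_rV n]_(x in Q) (`|T (b Q) x| `^ q)%:E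
        <= (Tloc `^ q)%:E * lebesgue_rV n Q)%E) ->
  tested_family D (fun f x => T f x / (1 + Tloc)) p q (A `^ p) (fun J => b (cube J)).
Proof.
move=> p0 q0 A0 Tl0 mT acc Db test.
have l0 : 0 < 1 + Tloc by lra.
have dP P := @dyadic_cubei R n P.
have mP P := @measurable_cube R n P.
have supp P : supported (b (cube P)) (cube P) by have [] := acc _ (dP P).
have H P : igr mu (fun x => \1_(cube P) x * `|b (cube P) x| `^ p) /\
    Int mu (fun x => \1_(cube P) x * `|b (cube P) x| `^ p) <= A `^ p * cmu P.
  have [mb _ _ N] := acc _ (dP P); have m0 := cmu_gt0 (R := R) P.
  have -> : A `^ p * cmu P = (A * cmu P `^ p^-1) `^ p.
    by rewrite powRM ?powR_ge0// -powRrM mulVf ?gt_eqF// powRr1// ltW.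
  have c0 : 0 <= A * cmu P `^ p^-1 by rewrite mulr_ge0 ?powR_ge0.
  apply: (Lnorm_le_on (mP P) mb (supp P) p0 c0).
  by move: N; rewrite lebesgue_cube poweR_EFin -EFinM.
have HT P : igr mu (fun x => \1_(cube P) x * `|T (b (cube P)) x / (1 + Tloc)| `^ q) /\
    Int mu (fun x => \1_(cube P) x * `|T (b (cube P)) x / (1 + Tloc)| `^ q) <= cmu P.
  have := test _ (dP P); rewrite lebesgue_cube -EFinM => t.
  have mq : measurable_fun setT (fun x => `|T (b (cube P)) x| `^ q).
    apply: (measurableT_comp (measurable_powR q)).
    have mTb := mT _ (Db _ (dP P)).
    by apply: measurableT_comp => //; exact: normr_measurable.
  have [I1 I2] := igr_le_on (mP P) mq (fun x => powR_ge0 _ _) t.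
  have -> : (fun x => \1_(cube P) x * `|T (b (cube P)) x / (1 + Tloc)| `^ q) =
      (fun x => (1 + Tloc)^-1 `^ q * (\1_(cube P) x * `|T (b (cube P)) x| `^ q)).
    apply/funext => x; rewrite normrM normfV (gtr0_norm l0) powRM ?invr_ge0 ?(ltW l0)//.
    by ring.
  split; first exact: igrZ.
  rewrite IntZ//; apply: le_trans (ler_wpM2l (powR_ge0 _ _) I2) _.
  rewrite mulrA -powRM ?invr_ge0 ?(ltW l0)// ler_piMl ?(ltW (cmu_gt0 _))//.
  apply: (@le_trans _ _ (1 `^ q)); last by rewrite powR1.
  apply: ge0_ler_powR; rewrite ?nnegrE ?(ltW q0)//.
    by rewrite mulr_ge0// invr_ge0 ltW.
  by rewrite mulrC ler_pdivrMr// mul1r lerDr.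
split.
- by move=> P; exact: Db.
- exact: supp.
- move=> P; have [mb sb int _] := acc _ (dP P).
  rewrite -(supportedE (supp P)) Int_indicM /Rintegral.
  have := congr1 fine int; rewrite lebesgue_cube /= => <-.
  by congr fine; apply: eq_integral.
- by move=> P; have [] := H P.
- by move=> P; have [] := H P.
- by move=> P; have [] := HT P.
- by move=> P; have [] := HT P.
Qed.

(** All parameters are fixed before the form is given: E0 from the accretivity constant, C from E0
    and the exponents, then M and B, where also the dimension enters. The exponents q1 and q2 are
    dual to p2 and p1, in this crossed order. *)
Lemma uniform_step_bound (p1 q1 p2 q2 A : R) : 1 < p1 -> 1 < p2 ->
  p1^-1 + q2^-1 = 1 -> p2^-1 + q1^-1 = 1 -> 0 <= A ->
  exists2 K : R, 0 < K & forall (D1 D2 : set ('rV[R]_n -> R)) Bil T V b1 b2,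
    dyadic_form D1 D2 Bil -> represented D1 D2 Bil T ->
    represented D2 D1 (fun g f => Bil f g) V ->
    tested_family D1 T p1 q1 (A `^ p1) b1 -> tested_family D2 V p2 q2 (A `^ p2) b2 ->
    forall c e d J, `|Bil (step c d J) (step e d J)| <=
      K * (sqn mu (step c d J) + sqn mu (step e d J)).
Proof.
move=> p1_gt1 p2_gt1 pq1 pq2 A0.
have q2_gt1 := conjugate_gt1 p1_gt1 pq1; have q1_gt1 := conjugate_gt1 p2_gt1 pq2.
pose c1 := A `^ p1; pose c2 := A `^ p2.
have c10 : 0 <= c1 by exact: powR_ge0.
have c20 : 0 <= c2 by exact: powR_ge0.
pose E0 := c1 + c2 + 1.
have E00 : 0 < E0 by rewrite ltr_wpDl ?addr_ge0.
have E08 : 0 < 8 * E0 by rewrite mulr_gt0.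
have [C1 C11 HC1] := norm_le_powR p1_gt1 E08; have [C2 C21 HC2] := norm_le_powR p2_gt1 E08.
pose C := C1 + C2; have C_ge1 : 1 <= C by rewrite /C; lra.
pose M := 8 * C * E0; have M0 : 0 <= M by rewrite !mulr_ge0// ?(ltW E00)// (le_trans _ C_ge1).
(* The sum of all the lower bounds that are imposed on [B]. *)
pose B : R := 2 ^+ n * M / (8 * E0) + C + 2 ^+ n + (2 ^+ n * M + c1 + c2 + 1).
have D0 : 0 <= (2 : R) ^+ n by rewrite exprn_ge0.
have DM0 : 0 <= 2 ^+ n * M by rewrite mulr_ge0.
have DME0 : 0 <= 2 ^+ n * M / (8 * E0) by rewrite divr_ge0// ltW.
pose K := 128 * (tb_const B C + (4 * C * (2 * (2 * M + c2 + 4) + 2 * tb_const B C) + 3)) *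
  (2 ^+ n) ^+ 2.
exists (`|K| + 1); first by rewrite ltr_wpDl.
move=> D1 D2 Bil T V b1 b2 F RT RV fam1 fam2 c e d J.
apply: (@le_trans _ _ (K * (sqn mu (step c d J) + sqn mu (step e d J)))); last first.
  by rewrite ler_wpM2r ?addr_ge0 ?sqn_ge0// ler_wpDr// ler_norm.
apply: (@step_form_le _ _ _ _ _ T V p1 q1 p2 q2 c1 c2 b1 b2 B M E0 C F RT RV fam1 fam2) => //.
- by move=> x y; apply: young_powR => //; rewrite addrC.
- by move=> x y; apply: young_powR => //; rewrite addrC.
- by rewrite /E0; lra.
- by rewrite /E0; lra.
- by move=> x; apply: le_trans (HC1 x) _; rewrite lerD2l /C; lra.
- by move=> x; apply: le_trans (HC2 x) _; rewrite lerD2l /C; lra.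
- by move: C_ge1 D0 DM0 c10 c20; rewrite /B; lra.
- by move: C_ge1 D0 DM0 DME0 c10 c20; rewrite /B; lra.
- by move: C_ge1 D0 DM0 DME0 c10 c20; rewrite /B; lra.
- by move: C_ge1 D0 DM0 DME0 c10 c20; rewrite /B; lra.
Qed.

End AccretiveSystems.

Theorem theorem1p2 (R : realType) (n : nat) (p1 p2 p1' p2' A : R) :
  (0 < n)%N -> 1 < p1 -> 1 < p2 ->
  p1^-1 + p1'^-1 = 1 -> p2^-1 + p2'^-1 = 1 -> 1 < A ->
  exists C : R,
    forall (D1 D2 : set ('rV[R]_n -> R))
           (T Tadj : ('rV[R]_n -> R) -> ('rV[R]_n -> R))
           (b1 b2 : set 'rV[R]_n -> 'rV[R]_n -> R) (Tloc : R),
    0 <= Tloc ->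
    perfect_dyadic_CZ D1 D2 T Tadj ->
    accretive_system p1 A b1 -> accretive_system p2 A b2 ->
    (forall Q, dyadic Q -> D1 (b1 Q) /\ D2 (b2 Q)) ->
    (forall Q, dyadic Q ->
      (\int[lebesgue_rV n]_(x in Q) (`|T (b1 Q) x| `^ p2')%:E
        <= (Tloc `^ p2')%:E * lebesgue_rV n Q)%E) ->
    (forall Q, dyadic Q ->
      (\int[lebesgue_rV n]_(x in Q) (`|Tadj (b2 Q) x| `^ p1')%:E
        <= (Tloc `^ p1')%:E * lebesgue_rV n Q)%E) ->
    exists S : ('rV[R]_n -> R) -> ('rV[R]_n -> R),
      [/\ L2_bounded_operator S,
          forall f, D1 f -> f \in Lfun (lebesgue_rV n) 2%:E ->
            S f = T f %[ae lebesgue_rV n]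
        & (L2_operator_norm S <= (C * (1 + Tloc))%:E)%E].
Proof.
move=> _ p1_gt1 p2_gt1 pq1 pq2 A_gt1.
have A0 : 0 <= A by lra.
have q1_gt1 := conjugate_gt1 p1_gt1 pq1; have q2_gt1 := conjugate_gt1 p2_gt1 pq2.
have [K K0 HK] := @uniform_step_bound R n p1 p2' p2 p1' A p1_gt1 p2_gt1 pq1 pq2 A0.
(* The square root of the constant in [L2_extension]. *)
pose C : R := 2 * ((K + 1) * #|{: corner n}|%:R).
have C0 : 0 <= C by rewrite !mulr_ge0// addr_ge0// ltW.
exists C => D1 D2 T Tadj b1 b2 Tloc Tl0 [OD1 OD2 AO [Kn PK]] acc1 acc2 Db test1 test2.
set lam := 1 + Tloc; have lam1 : 1 <= lam by rewrite lerDl.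
have lam0 : 0 < lam by exact: lt_le_trans lam1.
have F := operator_form OD1 OD2 AO PK lam1.
have RT := operator_represented lam AO; have RV := adjoint_represented lam AO.
have fam1 := accretive_tested (ltac:(lra) : 0 < p1) (ltac:(lra) : 0 < p2') A0 Tl0
  (op_measurable AO) acc1 (fun Q dQ => (Db Q dQ).1) test1.
have fam2 := accretive_tested (ltac:(lra) : 0 < p2) (ltac:(lra) : 0 < p1') A0 Tl0
  (adj_measurable AO) acc2 (fun Q dQ => (Db Q dQ).2) test2.
have [S0 [S0n S0lin S0T]] := L2_extension F RT RV K0 (HK _ _ _ _ _ _ _ F RT RV fam1 fam2).
(* [S0] extends the operator divided by [lam]; this undoes the normalisation. *)
pose S f (x : 'rV[R]_n) := lam * S0 f x.
pose mu : {measure set 'rV[R]_n -> \bar R} := lebesgue_rV n.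
have Sn f : sqi mu f -> sqi mu (S f) /\ sqn mu (S f) <= (C * lam) ^+ 2 * sqn mu f.
  move=> sf; have [s1 s2] := S0n f sf; split; first exact: sqiZ.
  rewrite (_ : sqn mu (S f) = lam ^+ 2 * sqn mu (S0 f)).
    have -> : (C * lam) ^+ 2 * sqn mu f =
      lam ^+ 2 * (4 * ((K + 1) * #|{: corner n}|%:R) ^+ 2 * sqn mu f) by rewrite /C; ring.
    by rewrite ler_wpM2l ?sqr_ge0.
  by rewrite /sqn -IntZ; [congr Int; apply/funext => x; rewrite exprMn|exact: s1.2].
have SN f : sqi mu f -> Num.sqrt (sqn mu (S f)) <= C * lam * Num.sqrt (sqn mu f).
  move=> sf; have [_ h] := Sn f sf; have Cl : 0 <= C * lam by rewrite mulr_ge0// ltW.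
  by rewrite -[X in X * _](ger0_norm Cl) -sqrtr_sqr -sqrtrM ?sqr_ge0// ler_wsqrtr.
exists S; split.
- split.
  + by move=> f /Lfun2_sqi sf; apply/Lfun2_sqi; have [] := Sn f sf.
  + move=> a f g /Lfun2_sqi sf /Lfun2_sqi sg.
    by apply: filterS (S0lin a f g sf sg) => x e xT; rewrite /S e//; ring.
  + exists (C * lam) => f /Lfun2_sqi sf.
    by rewrite !Lnorm2E//; [rewrite -EFinM lee_fin; exact: SN|have [] := Sn f sf].
- move=> f Df /Lfun2_sqi sf.
  by apply: filterS (S0T f Df sf) => x e xT; rewrite /S e// mulrC divfK// gt_eqF.
- apply: ereal_inf_lbound; exists (C * lam) => //=; split; first by rewrite mulr_ge0// ltW.
  move=> f g /Lfun2_sqi sf /Lfun2_sqi sg; rewrite !Lnorm2E// -!EFinM lee_fin.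
  have [sS _] := Sn f sf; have cs := cauchy_schwarz sS sg.
  apply: (@le_trans _ _ (Num.sqrt (sqn mu (S f)) * Num.sqrt (sqn mu g))).
    by rewrite -sqrtrM ?sqn_ge0// -sqrtr_sqr ler_wsqrtr.
  by rewrite ler_wpM2r ?sqrtr_ge0// SN.
Qed.
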